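(* Let $\lambda(D)$ be the principal eigenvalue of the Dirichlet problem $$-D\Delta \phi -2\alpha\nabla m(x)\cdot \nabla\phi+V(x)\phi=\lambda\phi \ \text{ in }\Omega,\qquad \phi=0\ \text{ on }\partial\Omega.$$ Set $\Sigma_1=\{x\in\Omega:\ |\nabla m(x)|=0\}$ and $\Sigma_2=\{x\in\partial\Omega:\ |\nabla m(x)|=0\}$. Then the following hold. (i) If $\Sigma_1\cup\Sigma_2=\emptyset$, then $\lim_{D\to0}\lambda(D)=+\infty$. (ii) If $\Sigma_1\cup\Sigma_2\neq\emptyset$, and if for every $x\in\Sigma_2$ the vector $n(x)$ is an eigenvector of the Hessian $D^2m(x)$ with corresponding eigenvalue $\kappa_N=0$, then $$\lim_{D\to0}\lambda(D)=\min_{x\in\Sigma_1\cup\Sigma_2}\Big\{V(x)+\alpha\sum_{i=1}^N\big(|\kappa_i(x)|+\kappa_i(x)\big)\Big\},$$ where $\kappa_1(x),\dots,\kappa_N(x)$ are the eigenvalues of $D^2m(x)$.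
   Context: $\Omega\subset\mathbb{R}^N$ is a bounded smooth domain, $n(x)$ is the unit exterior normal to $\partial\Omega$ at $x\in\partial\Omega$, $\alpha>0$ is a fixed constant, $D>0$ is a parameter, and $m\in C^2(\bar\Omega)$, $V\in C(\bar\Omega)$ are given functions. The principal eigenvalue is the smallest eigenvalue; it is the one corresponding to a positive eigenfunction. Here $D^2m(x)$ denotes the Hessian matrix of $m$ (the symbol $D$ in $D^2m$ is differentiation, not the diffusion coefficient). *)

(* Defs.v *)
From HB Require Import structures.
From mathcomp Require Import all_boot all_order all_algebra.
From mathcomp Require Import all_classical all_reals all_analysis.
Set Implicit Arguments.
Unset Strict Implicit.
Unset Printing Implicit Defensive.
Import Order.TTheory GRing.Theory Num.Theory.
Import numFieldNormedType.Exports.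
Local Open Scope classical_set_scope.
Local Open Scope ring_scope.

(* The norm that the library puts on 'rV[R]_N is the sup norm; it is used only
   for topology and boundedness. *)
Definition dot (R : realType) (N : nat) (u v : 'rV[R]_N) : R :=
  \sum_(i < N) u 0 i * v 0 i.

Definition enorm (R : realType) (N : nat) (u : 'rV[R]_N) : R :=
  Num.sqrt (dot u u).

Definition boundary (T : topologicalType) (A : set T) : set T :=
  closure A `\` interior A.

Definition pd (R : realType) (N : nat) (i : 'I_N) (f : 'rV[R]_N -> R)
    (x : 'rV[R]_N) : R :=
  'D_(delta_mx 0 i) f x.

Definition grad (R : realType) (N : nat) (f : 'rV[R]_N -> R)
    (x : 'rV[R]_N) : 'rV[R]_N :=
  \row_i pd i f x.

(* C^k(U), for U open. *)
Fixpoint Ck_on (R : realType) (N k : nat) (U : set 'rV[R]_N)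
    (f : 'rV[R]_N -> R) : Prop :=
  (forall x, U x -> {for x, continuous f}) /\
  (if k is k'.+1 then
     forall i : 'I_N,
       (forall x, U x -> derivable f x (delta_mx 0 i)) /\ Ck_on k' U (pd i f)
   else True).

(* All partial derivatives of f of order <= k exist in the open set U and have
   limits from U at every point of closure U; by regularity of R these limits
   form a continuous extension.  At x in U the filter within U (nbhs x) is
   nbhs x, so that the condition includes continuity in U. *)
Fixpoint Ck_ext (R : realType) (N k : nat) (U : set 'rV[R]_N)
    (f : 'rV[R]_N -> R) : Prop :=
  (forall x, closure U x -> cvg (f y @[y --> within U (nbhs x)])) /\
  (if k is k'.+1 then
     forall i : 'I_N,
       (forall x, U x -> derivable f x (delta_mx 0 i)) /\ Ck_ext k' U (pd i f)
   else True).

(* C^k(closure U); only the values of f on closure U matter. *)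
Definition Ck_closure (R : realType) (N k : nat) (U : set 'rV[R]_N)
    (f : 'rV[R]_N -> R) : Prop :=
  {within closure U, continuous f} /\ Ck_ext k U f.

(* Continuous extension of f from U to closure U. *)
Definition ext (R : realType) (N : nat) (U : set 'rV[R]_N)
    (f : 'rV[R]_N -> R) (x : 'rV[R]_N) : R :=
  lim (f y @[y --> within U (nbhs x)]).

Definition cgrad (R : realType) (N : nat) (U : set 'rV[R]_N)
    (f : 'rV[R]_N -> R) (x : 'rV[R]_N) : 'rV[R]_N :=
  \row_i ext U (pd i f) x.

Definition chess (R : realType) (N : nat) (U : set 'rV[R]_N)
    (f : 'rV[R]_N -> R) (x : 'rV[R]_N) : 'M[R]_N :=
  \matrix_(i, j) ext U (pd i (pd j f)) x.

(* rho is a smooth defining function of Omega near the boundary point x. *)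
Definition defining_function (R : realType) (N : nat) (Omega : set 'rV[R]_N)
    (x : 'rV[R]_N) (U : set 'rV[R]_N) (rho : 'rV[R]_N -> R) : Prop :=
  [/\ open U, U x, (forall k, Ck_on k U rho),
      (forall y, U y -> (Omega y <-> rho y < 0)) & grad rho x != 0].

Definition bounded_smooth_domain (R : realType) (N : nat)
    (Omega : set 'rV[R]_N) : Prop :=
  [/\ Omega !=set0, open Omega, connected Omega, bounded_set Omega &
      forall x, boundary Omega x ->
        exists U, exists rho, defining_function Omega x U rho].

Definition unit_exterior_normal (R : realType) (N : nat)
    (Omega : set 'rV[R]_N) (x nu : 'rV[R]_N) : Prop :=
  exists U, exists rho, defining_function Omega x U rho /\
    nu = (enorm (grad rho x))^-1 *: grad rho x.

(* Integral over R^N as an iterated Lebesgue integral: it is only applied to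
   continuous functions with compact support, where this is the Lebesgue
   integral by Fubini's theorem. *)
Fixpoint intRN (R : realType) (N : nat) : ('rV[R]_N -> R) -> R :=
  match N return ('rV[R]_N -> R) -> R with
  | 0%N => fun f => f 0
  | N'.+1 => fun f =>
      \int[@lebesgue_measure R]_t
        @intRN R N' (fun y : 'rV[R]_N' =>
          f (row_mx (t%:M : 'rV[R]_1) y : 'rV[R]_(1 + N')))
  end.

Definition int_on (R : realType) (N : nat) (Omega : set 'rV[R]_N)
    (f : 'rV[R]_N -> R) : R :=
  intRN (f \_ Omega).

Definition test_function (R : realType) (N : nat) (Omega : set 'rV[R]_N)
    (psi : 'rV[R]_N -> R) : Prop :=
  Ck_on 1 setT psi /\
  exists K : set 'rV[R]_N,
    [/\ compact K, K `<=` Omega & forall x, ~ K x -> psi x = 0].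

(* phi is an eigenfunction, with eigenvalue mu, of
     - D Laplace(phi) - 2 alpha grad m . grad phi + V phi = mu phi   in Omega,
     phi = 0                                                on boundary Omega.
   Since V is only continuous, eigenfunctions need not be C^2: they lie in
   W^{2,p}(Omega) for all p < oo, hence in C^1(closure Omega).  The equation
   is therefore understood in the weak sense, after integrating the Laplacian
   by parts once. *)
Definition eigenfunction (R : realType) (N : nat) (Omega : set 'rV[R]_N)
    (alpha : R) (m V : 'rV[R]_N -> R) (D mu : R) (phi : 'rV[R]_N -> R) :
    Prop :=
  [/\ Ck_closure 1 Omega phi,
      (forall x, boundary Omega x -> phi x = 0),
      (exists2 x, Omega x & phi x != 0) &
      forall psi, test_function Omega psi ->
        int_on Omega (fun x =>
            D * dot (grad phi x) (grad psi x)
            - 2 * alpha * dot (grad m x) (grad phi x) * psi x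
            + V x * phi x * psi x)
        = int_on Omega (fun x => mu * phi x * psi x)].

Definition principal_eigenvalue (R : realType) (N : nat)
    (Omega : set 'rV[R]_N) (alpha : R) (m V : 'rV[R]_N -> R) (D lam : R) :
    Prop :=
  (exists2 phi, eigenfunction Omega alpha m V D lam phi &
     forall x, Omega x -> 0 < phi x) /\
  (forall mu phi, eigenfunction Omega alpha m V D mu phi -> lam <= mu).

Definition Sigma1 (R : realType) (N : nat) (Omega : set 'rV[R]_N)
    (m : 'rV[R]_N -> R) : set 'rV[R]_N :=
  [set x | Omega x /\ enorm (cgrad Omega m x) = 0].

Definition Sigma2 (R : realType) (N : nat) (Omega : set 'rV[R]_N)
    (m : 'rV[R]_N -> R) : set 'rV[R]_N :=
  [set x | boundary Omega x /\ enorm (cgrad Omega m x) = 0].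

(* The roots of the characteristic polynomial, with multiplicity. *)
Definition eigenvalues (R : realType) (N : nat) (A : 'M[R]_N)
    (k : 'I_N -> R) : Prop :=
  char_poly A = \prod_(i < N) ('X - (k i)%:P).

Definition eigenvector (R : realType) (N : nat) (A : 'M[R]_N) (a : R)
    (v : 'rV[R]_N) : Prop :=
  v != 0 /\ A *m v^T = a *: v^T.

Definition is_min (R : realType) (T : Type) (S : set T) (F : T -> R)
    (mu : R) : Prop :=
  (exists2 x, S x & F x = mu) /\ (forall x, S x -> mu <= F x).

(* Main.v *)
Require Import Defs.
From mathcomp Require Import all_boot all_order all_algebra.
From mathcomp Require Import ring lra.
From mathcomp Require Import all_classical all_reals all_analysis.
Import Order.TTheory GRing.Theory Num.Theory.
Import numFieldNormedType.Exports.
Local Open Scope classical_set_scope.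
Local Open Scope ring_scope.
Set Implicit Arguments.
Unset Strict Implicit.
Unset Printing Implicit Defensive.

(* Multiplying the equation by w = exp (2 alpha m / D) makes it variational: the
   principal eigenvalue is the infimum over compactly supported psi of
     int w (D |grad psi|^2 + V psi^2) / int w psi^2.
   The upper half of this is Picone's inequality for the positive eigenfunction
   (eigenvalue_le).  The lower half, in the form eigenvalue_ge, tests the
   equation with w eta(phi), where eta is a truncation, and completes a square
   with a vector field Y:  the eigenvalue is at least
     inf ((2 alpha grad m . Y - |Y|^2) / D + div Y + V).
   All comparisons of integrals are pointwise inequalities between integrands
   up to the divergence of a compactly supported field.

   Lower bound: Y = alpha (grad m + T grad m), where T is a combination of
   contractions close to sign (D^2 m (x_j)) for finitely many critical points
   x_j, with weights b_j / (|grad m|^2 + sum b_j) given by bumps b_j.  The bound is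
   large where grad m <> 0, and near x_j it is close to
     V + alpha tr (D^2 m) + alpha sum |kappa_i|.

   Upper bound: near a critical point, test with (1 - q / (2 k))_+^k, where q is
   the quadratic form (alpha / D) y P y^T and P is close to |D^2 m|.  At a
   boundary critical point the test function is moved into Omega by a multiple
   of sqrt D along the normal, which D^2 m annihilates.

   The minimum is attained: otherwise the lower bound, which involves finitely
   many critical points only, would contradict the upper bound at another one. *)

(** * Pointwise continuity *)

(** With g = psi exp (alpha m / D) the quotient becomes that of - D Laplace + alpha^2 |grad m|^2 / D
    + alpha Laplace m + V. Near a critical point with Hessian H this is a harmonic oscillator with
    potential alpha^2 |y H|^2 / D: its ground state exp (- alpha y |H| y^T / (2 D)) lives at scale
    sqrt D, and its ground energy alpha sum |kappa_i| does not depend on D. Hence the limit, the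
    form q and the size of the shift. In the lower bound, Y = alpha (grad m + W) turns the 1 / D
    term into alpha^2 (|grad m|^2 - |W|^2) / D. A contraction T with W = T grad m keeps it
    nonnegative, while div Y gains alpha tr (T D^2 m), whose supremum over contractions is alpha sum
    |kappa_i|. Strict contraction leaves a multiple of |grad m|^2 / D, which pays for the
    derivatives of T and for weights whose sum is below 1. The normal enters in the upper bound
    alone: Y is free at the boundary, whereas a test function must fit into Omega. *)

Section PointwiseContinuity.
Context {R : realType} {T : topologicalType}.
Implicit Types (f g : T -> R) (x : T).

Lemma cfor_cst x (c : R) : {for x, continuous (fun _ : T => c)}.
Proof. exact: cvg_cst. Qed.

Lemma cforD x f g : {for x, continuous f} -> {for x, continuous g} ->
  {for x, continuous (fun y => f y + g y)}.
Proof. by move=> fx gx; exact: (@cvgD _ _ _ _ _ f g _ _ fx gx). Qed.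

Lemma cforN x f : {for x, continuous f} -> {for x, continuous (fun y => - f y)}.
Proof. by move=> fx; exact: (@cvgN _ _ _ _ _ f _ fx). Qed.

Lemma cforB x f g : {for x, continuous f} -> {for x, continuous g} ->
  {for x, continuous (fun y => f y - g y)}.
Proof. by move=> fx gx; apply: cforD => //; exact: cforN. Qed.

Lemma cforM x f g : {for x, continuous f} -> {for x, continuous g} ->
  {for x, continuous (fun y => f y * g y)}.
Proof. by move=> fx gx; exact: (@cvgM _ _ _ _ f g _ _ fx gx). Qed.

Lemma cfor_comp x f (h : R -> R) : {for x, continuous f} ->
  {for (f x), continuous h} -> {for x, continuous (fun y => h (f y))}.
Proof. by move=> fx hx; exact: (continuous_comp fx hx). Qed.

Lemma cforV x f : f x != 0 -> {for x, continuous f} ->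
  {for x, continuous (fun y => (f y)^-1)}.
Proof. by move=> fx0 fx; exact: (@cvgV _ _ _ _ f _ fx0 fx). Qed.

Lemma cforX x f k : {for x, continuous f} ->
  {for x, continuous (fun y => f y ^+ k)}.
Proof.
move=> fx; elim: k => [|k ih]; first exact: cfor_cst.
rewrite (_ : (fun y => _) = (fun y => f y * f y ^+ k)); first exact: cforM.
by apply/funext => y; rewrite exprS.
Qed.

Lemma cfor_sum x (I : Type) (s : seq I) (F : I -> T -> R) :
  (forall i, {for x, continuous (F i)}) ->
  {for x, continuous (fun y => \sum_(i <- s) F i y)}.
Proof.
move=> Fx; elim: s => [|i s ih].
  rewrite (_ : (fun y => _) = (fun=> 0)); first exact: cfor_cst.
  by apply/funext => y; rewrite big_nil.
rewrite (_ : (fun y => _) = (fun y => F i y + \sum_(j <- s) F j y)); first exact: cforD.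
by apply/funext => y; rewrite big_cons.
Qed.

Lemma cfor_near x f g : (\near x, f x = g x) ->
  {for x, continuous f} -> {for x, continuous g}.
Proof.
move=> fg fx; rewrite /prop_for /continuous_at -(nbhs_singleton fg).
by apply: cvg_trans fx; exact: near_eq_cvg.
Qed.

End PointwiseContinuity.
Arguments cfor_cst {R T} x c.

Section DistContinuity.
Context {R : realType} {V : normedModType R}.

Lemma cfor_distP (f : V -> R) (x : V) : {for x, continuous f} <->
  forall e, 0 < e -> exists2 d, 0 < d & forall y, `|x - y| < d -> `|f x - f y| < e.
Proof.
split=> [fx e e0|H].
  have /fx : nbhs (f x) (ball (f x) e) by exact: nbhsx_ballx.
  move=> /nbhs_ballP[d d0 fd]; exists d => // y xy.
  by have := fd y; rewrite -!ball_normE; apply.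
apply: (iffRL (@cvgrPdist_lt _ _ _ _ _ _ _)) => e e0; have [d d0 fd] := H e e0.
by apply/nbhs_ballP; exists d => // y; rewrite -ball_normE; exact: fd.
Qed.

End DistContinuity.

(** * Integrals of compactly supported continuous functions *)

Section OneDim.
Context {R : realType}.
Local Notation mu := (@lebesgue_measure R).
Implicit Types (f g : R -> R) (a b c M : R).

Lemma cst_compact_supp_integrable f M : continuous f ->
  (forall t, M < `|t| -> f t = 0) -> mu.-integrable setT (EFin \o f).
Proof.
move=> fc f0.
have fE : f = f \_ `[- M, M].
  apply/funext => t; rewrite patchE; case: ifPn => //.
  by rewrite notin_setE /= in_itv /= -ler_norml => /negP; rewrite -ltNge => /f0.
have fi : mu.-integrable `[- M, M] (EFin \o f).
  apply: continuous_compact_integrable; first exact: segment_compact.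
  exact: continuous_subspaceT.
have mM : measurable (`[- M, M] : set (measurableTypeR R)) by [].
rewrite fE; have := iffLR (integrable_mkcond _ mM) fi.
by rewrite restrict_EFin.
Qed.

Lemma Rintegral_segment_cst a b c : a <= b ->
  \int[mu]_(t in `[a, b]) c = c * (b - a).
Proof.
move=> ab; rewrite Rintegral_cst //; congr (_ * _).
transitivity (fine (if a%:E < b%:E then b%:E - a%:E else 0)%E).
  by congr fine; exact: (lebesgue_measure_itv `[a, b]).
rewrite lte_fin; case: ltP => //= ba.
by rewrite (@le_anti _ _ a b) ?subrr // ab ba.
Qed.

Lemma Rintegral_supp f M : (forall t, M < `|t| -> f t = 0) ->
  \int[mu]_t f t = \int[mu]_(t in `[- M, M]) f t.
Proof.
move=> f0; rewrite [RHS]Rintegral_mkcond; congr Rintegral.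
apply/funext => t; rewrite patchE; case: ifPn => //.
by rewrite notin_setE /= in_itv /= -ler_norml => /negP; rewrite -ltNge => /f0.
Qed.

Lemma Rintegral_bound f M c : 0 <= M -> continuous f ->
  (forall t, M < `|t| -> f t = 0) -> (forall t, `|f t| <= c) ->
  `|\int[mu]_t f t| <= c * (2 * M).
Proof.
move=> M0 fc f0 fb; rewrite (Rintegral_supp f0).
have fi : mu.-integrable `[- M, M] (EFin \o f).
  apply: continuous_compact_integrable; first exact: segment_compact.
  exact: continuous_subspaceT.
apply: le_trans (le_normr_Rintegral _ _) _ => //.
apply: le_trans (_ : \int[mu]_(t in `[- M, M]) c <= _).
  apply: le_Rintegral => //.
  - apply: continuous_compact_integrable; first exact: segment_compact.
    apply: continuous_subspaceT => x; apply: continuous_comp; first exact: fc.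
    exact: norm_continuous.
  - apply: continuous_compact_integrable; first exact: segment_compact.
    by apply: continuous_subspaceT => x; exact: cvg_cst.
rewrite Rintegral_segment_cst; last lra.
by rewrite opprK mulr2n mulrDl mul1r.
Qed.

Lemma Rintegral_shift f M h : continuous f ->
  (forall t, M < `|t| -> f t = 0) ->
  \int[mu]_t f (t + h) = \int[mu]_t f t.
Proof.
move=> fc f0.
(* Large enough that [-L, L] contains the support of the translate and [-L + h, L + h] that of [f];
   substitution then takes place on compact intervals. *)
pose L := `|M| + `|h| + 1.
have L0 : 0 < L by rewrite /L ltr_wpDl // addr_ge0.
have hle := ler_norm h; have hle' := ler_norm (- h); rewrite normrN in hle'.
have Mle := ler_norm M.
have f1 : \int[mu]_t f t = \int[mu]_(t in `[- L + h, L + h]) f t.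
  rewrite [RHS]Rintegral_mkcond; congr Rintegral.
  apply/funext => t; rewrite patchE; case: ifPn => //.
  rewrite notin_setE /= in_itv /= => /negP tL; apply: f0.
  rewrite ltNge; apply: contra tL; rewrite ler_norml => /andP[? ?].
  by apply/andP; split; rewrite /L; lra.
have f2 : \int[mu]_t f (t + h) = \int[mu]_(t in `[- L, L]) f (t + h).
  rewrite [RHS]Rintegral_mkcond; congr Rintegral.
  apply/funext => t; rewrite patchE; case: ifPn => //.
  rewrite notin_setE /= in_itv /= => /negP tL; apply: f0.
  rewrite ltNge; apply: contra tL; rewrite ler_norml => /andP[? ?].
  by apply/andP; split; rewrite /L; lra.
rewrite f1 f2 /Rintegral; congr fine.
have dE : derive1 (shift h : R -> R) = cst 1.
  by apply/funext => x; rewrite derive1E; exact: (@derive_val _ _ _ _ _ _ _ (is_derive_shift x 1 h)).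
rewrite (@integration_by_substitution_increasing _ (shift h) f (- L) L).
- apply: eq_integral => t _ /=; rewrite /GRing.mul /= dE /= mulr1 //.
- lra.
- by move=> x y _ _ xy; rewrite /= ltrD2r.
- by move=> x _; rewrite dE; exact: cvg_cst.
- by rewrite dE; exact: is_cvg_cst.
- by rewrite dE; exact: is_cvg_cst.
- have sc : continuous (shift h : R -> R).
    by move=> x; apply: cvgD; [exact: cvg_id|exact: cvg_cst].
  split.
  + by move=> x _; exact: (@ex_derive _ _ _ _ _ _ _ (is_derive_shift x 1 h)).
  + exact/cvg_at_right_filter/sc.
  + exact/cvg_at_left_filter/sc.
- exact: continuous_subspaceT.
Qed.

Lemma Rintegral_gt0 f M t0 : continuous f ->
  (forall t, M < `|t| -> f t = 0) -> (forall t, 0 <= f t) -> 0 < f t0 ->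
  0 < \int[mu]_t f t.
Proof.
move=> fc f0 fp ft0.
have /fc : nbhs (f t0) [set y | f t0 / 2 < y].
  by apply: lt_nbhsr; lra.
move=> /nbhs_ballP[r r0 rf].
have r2 : 0 < r / 2 by apply: divr_gt0.
have fi := cst_compact_supp_integrable fc f0.
pose A : set (measurableTypeR R) := `[t0 - r / 2, t0 + r / 2]%classic.
have mA : measurable A by exact: measurable_itv.
have : \int[mu]_(t in A) (f t0 / 2) <= \int[mu]_t f t.
  apply: le_trans (_ : \int[mu]_(t in A) f t <= _).
    apply: le_Rintegral => //.
    - apply: continuous_compact_integrable; first exact: segment_compact.
      by apply: continuous_subspaceT => x; exact: cvg_cst.
    - exact: integrableS fi.
    - move=> t; rewrite /A /= in_itv /= => /andP[t1 t2].
      apply/ltW/(rf t); rewrite /ball /= ltr_norml; apply/andP; split; lra.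
  rewrite /Rintegral; apply: fine_le.
  - apply: integrable_fin_num => //; exact: integrableS fi.
  - exact: integrable_fin_num.
  - apply: ge0_subset_integral => //; first by have /integrableP[] := fi.
    by move=> x _; rewrite lee_fin.
apply: lt_le_trans; rewrite Rintegral_segment_cst; last lra.
by apply: mulr_gt0; lra.
Qed.

End OneDim.

(** * Iterated integrals over R^n by slicing off the first coordinate *)

Section RowNorm.
Context {R : realType} {n : nat}.
Implicit Types x y : 'rV[R]_n.

Lemma rV_coord_le_norm x i : `|x 0 i| <= `|x|.
Proof.
rewrite [leRHS]/Num.norm /= mx_normrE; apply/bigmax_geP; right.
by exists (0, i).
Qed.

Lemma rV_norm_le x c : 0 <= c -> (forall i, `|x 0 i| <= c) -> `|x| <= c.
Proof.
move=> c0 xc; rewrite [leLHS]/Num.norm /= mx_normrE; apply/bigmax_leP; split => //.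
by move=> [i j] _ /=; rewrite ord1.
Qed.

End RowNorm.

Section Slices.
Context {R : realType} {n : nat}.

(** The very term on which [intRN] recurses, so that [intRNS] holds by conversion. *)
Definition slice (t : R) (y : 'rV[R]_n) : 'rV[R]_n.+1 :=
  row_mx (t%:M : 'rV[R]_1) y.

Lemma sliceE t y i : slice t y 0 i = if unlift ord0 i is Some j then y 0 j else t.
Proof.
rewrite /slice mxE; case: splitP => j.
  by rewrite ord1 => /= i0; rewrite (_ : i = ord0) ?unlift_none ?mxE ?eqxx //; apply/val_inj.
move=> ij; have -> : i = lift ord0 j by apply/val_inj.
by rewrite liftK.
Qed.

Lemma slice0 t y : slice t y 0 ord0 = t.
Proof. by rewrite sliceE unlift_none. Qed.

Lemma sliceS t y j : slice t y 0 (lift ord0 j) = y 0 j.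
Proof. by rewrite sliceE liftK. Qed.

Lemma slice_coords (x : 'rV[R]_n.+1) :
  slice (x 0 0) (\row_j x 0 (lift ord0 j)) = x.
Proof.
by apply/rowP => i; rewrite sliceE; case: unliftP => [j|] -> //; rewrite mxE.
Qed.

Lemma norm_slice_ge_l t y : `|t| <= `|slice t y|.
Proof. by rewrite -{1}(slice0 t y) rV_coord_le_norm. Qed.

Lemma norm_slice_ge_r t y : `|y| <= `|slice t y|.
Proof. by apply: rV_norm_le => // j; rewrite -(sliceS t) rV_coord_le_norm. Qed.

Lemma norm_slice_le t y c : `|t| <= c -> `|y| <= c -> `|slice t y| <= c.
Proof.
move=> tc yc; apply: rV_norm_le => [|i]; first exact: le_trans tc.
rewrite sliceE; case: unliftP => // j _.
exact: le_trans (rV_coord_le_norm _ _) yc.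
Qed.

Lemma sliceB t y s z : slice t y - slice s z = slice (t - s) (y - z).
Proof.
apply/rowP => i; rewrite [RHS]sliceE mxE [(- slice s z) 0 i]mxE !sliceE.
by case: unliftP => [j|] _ //; rewrite !mxE.
Qed.

End Slices.

Section CompactSupport.
Context {R : realType}.

Definition supp_le {n} (M : R) (f : 'rV[R]_n -> R) :=
  forall x, M < `|x| -> f x = 0.

(** A radius in place of a compact support: the same radius serves for all slices of [f]. *)
Definition Cc {n} (f : 'rV[R]_n -> R) :=
  continuous f /\ exists2 M, 0 <= M & supp_le M f.

Lemma supp_le_weak n (f : 'rV[R]_n -> R) M M' :
  M <= M' -> supp_le M f -> supp_le M' f.
Proof. by move=> MM' fM x xM; apply: fM; exact: le_lt_trans xM. Qed.

Lemma Cc_supp2 n (f g : 'rV[R]_n -> R) : Cc f -> Cc g ->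
  exists M, [/\ 0 <= M, supp_le M f & supp_le M g].
Proof.
move=> [_ [M M0 fM]] [_ [M' M'0 gM]]; exists (M + M'); split.
- exact: addr_ge0.
- by apply: supp_le_weak fM; rewrite lerDl.
- by apply: supp_le_weak gM; rewrite lerDr.
Qed.

Lemma CcD n (f g : 'rV[R]_n -> R) : Cc f -> Cc g -> Cc (fun x => f x + g x).
Proof.
move=> cf cg; have [M [M0 fM gM]] := Cc_supp2 cf cg.
move: cf cg => [fc _] [gc _]; split; last first.
  by exists M => // x xM; rewrite fM // gM // addr0.
by move=> x; apply: cforD; [exact: fc|exact: gc].
Qed.

Lemma CcZ n c (f : 'rV[R]_n -> R) : Cc f -> Cc (fun x => c * f x).
Proof.
move=> [fc [M M0 fM]]; split; last first.
  by exists M => // x xM; rewrite fM // mulr0.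
by move=> x; apply: cforM; [exact: cfor_cst|exact: fc].
Qed.

Lemma CcB n (f g : 'rV[R]_n -> R) : Cc f -> Cc g -> Cc (fun x => f x - g x).
Proof.
move=> cf cg; have -> : (fun x => f x - g x) = (fun x => f x + -1 * g x).
  by apply/funext => x; rewrite mulN1r.
by apply: CcD => //; exact: CcZ.
Qed.

Lemma Cc_cst0 n : Cc (fun _ : 'rV[R]_n => 0 : R).
Proof. by split; [move=> x; exact: cfor_cst|exists 0]. Qed.

Lemma Cc_unif_continuous n (f : 'rV[R]_n -> R) : Cc f -> forall e, 0 < e ->
  exists2 d, 0 < d & forall x y, `|x - y| < d -> `|f x - f y| < e.
Proof.
move=> [fc [M M0 fM]] e e0.
(* One unit larger than the support: since d < 1 below, a point outside [K] and its d-neighbours all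
   lie outside the support. *)
pose K : set 'rV[R]_n := [set x | `|x| <= M + 1].
have cK : compact K.
  apply: bounded_closed_compact.
    exists (M + 1); split; first exact: num_real.
    by move=> N MN x Kx; exact: le_trans (ltW MN).
  rewrite (_ : K = (fun x => `|x|) @^-1` [set r | r <= M + 1]) //.
  by apply: closed_comp; [move=> x _; exact: norm_continuous|exact: closed_le].
pose P (d : R) (x : 'rV[R]_n) := forall y, `|x - y| < d -> `|f x - f y| < e.
have : \forall d \near (0:R)^'+, K `<=` P d.
  move: cK => /compact_near_coveringP; apply => x _.
  have /fc : nbhs (f x) (ball (f x) (e / 2)) by apply: nbhsx_ballx; lra.
  move=> /nbhs_ballP[r r0 rf].
  exists (ball x (r / 2), [set d | d < r / 2]); first split => /=.
  - by apply: nbhsx_ballx; rewrite divr_gt0.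
  - by apply: nbhs_right_lt; rewrite divr_gt0.
  move=> [z d] [/=]; rewrite -!ball_normE /= => xz dr y zy.
  have fz : `|f x - f z| < e / 2.
    by apply: rf; rewrite -ball_normE /=; apply: lt_trans xz _; rewrite gtr_pMr// invf_lt1 // ltr1n.
  have fy : `|f x - f y| < e / 2.
    apply: rf; rewrite -ball_normE /= (_ : x - y = (x - z) + (z - y)); last by rewrite addrA subrK.
    by apply: le_lt_trans (ler_normD _ _) _; have := ltrD xz (lt_trans zy dr); rewrite -splitr.
  rewrite (_ : f z - f y = (f x - f y) - (f x - f z)); last by ring.
  by apply: le_lt_trans (ler_normB _ _) _; have := ltrD fy fz; rewrite -splitr.
move=> Kd; near (0:R)^'+ => d; exists d; first by near: d; exact: nbhs_right_gt.
move=> x y xy; case: (leP `|x| (M + 1)) => xM.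
  by apply: (near Kd d).
have d1 : d < 1 by near: d; exact: nbhs_right_lt.
have yM : M < `|y|.
  have := ler_normD (x - y) y; rewrite subrK => xy'; lra.
by rewrite !fM ?subrr ?normr0 //; lra.
Unshelve. all: end_near. Qed.
End CompactSupport.

Section IteratedIntegral.
Context {R : realType}.
Local Notation mu := (@lebesgue_measure R).

Lemma intRNS n (f : 'rV[R]_n.+1 -> R) :
  intRN f = \int[mu]_t intRN (fun y => f (slice t y)).
Proof. by []. Qed.

Lemma supp_le_slice n (f : 'rV[R]_n.+1 -> R) M t :
  supp_le M f -> supp_le M (fun y => f (slice t y)).
Proof. by move=> fM y yM; apply/fM/(lt_le_trans yM); exact: norm_slice_ge_r. Qed.

Lemma intRN0 n : intRN (fun _ : 'rV[R]_n => 0 : R) = 0.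
Proof.
elim: n => [//|n ih]; rewrite intRNS.
by under eq_Rintegral do rewrite ih; rewrite /Rintegral integral0.
Qed.

Lemma Cc_slice n (f : 'rV[R]_n.+1 -> R) t : Cc f -> Cc (fun y => f (slice t y)).
Proof.
move=> cf; have [fc [M M0 fM]] := cf; split; last first.
  by exists M => //; exact: supp_le_slice.
move=> y; apply/cfor_distP => e e0.
have [d d0 fd] := Cc_unif_continuous cf e0; exists d => // z yz; apply: fd.
rewrite sliceB subrr; apply: le_lt_trans yz; apply: norm_slice_le => //.
by rewrite normr0.
Qed.

Lemma slice_supp0 n (f : 'rV[R]_n.+1 -> R) M t : supp_le M f -> M < `|t| ->
  (fun y => f (slice t y)) = (fun=> 0).
Proof.
move=> fM Mt; apply/funext => y; apply: fM; apply: lt_le_trans Mt _.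
exact: norm_slice_ge_l.
Qed.

Lemma intRN_slice_supp n (f : 'rV[R]_n.+1 -> R) M t : supp_le M f -> M < `|t| ->
  intRN (fun y => f (slice t y)) = 0.
Proof. by move=> fM Mt; rewrite (slice_supp0 fM Mt) intRN0. Qed.

Definition intRN_sub_morph n := forall f g : 'rV[R]_n -> R, Cc f -> Cc g ->
  intRN (fun x => f x - g x) = intRN f - intRN g.

Definition intRN_estimate n := forall f : 'rV[R]_n -> R, Cc f ->
  forall M c : R, 0 <= M -> supp_le M f -> (forall x, `|f x| <= c) ->
  `|intRN f| <= c * (2 * M) ^+ n.

Lemma intRN_slice_continuous_of n (f : 'rV[R]_n.+1 -> R) :
  intRN_sub_morph n -> intRN_estimate n -> Cc f ->
  continuous (fun t => intRN (fun y => f (slice t y))).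
Proof.
move=> H1 H2 cf t; have [fc [M M0 fM]] := cf.
apply/cfor_distP => e e0.
pose C := (2 * M) ^+ n + 1.
have C0 : 0 < C by rewrite ltr_wpDl // exprn_ge0 // mulr_ge0.
have [d d0 fd] := Cc_unif_continuous cf (divr_gt0 e0 C0).
exists d => // s ts.
rewrite -H1; [|exact: Cc_slice..].
apply: le_lt_trans (H2 _ _ M (e / C) M0 _ _) _.
- by apply: CcB; exact: Cc_slice.
- by move=> y yM; rewrite !(supp_le_slice _ fM) ?subrr.
- move=> y; apply/ltW/fd; rewrite sliceB subrr.
  by apply: le_lt_trans ts; apply: norm_slice_le; rewrite ?normr0.
- by rewrite mulrAC ltr_pdivrMr // ltr_pM2l // /C ltrDl.
Qed.

(** Both properties go through one induction. In dimension n they make the integral over a slice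
    depend continuously on the slice; this gives the integrability on the line that both need in
    dimension n + 1. *)
Lemma intRN_sub_estimate n : intRN_sub_morph n /\ intRN_estimate n.
Proof.
elim: n => [|n [ihB ihb]].
  by split=> [f g _ _ //|f cf M c M0 fM fb]; rewrite expr0 mulr1; exact: fb.
have ihc (f : 'rV[R]_n.+1 -> R) : Cc f ->
  continuous (fun t => intRN (fun y => f (slice t y))).
  exact: intRN_slice_continuous_of.
split=> [f g cf cg|f cf M c M0 fM fb].
  have [M [M0 fM gM]] := Cc_supp2 cf cg; rewrite !intRNS.
  rewrite -RintegralB //.
  - by apply: eq_Rintegral => t _; rewrite -ihB //; exact: Cc_slice.
  - apply: (@cst_compact_supp_integrable _ _ M); first exact: ihc.
    by move=> t; exact: intRN_slice_supp.
  - apply: (@cst_compact_supp_integrable _ _ M); first exact: ihc.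
    by move=> t; exact: intRN_slice_supp.
rewrite intRNS exprSr mulrA; apply: Rintegral_bound => //; first exact: ihc.
  by move=> t; exact: intRN_slice_supp.
move=> t; apply: ihb => //; first exact: Cc_slice.
exact: supp_le_slice.
Qed.

Lemma intRN_slice_continuous n (f : 'rV[R]_n.+1 -> R) : Cc f ->
  continuous (fun t => intRN (fun y => f (slice t y))).
Proof. by have [? ?] := intRN_sub_estimate n; exact: intRN_slice_continuous_of. Qed.

Lemma intRN_slice_integrable n (f : 'rV[R]_n.+1 -> R) : Cc f ->
  mu.-integrable setT (EFin \o (fun t => intRN (fun y => f (slice t y)))).
Proof.
move=> cf; have [fc [M M0 fM]] := cf.
apply: (@cst_compact_supp_integrable _ _ M); first exact: intRN_slice_continuous.
by move=> t; exact: intRN_slice_supp.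
Qed.

Lemma intRNB n (f g : 'rV[R]_n -> R) : Cc f -> Cc g ->
  intRN (fun x => f x - g x) = intRN f - intRN g.
Proof. by have [+ _] := intRN_sub_estimate n; apply. Qed.

Lemma intRN_bound n (f : 'rV[R]_n -> R) M c : Cc f -> 0 <= M -> supp_le M f ->
  (forall x, `|f x| <= c) -> `|intRN f| <= c * (2 * M) ^+ n.
Proof. by have [_ h] := intRN_sub_estimate n; move=> *; exact: h. Qed.

Lemma intRNN n (f : 'rV[R]_n -> R) : Cc f -> intRN (fun x => - f x) = - intRN f.
Proof.
move=> cf; rewrite -[RHS]add0r -(intRN0 n) -intRNB //; last exact: Cc_cst0.
by congr intRN; apply/funext => x; rewrite add0r.
Qed.

Lemma intRND n (f g : 'rV[R]_n -> R) : Cc f -> Cc g ->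
  intRN (fun x => f x + g x) = intRN f + intRN g.
Proof.
move=> cf cg; rewrite -[intRN g]opprK -intRNN // -intRNB //.
  by congr intRN; apply/funext => x; rewrite opprK.
by rewrite (_ : (fun x => _) = (fun x => -1 * g x)); [exact: CcZ|apply/funext => x; rewrite mulN1r].
Qed.

Lemma intRNZ n c (f : 'rV[R]_n -> R) : Cc f ->
  intRN (fun x => c * f x) = c * intRN f.
Proof.
elim: n f => [//|n ih] f cf; rewrite !intRNS -RintegralZl //.
  by apply: eq_Rintegral => t _; rewrite ih //; exact: Cc_slice.
exact: intRN_slice_integrable.
Qed.

Lemma intRN_ge0 n (f : 'rV[R]_n -> R) : (forall x, 0 <= f x) -> 0 <= intRN f.
Proof.
elim: n f => [|n ih] f f0; first exact: f0.
by rewrite intRNS; apply: Rintegral_ge0 => t _; apply: ih.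
Qed.

Lemma le_intRN n (f g : 'rV[R]_n -> R) : Cc f -> Cc g ->
  (forall x, f x <= g x) -> intRN f <= intRN g.
Proof.
move=> cf cg fg; rewrite -subr_ge0 -intRNB //; apply: intRN_ge0 => x.
by rewrite subr_ge0.
Qed.

Lemma intRN_gt0 n (f : 'rV[R]_n -> R) x0 : Cc f -> (forall x, 0 <= f x) ->
  0 < f x0 -> 0 < intRN f.
Proof.
elim: n f x0 => [|n ih] f x0 cf f0 fx0; first by rewrite (thinmx0 x0) in fx0.
have [fc [M M0 fM]] := cf.
rewrite intRNS; apply: (@Rintegral_gt0 _ _ M (x0 0 0)).
- exact: intRN_slice_continuous.
- by move=> t; exact: intRN_slice_supp.
- by move=> t; exact: intRN_ge0.
- apply: (ih _ (\row_j x0 0 (lift ord0 j))) => //; first exact: Cc_slice.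
  by rewrite slice_coords.
Qed.

Lemma Cc_sum n (I : Type) (s : seq I) (F : I -> 'rV[R]_n -> R) :
  (forall i, Cc (F i)) -> Cc (fun x => \sum_(i <- s) F i x).
Proof.
move=> cF; elim: s => [|i s ih].
  by rewrite (_ : (fun x => _) = (fun=> 0)); [exact: Cc_cst0|apply/funext => y; rewrite big_nil].
rewrite (_ : (fun y => _) = (fun y => F i y + \sum_(j <- s) F j y)); first exact: CcD.
by apply/funext => y; rewrite big_cons.
Qed.

Lemma intRN_sum n (I : Type) (s : seq I) (F : I -> 'rV[R]_n -> R) :
  (forall i, Cc (F i)) ->
  intRN (fun x => \sum_(i <- s) F i x) = \sum_(i <- s) intRN (F i).
Proof.
move=> cF; elim: s => [|i s ih].
  by rewrite big_nil -[RHS](intRN0 n); congr intRN; apply/funext => y; rewrite big_nil.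
rewrite big_cons -ih -intRND //; last exact: Cc_sum.
by congr intRN; apply/funext => y; rewrite big_cons.
Qed.

Lemma Cc_shift n (f : 'rV[R]_n -> R) (v : 'rV[R]_n) : Cc f -> Cc (fun x => f (x + v)).
Proof.
move=> [fc [M M0 fM]]; split.
  move=> x; apply/cfor_distP => e e0.
  have /cfor_distP/(_ e e0)[d d0 fd] := fc (x + v).
  exists d => // y xy; apply: fd; rewrite (_ : _ - _ = x - y) //.
  by rewrite opprD addrACA subrr addr0.
exists (M + `|v|) => [|x xM]; first exact: addr_ge0.
by apply: fM; have := ler_normB (x + v) v; rewrite addrK => h; lra.
Qed.

Lemma shift_coordE n (x : 'rV[R]_n) h i k :
  (x + h *: delta_mx 0 i) 0 k = x 0 k + h * (k == i)%:R.
Proof. by rewrite !mxE eqxx. Qed.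

Lemma intRN_shift n (f : 'rV[R]_n -> R) i h : Cc f ->
  intRN (fun x => f (x + h *: delta_mx 0 i)) = intRN f.
Proof.
elim: n f i => [|n ih] f i cf; first by case: i.
have [fc [M M0 fM]] := cf; rewrite !intRNS.
case: (unliftP ord0 i) => [j|] ->.
  apply: eq_Rintegral => t _; rewrite -[RHS](ih _ j); last exact: Cc_slice.
  congr intRN; apply/funext => y; congr f; apply/rowP => k.
  rewrite shift_coordE !sliceE.
  case: unliftP => [k'|] ->.
    by rewrite shift_coordE (inj_eq lift_inj).
  by rewrite (negbTE (neq_lift _ _)) mulr0 addr0.
rewrite -[RHS](@Rintegral_shift _ _ M h).
- apply: eq_Rintegral => t _.
  congr intRN; apply/funext => y; congr f; apply/rowP => k.
  rewrite shift_coordE !sliceE.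
  case: unliftP => [k'|] ->; last by rewrite eqxx mulr1.
  by rewrite eq_sym (negbTE (neq_lift _ _)) mulr0 addr0.
- exact: intRN_slice_continuous.
- by move=> t; exact: intRN_slice_supp.
Qed.

End IteratedIntegral.

(** * Functions with continuous partial derivatives *)

Section PointwiseDerivative.
Context {R : realType} {V : normedModType R}.
Implicit Types (f g : V -> R) (x v : V) (a b : R).

(** Moves directional derivatives to the real line, where the one-variable chain rule applies. *)
Lemma is_derive_lineP f x v a :
  is_derive x v f a <-> is_derive (0 : R) 1 (fun t => f (t *: v + x)) a.
Proof.
have E : 'D_1 (fun t : R => f (t *: v + x)) 0 = 'D_v f x.
  rewrite /derive; set g1 := fun h => h^-1 *: _; set g2 := fun h => h^-1 *: _.
  suff -> : g1 = g2 by [].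
  by rewrite funeqE /g1 /g2 => h /=; rewrite addr0 scale0r add0r [_%:A]mulr1.
split=> -[df dE]; apply: DeriveDef.
- exact: (iffLR (derivable1P _ _ _) df).
- by rewrite E.
- exact: (iffRL (derivable1P _ _ _) df).
- by rewrite -E.
Qed.

End PointwiseDerivative.

Section PointwiseDerivativeCalculus.
Context {R : realType} {V : normedModType R}.
Implicit Types (f g : V -> R) (x v : V) (a b : R).

Lemma is_derive_line f x v t a : is_derive (x + t *: v) v f a ->
  is_derive t 1 (fun s => f (x + s *: v)) a.
Proof.
move=> /is_derive_lineP h; apply: (iffRL (is_derive_lineP _ _ _ _)).
rewrite (_ : (fun s => _) = (fun s => f (s *: v + (x + t *: v)))) //.
by apply/funext => s; congr f; rewrite [s%:A]mulr1 scalerDl addrCA.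
Qed.

Lemma isder_cst x v a : is_derive x v (fun _ => a) 0.
Proof. exact: is_derive_cst. Qed.

Lemma isderD f g x v a b : is_derive x v f a -> is_derive x v g b ->
  is_derive x v (fun y => f y + g y) (a + b).
Proof. by move=> df dg; exact: is_deriveD. Qed.

Lemma isderN f x v a : is_derive x v f a ->
  is_derive x v (fun y => - f y) (- a).
Proof. by move=> df; exact: is_deriveN. Qed.

Lemma isderM f g x v a b : is_derive x v f a -> is_derive x v g b ->
  is_derive x v (fun y => f y * g y) (a * g x + f x * b).
Proof.
move=> df dg; have := @is_deriveM _ _ f g x v a b df dg.
by rewrite addrC ![_ *: _]/GRing.scale /= [g x * a]mulrC.
Qed.

Lemma isder_comp f x v a (h : R -> R) b : is_derive x v f a ->
  is_derive (f x) 1 h b -> is_derive x v (fun y => h (f y)) (b * a).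
Proof.
move=> /is_derive_lineP df dh; apply: (iffRL (is_derive_lineP _ _ _ _)).
apply: (@is_derive1_comp _ h (fun t => f (t *: v + x))) => //.
by rewrite scale0r add0r.
Qed.

Lemma isder_near f g x v a : (\near x, f x = g x) -> is_derive x v f a ->
  is_derive x v g a.
Proof. exact: near_eq_is_derive. Qed.

Lemma isder_sum x v (I : Type) (s : seq I) (F : I -> V -> R) (a : I -> R) :
  (forall i, is_derive x v (F i) (a i)) ->
  is_derive x v (fun y => \sum_(i <- s) F i y) (\sum_(i <- s) a i).
Proof.
move=> dF; elim: s => [|i s ih].
  rewrite big_nil (_ : (fun y => _) = (fun=> 0)); first exact: isder_cst.
  by apply/funext => y; rewrite big_nil.
rewrite big_cons (_ : (fun y => _) = (fun y => F i y + \sum_(j <- s) F j y)).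
  exact: isderD.
by apply/funext => y; rewrite big_cons.
Qed.

End PointwiseDerivativeCalculus.

Section C1.
Context {R : realType} {n : nat}.
Local Notation V := 'rV[R]_n.
Implicit Types (U : set V) (f g : V -> R) (df dg : 'I_n -> V -> R).

(** The partial derivatives are explicit data: the rules below compute them, and no [pd] of a
    compound expression has to be evaluated. *)
Definition C1 U f df := forall x, U x -> {for x, continuous f} /\
  forall i, is_derive x (delta_mx 0 i) f (df i x) /\ {for x, continuous (df i)}.

Lemma C1_cont U f df x : C1 U f df -> U x -> {for x, continuous f}.
Proof. by move=> h /h[]. Qed.

Lemma C1_der U f df x i : C1 U f df -> U x ->
  is_derive x (delta_mx 0 i) f (df i x).
Proof. by move=> h /h[_ /(_ i)[]]. Qed.

Lemma C1_dcont U f df x i : C1 U f df -> U x -> {for x, continuous (df i)}.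
Proof. by move=> h /h[_ /(_ i)[]]. Qed.

Lemma C1_eq U f df dg : C1 U f df -> (forall i x, df i x = dg i x) -> C1 U f dg.
Proof. by move=> h e; rewrite (_ : dg = df) //; apply/funext => i; apply/funext => x. Qed.

Lemma C1S U U' f df : U' `<=` U -> C1 U f df -> C1 U' f df.
Proof. by move=> s h x /s /h. Qed.

Lemma C1_cst U c : C1 U (fun=> c) (fun _ _ => 0).
Proof.
by move=> x _; split=> [|i]; [|split; [exact: isder_cst|]]; exact: cfor_cst.
Qed.

Lemma C1D U f df g dg : C1 U f df -> C1 U g dg ->
  C1 U (fun x => f x + g x) (fun i x => df i x + dg i x).
Proof.
move=> hf hg x Ux; have [cf df_] := hf x Ux; have [cg dg_] := hg x Ux.
split=> [|i]; first exact: cforD.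
have [? ?] := df_ i; have [? ?] := dg_ i.
by split; [exact: isderD|exact: cforD].
Qed.

Lemma C1M U f df g dg : C1 U f df -> C1 U g dg ->
  C1 U (fun x => f x * g x) (fun i x => df i x * g x + f x * dg i x).
Proof.
move=> hf hg x Ux; have [cf df_] := hf x Ux; have [cg dg_] := hg x Ux.
split=> [|i]; first exact: cforM.
have [? ?] := df_ i; have [? ?] := dg_ i.
by split; [exact: isderM|apply: cforD; exact: cforM].
Qed.

Lemma C1Z U c f df : C1 U f df -> C1 U (fun x => c * f x) (fun i x => c * df i x).
Proof.
move=> hf; have := C1M (@C1_cst U c) hf; move/C1_eq; apply => i x.
by rewrite mul0r add0r.
Qed.

Lemma C1N U f df : C1 U f df -> C1 U (fun x => - f x) (fun i x => - df i x).
Proof.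
move=> hf x Ux; have [cf df_] := hf x Ux; split=> [|i]; first exact: cforN.
by have [? ?] := df_ i; split; [exact: isderN|exact: cforN].
Qed.

Lemma C1B U f df g dg : C1 U f df -> C1 U g dg ->
  C1 U (fun x => f x - g x) (fun i x => df i x - dg i x).
Proof. by move=> hf /C1N; exact: C1D. Qed.

Lemma C1_comp U (W : set R) f df (h dh : R -> R) : C1 U f df ->
  (forall x, U x -> W (f x)) ->
  (forall t, W t -> [/\ is_derive t 1 h (dh t), {for t, continuous h} &
                        {for t, continuous dh}]) ->
  C1 U (fun x => h (f x)) (fun i x => dh (f x) * df i x).
Proof.
move=> hf UW hh x Ux; have [cf df_] := hf x Ux; have [d1 c1 c2] := hh _ (UW _ Ux).
split=> [|i]; first exact: cfor_comp.
have [? ?] := df_ i; split; first exact: isder_comp.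
by apply: cforM => //; exact: cfor_comp.
Qed.

Lemma C1V U f df : C1 U f df -> (forall x, U x -> f x != 0) ->
  C1 U (fun x => (f x)^-1) (fun i x => - (f x) ^- 2 * df i x).
Proof.
move=> hf f0; apply: (@C1_comp U [set t | t != 0] f df GRing.inv (fun t => - t ^- 2)) => // t /= t0.
have ct : {for t, continuous (fun s : R => s)} by exact: cvg_id.
have cV : {for t, continuous (@GRing.inv R)} by exact: (@cforV _ _ t (fun s => s)).
split => //.
  have := @is_deriveV _ (fun s : R => s) t 1 1 t0 (is_derive_id _ _).
  by rewrite [_ *: _]mulr1.
apply: cforN; apply: (@cforV _ _ t (fun s => s ^+ 2)); first by rewrite expf_neq0.
exact: cforX.
Qed.

Lemma C1_sum U (I : Type) (s : seq I) (F : I -> V -> R) (dF : I -> 'I_n -> V -> R) :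
  (forall i, C1 U (F i) (dF i)) ->
  C1 U (fun x => \sum_(j <- s) F j x) (fun i x => \sum_(j <- s) dF j i x).
Proof.
move=> hF x Ux; split=> [|i].
  by apply: cfor_sum => j; exact: C1_cont (hF j) Ux.
split; first by apply: isder_sum => j; exact: C1_der (hF j) Ux.
by apply: cfor_sum => j; exact: C1_dcont (hF j) Ux.
Qed.

Lemma cfor_coord (x : V) j : {for x, continuous (fun y : V => y 0 j)}.
Proof. exact: coord_continuous. Qed.

Lemma C1_coord U j : C1 U (fun x => x 0 j) (fun i _ => (j == i)%:R).
Proof.
move=> x _; split=> [|i]; first exact: cfor_coord.
split; last exact: cfor_cst.
apply: (iffRL (is_derive_lineP _ _ _ _)).
rewrite (_ : (fun t => _) = (fun t : R => t * (j == i)%:R + x 0 j)).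
  have := @isderM _ _ (fun t : R => t) (fun=> (j == i)%:R) 0 1 1 0 (is_derive_id _ _) (isder_cst _ _ _).
  move=> h; have := isderD h (isder_cst (0:R) 1 (x 0 j)).
  by rewrite mul1r mul0r !addr0.
by apply/funext => t; rewrite addrC shift_coordE addrC.
Qed.

Lemma C1_Ck U f df : open U -> C1 U f df -> Ck_on 1 U f.
Proof.
move=> oU hf; split=> [x Ux|i]; first exact: C1_cont hf Ux.
split=> [x Ux|]; first by have [] := C1_der i hf Ux.
split=> // x Ux; apply: (@cfor_near _ _ _ (df i)); last exact: C1_dcont hf Ux.
apply: filterS (open_nbhs_nbhs (conj oU Ux)) => y Uy.
by have [_ <-] := C1_der i hf Uy.
Qed.

Lemma C1_grad U f df x i : C1 U f df -> U x -> grad f x 0 i = df i x.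
Proof. by move=> hf Ux; rewrite mxE; have [_ <-] := C1_der i hf Ux. Qed.

Lemma Ck_C1 U f : Ck_on 1 U f -> C1 U f (fun i => pd i f).
Proof.
move=> [cf h] x Ux; split=> [|i]; first exact: cf.
have [d [c _]] := h i; split; last exact: c.
by apply: derivableP; exact: d.
Qed.

Definition zext U f := f \_ U.

Lemma zext_in U f x : U x -> zext U f x = f x.
Proof. by move=> Ux; rewrite /zext patchE mem_set. Qed.

Lemma zext_out U f x : ~ U x -> zext U f x = 0.
Proof. by move=> Ux; rewrite /zext patchE memNset. Qed.

Definition supported_in U f := exists K : set V,
  [/\ compact K, K `<=` U & forall x, U x -> ~ K x -> f x = 0].

Lemma near_zext_in U f x : open U -> U x -> \near x, f x = zext U f x.
Proof.
move=> oU Ux; apply: filterS (open_nbhs_nbhs (conj oU Ux)) => y Uy.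
by rewrite zext_in.
Qed.

Lemma near_zext_out U f K x : compact K -> K `<=` U ->
  (forall x, U x -> ~ K x -> f x = 0) -> ~ K x -> \near x, 0 = zext U f x.
Proof.
move=> cK KU f0 Kx.
have oK : open (~` K) by apply: closed_openC; apply: compact_closed.
apply: filterS (open_nbhs_nbhs (conj oK Kx)) => y Ky.
have [Uy|Uy] := pselect (U y); first by rewrite zext_in // f0.
by rewrite zext_out.
Qed.

Lemma rV_compact_bounded (K : set V) : compact K ->
  exists2 M : R, 0 <= M & forall x, K x -> `|x| <= M.
Proof.
move=> /compact_bounded[M [_ KM]]; exists (`|M| + 1); first exact: addr_ge0.
by move=> x Kx; apply: (KM _ _ _ Kx); rewrite ltr_pwDr // ler_norm.
Qed.

(** Here and in [C1_zext], [U] and the complement of [K] are open and cover the space; the extension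
    is locally [f] on the first and 0 on the second. *)
Lemma Cc_zext U f : open U -> (forall x, U x -> {for x, continuous f}) ->
  supported_in U f -> Cc (zext U f).
Proof.
move=> oU cf [K [cK KU f0]]; split.
  move=> x; have [Kx|Kx] := pselect (K x).
    exact: cfor_near (near_zext_in f oU (KU _ Kx)) (cf _ (KU _ Kx)).
  exact: (@cfor_near _ _ x (fun=> 0) _ (near_zext_out cK KU f0 Kx) (cfor_cst _ _)).
have [M M0 KM] := rV_compact_bounded cK; exists M => // x xM.
have [Ux|Ux] := pselect (U x); last by rewrite zext_out.
by rewrite zext_in // f0 // => /KM; rewrite leNgt xM.
Qed.

Lemma C1_zext U f df : open U -> C1 U f df -> supported_in U f ->
  C1 setT (zext U f) (fun i => zext U (df i)) /\
  forall i, supported_in U (df i).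
Proof.
move=> oU hf [K [cK KU f0]].
have df0 i x : U x -> ~ K x -> df i x = 0.
  move=> Ux Kx; have [_ <-] := C1_der i hf Ux.
  apply: (@derive_val _ _ _ _ _ f 0); apply: (@isder_near _ _ (fun=> 0) _ _ _ _ _ (isder_cst _ _ 0)).
  have := near_zext_out cK KU f0 Kx; have := near_zext_in f oU Ux.
  by apply: filterS2 => y -> <-.
split; last by move=> i; exists K; split => // x; exact: df0.
move=> x _; have [Kx|Kx] := pselect (K x).
  have Ux := KU _ Kx.
  split; first exact: cfor_near (near_zext_in f oU Ux) (C1_cont hf Ux).
  move=> i; split; last exact: cfor_near (near_zext_in (df i) oU Ux) (C1_dcont hf Ux).
  rewrite zext_in //; exact: isder_near (near_zext_in f oU Ux) (C1_der i hf Ux).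
split; first exact: (@cfor_near _ _ x (fun=> 0) _ (near_zext_out cK KU f0 Kx) (cfor_cst _ _)).
move=> i; have N := near_zext_out cK KU (df0 i) Kx.
split; last exact: (@cfor_near _ _ x (fun=> 0) _ N (cfor_cst _ _)).
rewrite -(nbhs_singleton N).
exact: (@isder_near _ _ (fun=> 0) _ _ _ _ (near_zext_out cK KU f0 Kx) (isder_cst _ _ _)).
Qed.

Lemma MVT_delta f (fi : V -> R) i (x : V) h : 0 <= h ->
  (forall t, 0 <= t <= h -> is_derive (x + t *: delta_mx 0 i) (delta_mx 0 i) f
    (fi (x + t *: delta_mx 0 i))) ->
  exists2 t, 0 <= t <= h &
    f (x + h *: delta_mx 0 i) - f x = fi (x + t *: delta_mx 0 i) * h.
Proof.
move=> h0 fd.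
have dg t : 0 <= t <= h -> is_derive t 1 (fun s => f (x + s *: delta_mx 0 i))
    (fi (x + t *: delta_mx 0 i)) by move=> /fd; exact: is_derive_line.
have cg : {within `[0, h], continuous (fun s => f (x + s *: delta_mx 0 i))}.
  apply: derivable_within_continuous => t; rewrite in_itv /= => th.
  by have [] := dg t th.
have [t|t] := @MVT_segment _ (fun s => f (x + s *: delta_mx 0 i))
  (fun s => fi (x + s *: delta_mx 0 i)) 0 h h0 _ cg.
  by rewrite in_itv /= => /andP[t0 th]; apply: dg; rewrite !ltW.
by rewrite in_itv /= scale0r addr0 subr0 => th e; exists t.
Qed.

End C1.

(** * Divergences of compactly supported fields integrate to zero *)

Section Divergence.
Context {R : realType} {n : nat}.
Local Notation V := 'rV[R]_n.

Lemma norm_delta_le (i : 'I_n) : `|delta_mx 0 i : V| <= 1.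
Proof.
apply: rV_norm_le => // j; rewrite mxE eqxx /=; case: (j == i) => //=.
  by rewrite normr1.
by rewrite normr0.
Qed.

Lemma supp_le_der (f : V -> R) df M i : C1 setT f df -> supp_le M f ->
  supp_le M (df i).
Proof.
move=> hf fM x xM; have [_ <-] := C1_der i hf (I : setT x).
have N : \near x, 0 = f x.
  have oM : open [set y : V | M < `|y|].
    rewrite (_ : [set y | _] = (fun y : V => `|y|) @^-1` [set r | M < r]) //.
    by apply: open_comp; [move=> y _; exact: norm_continuous|exact: open_gt].
  by apply: filterS (open_nbhs_nbhs (conj oM xM)) => y /fM.
apply: (@derive_val _ _ _ _ _ f 0).
exact: (@isder_near _ _ (fun=> 0) _ _ _ _ N (isder_cst _ _ 0)).
Qed.

(* Translation invariance makes the difference quotients of f integrate to 0,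
   and they converge uniformly to the derivative. *)
Lemma intRN_der (f : V -> R) df i M : C1 setT f df -> supp_le M f ->
  intRN (df i) = 0.
Proof.
move=> hf fM0.
pose M1 := `|M| + 1.
have M10 : 0 <= M1 by rewrite /M1 addr_ge0.
have fM : supp_le `|M| f by apply: supp_le_weak fM0; exact: ler_norm.
have dfM : supp_le `|M| (df i) := supp_le_der i hf fM.
have cf : Cc f.
  by split; [move=> x; exact: C1_cont hf I|exists `|M|].
have cdf : Cc (df i).
  by split; [move=> x; exact: C1_dcont hf I|exists `|M|].
apply/eqP; rewrite -normr_eq0; apply/eqP/le_anti/andP; split=> //.
apply/ler_addgt0Pr => e e0; rewrite add0r.
pose C := (2 * M1) ^+ n + 1.
have C0 : 0 < C by rewrite ltr_wpDl // exprn_ge0 // mulr_ge0.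
have [d d0 fd] := Cc_unif_continuous cdf (divr_gt0 e0 C0).
pose h := Num.min (d / 2) 1.
have h0 : 0 < h by rewrite /h lt_min ltr01 andbT divr_gt0.
have hd : h < d by rewrite /h gt_min; apply/orP; left; rewrite gtr_pMr // invf_lt1 // ltr1n.
have h1 : h <= 1 by rewrite /h ge_min lexx orbT.
have nd := norm_delta_le i.
pose g x := h^-1 * (f (x + h *: delta_mx 0 i) - f x) - df i x.
have cs : Cc (fun x => f (x + h *: delta_mx 0 i)) by exact: Cc_shift.
have cB : Cc (fun x => f (x + h *: delta_mx 0 i) - f x) by exact: CcB.
have cZ : Cc (fun x => h^-1 * (f (x + h *: delta_mx 0 i) - f x)) by exact: CcZ.
have gE : intRN g = - intRN (df i).
  by rewrite /g intRNB // intRNZ // intRNB // intRN_shift // subrr mulr0 sub0r.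
rewrite -normrN -gE.
apply: le_trans (_ : e / C * (2 * M1) ^+ n <= _).
  apply: intRN_bound => //; first exact: CcB.
  - move=> x xM; rewrite /g dfM ?(fM x) ?fM ?subrr ?mulr0 ?subr0 //;
      try by move: xM; rewrite /M1; lra.
    have := ler_normB (x + h *: delta_mx 0 i) (h *: delta_mx 0 i).
    rewrite addrK normrZ (gtr0_norm h0) => k.
    have : h * `|delta_mx 0 i : V| <= 1 by rewrite mulr_ile1 // ltW.
    move: xM; rewrite /M1; lra.
  - move=> x; have [|t /andP[t0 th] E] := @MVT_delta _ _ f (df i) i x h (ltW h0).
      by move=> t _; exact: C1_der hf I.
    rewrite /g E mulrC mulfK ?gt_eqF // distrC; apply/ltW/fd.
    rewrite opprD addrA subrr sub0r normrN normrZ ger0_norm //.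
    apply: le_lt_trans hd; apply: le_trans th; by rewrite ler_piMr.
rewrite mulrAC ler_pdivrMr // ler_pM2l // /C; lra.
Qed.

Lemma zext_sum (U : set V) (I : Type) (s : seq I) (F : I -> V -> R) x :
  zext U (fun x => \sum_(i <- s) F i x) x = \sum_(i <- s) zext U (F i) x.
Proof.
have [Ux|Ux] := pselect (U x).
  by rewrite zext_in //; apply: eq_bigr => i _; rewrite zext_in.
by rewrite zext_out // big1 // => i _; rewrite zext_out.
Qed.

Lemma intRN_div (U : set V) (Z : 'I_n -> V -> R) (dZ : 'I_n -> 'I_n -> V -> R) :
  open U -> (forall i, C1 U (Z i) (dZ i)) -> (forall i, supported_in U (Z i)) ->
  Cc (zext U (fun x => \sum_i dZ i i x)) /\
  intRN (zext U (fun x => \sum_i dZ i i x)) = 0.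
Proof.
move=> oU hZ sZ.
have cZ i : Cc (zext U (dZ i i)).
  apply: Cc_zext => //; first by move=> x; exact: C1_dcont.
  by have [_ +] := C1_zext oU (hZ i) (sZ i); apply.
have E : zext U (fun x => \sum_i dZ i i x) = (fun x => \sum_i zext U (dZ i i) x).
  by apply/funext => x; exact: zext_sum.
rewrite E; split; first exact: Cc_sum.
rewrite intRN_sum // big1 // => i _.
have [h _] := C1_zext oU (hZ i) (sZ i).
have [_ [M M0 fM]] : Cc (zext U (Z i)).
  by apply: Cc_zext => // x; exact: C1_cont.
exact: (intRN_der i h fM).
Qed.

End Divergence.

(** * Limits from an open set to its closure *)

Section Closure.
Context {R : realType} {n : nat}.
Local Notation V := 'rV[R]_n.
Implicit Types (U : set V) (f : V -> R) (x y : V).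

Lemma closure_dist U x : closure U x ->
  forall d, 0 < d -> exists2 y, U y & `|x - y| < d.
Proof.
move=> Ux d d0; have [|y [Uy xy]] := Ux (ball x d); first exact: nbhsx_ballx.
by exists y => //; move: xy; rewrite -ball_normE.
Qed.

Lemma ext_dist U f x : closure U x -> cvg (f y @[y --> within U (nbhs x)]) ->
  forall e, 0 < e -> exists2 d, 0 < d & forall y, U y -> `|x - y| < d ->
    `|ext U f x - f y| < e.
Proof.
move=> Ux fx e e0.
have PF : ProperFilter (within U (nbhs x)) by exact: within_nbhs_proper.
have /nbhs_ballP[d d0 fd] : nbhs x [set y | U y -> `|ext U f x - f y| < e].
  exact: (iffLR (@cvgrPdist_lt _ _ _ _ _ _ _) fx e e0).
exists d => // y Uy xy; by apply: fd => //; rewrite -ball_normE.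
Qed.

Lemma cvg_within_continuous U f x : open U -> U x ->
  cvg (f y @[y --> within U (nbhs x)]) -> {for x, continuous f}.
Proof.
move=> oU Ux fx; have cUx := subset_closure Ux.
have H := ext_dist cUx fx.
(* The filter is not punctured, so [x] itself may be taken as a point close to [x]. *)
have E : ext U f x = f x.
  apply/eqP; rewrite -subr_eq0 -normr_eq0; apply/eqP/le_anti/andP; split => //.
  apply/ler_addgt0Pr => e e0; rewrite add0r.
  have [d d0 fd] := H e e0.
  by apply/ltW/fd => //; rewrite subrr normr0.
apply/cfor_distP => e e0; have [d d0 fd] := H e e0.
have /nbhs_ballP[r r0 rU] : nbhs x U by move/open_nbhs_nbhs: (conj oU Ux).
exists (Num.min d r); first by rewrite lt_min d0.
move=> y; rewrite lt_min => /andP[xd xr]; rewrite -E; apply: fd => //.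
by apply: rU; rewrite -ball_normE.
Qed.

Lemma within_closure_dist (A : set V) f x : A x -> {within A, continuous f} ->
  forall e, 0 < e -> exists2 d, 0 < d & forall y, A y -> `|x - y| < d ->
    `|f x - f y| < e.
Proof.
move=> Ax /subspace_continuousP/(_ x Ax) fx e e0.
have /nbhs_ballP[d d0 fd] : nbhs x [set y | A y -> `|f x - f y| < e].
  exact: (iffLR (@cvgrPdist_lt _ _ _ _ _ _ _) fx e e0).
exists d => // y Uy xy; by apply: fd => //; rewrite -ball_normE.
Qed.

Lemma within_closure_continuous U f x : open U -> U x ->
  {within closure U, continuous f} -> {for x, continuous f}.
Proof.
move=> oU Ux fc; apply/cfor_distP => e e0.
have [d d0 fd] := within_closure_dist (subset_closure Ux) fc e0.
have /nbhs_ballP[r r0 rU] : nbhs x U by move/open_nbhs_nbhs: (conj oU Ux).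
exists (Num.min d r); first by rewrite lt_min d0.
move=> y; rewrite lt_min => /andP[xd xr]; apply: fd => //.
by apply/subset_closure/rU; rewrite -ball_normE.
Qed.

Lemma Ck_ext_C1 U f : open U -> Ck_ext 1 U f -> C1 U f (fun i => pd i f).
Proof.
move=> oU [cf h] x Ux; have cUx := subset_closure Ux.
split=> [|i]; first exact: cvg_within_continuous (cf _ cUx).
have [d [c _]] := h i; split; last exact: cvg_within_continuous (c _ cUx).
by apply: derivableP; exact: d.
Qed.

Lemma Ck_ext_pd k U f i : Ck_ext k.+1 U f -> Ck_ext k U (pd i f).
Proof. by move=> [_ /(_ i)[_]]. Qed.

Lemma Ck_ext_cvg k U f x : Ck_ext k U f -> closure U x ->
  cvg (f y @[y --> within U (nbhs x)]).
Proof. by case: k => [|k] [+ _]; apply. Qed.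

Lemma Ck_extS k U f : Ck_ext k.+1 U f -> Ck_ext k U f.
Proof.
elim: k f => [|k ih] f [cf h]; split => // i.
have [d c] := h i; split => //; exact: ih.
Qed.

Lemma compact_ball_cover (K : set V) (r : V -> R) : compact K ->
  (forall x, K x -> 0 < r x) ->
  exists2 s : seq V, (forall x, x \in s -> K x) &
    forall y, K y -> exists2 x, x \in s & `|x - y| < r x.
Proof.
rewrite compact_cover => cK r0.
have [|y Ky|s sK Ks] := cK V K (fun x => ball x (r x)).
- by move=> x Kx; exact: ball_open.
- by exists y => //=; apply: ballxx; exact: r0.
exists (finmap.enum_fset s) => [x xs|y Ky]; first by have := sK x xs; rewrite inE.
by have [x /= xs] := Ks y Ky; rewrite -ball_normE /= => xy; exists x.
Qed.

Lemma ext_bounded U f : compact (closure U) ->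
  (forall x, closure U x -> cvg (f y @[y --> within U (nbhs x)])) ->
  exists2 C, 0 < C & forall x, U x -> `|f x| <= C.
Proof.
move=> cU fc.
have H x : exists d, closure U x -> 0 < d /\
    forall y, U y -> `|x - y| < d -> `|ext U f x - f y| < 1.
  have [Ux|Ux] := pselect (closure U x); last by exists 0.
  by have [d d0 fd] := ext_dist Ux (fc x Ux) ltr01; exists d.
have [r rP] := choice H.
have [x Kx|s sK Ks] := compact_ball_cover cU (r := r); first by have [] := rP x Kx.
exists (1 + \sum_(x <- s) (1 + `|ext U f x|)).
  by rewrite ltr_pwDl // sumr_ge0 // => i _; rewrite addr_ge0.
move=> y Uy; have [x xs xy] := Ks y (subset_closure Uy).
have [_ /(_ y Uy xy) h] := rP x (sK x xs).
have h1 : `|f y| <= 1 + `|ext U f x|.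
  have := ler_normB (ext U f x) (ext U f x - f y); rewrite opprB addrC subrK.
  by move=> h2; lra.
apply: le_trans h1 _; rewrite (big_rem x xs) /= addrC addrA.
have : 0 <= \sum_(z <- rem x s) (1 + `|ext U f z|).
  by rewrite sumr_ge0 // => i _; rewrite addr_ge0.
by lra.
Qed.

Lemma within_bounded (A : set V) f : compact A -> {within A, continuous f} ->
  exists2 C, 0 < C & forall x, A x -> `|f x| <= C.
Proof.
move=> cA fc; have [[x0 Ax0]|nA] := pselect (A !=set0); last first.
  by exists 1 => // x Ax; case: nA; exists x.
have [c _ cP] := EVT_max_rV (ex_intro _ x0 Ax0) cA fc.
have [d _ dP] := EVT_min_rV (ex_intro _ x0 Ax0) cA fc.
exists (`|f c| + `|f d| + 1); first by rewrite ltr_wpDl // addr_ge0.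
move=> x Ax; have := cP x (mem_set Ax); have := dP x (mem_set Ax).
have := ler_norm (f c); have := ler_norm (- f d); rewrite normrN.
have := normr_ge0 (f c); have := normr_ge0 (f d).
by move=> ? ? ? ? ? ?; rewrite ler_norml; apply/andP; split; lra.
Qed.

End Closure.

(** * Powers of the positive part *)

Section PositivePart.
Context {R : realType}.
Implicit Types u t : R.

Definition pos (u : R) : R := Num.max u 0.

Lemma pos_ge0 u : 0 <= pos u.
Proof. by rewrite le_max lexx orbT. Qed.

Lemma pos_le0 u : u <= 0 -> pos u = 0.
Proof. exact: max_r. Qed.

Lemma pos_id u : 0 <= u -> pos u = u.
Proof. exact: max_l. Qed.

Lemma cfor_pos u : {for u, continuous pos}.
Proof.
apply/cfor_distP => e e0; exists e => // y; apply: le_lt_trans.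
case: (lerP u 0) => u0; case: (lerP y 0) => y0.
- by rewrite !pos_le0 // subrr normr0.
- by rewrite pos_le0 // (pos_id (ltW y0)) sub0r normrN (ger0_norm (ltW y0)) ler0_norm; lra.
- by rewrite (pos_id (ltW u0)) (pos_le0 y0) subr0 (ger0_norm (ltW u0)) ger0_norm; lra.
- by rewrite (pos_id (ltW u0)) (pos_id (ltW y0)).
Qed.

(** Continuity of [p] at 0 suffices. This settles the corner of [pos] in [is_derive_posX], where the
    power k + 2 is u times the power k + 1. *)
Lemma is_derive_mulid (p : R -> R) : {for (0 : R), continuous p} ->
  is_derive (0 : R) 1 (fun u : R => u * p u) (p 0).
Proof.
move=> cp.
have C : (fun h => h^-1 *: (((fun u : R => u * p u) \o shift 0) (h *: (1 : R)) - 0 * p 0))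
    @ (0 : R)^' --> p 0.
  apply: cvg_trans (cvg_within_filter _ cp).
  apply: near_eq_cvg; near=> h.
  have h0 : h != 0 by near: h; exact: nbhs_dnbhs_neq.
  by rewrite /= addr0 [h%:A]mulr1 mul0r subr0 /GRing.scale /= mulKf.
by apply: DeriveDef; [apply/cvg_ex; exists (p 0)|exact: cvg_lim].
Unshelve. all: end_near. Qed.

Lemma is_derive_posX k t :
  is_derive t 1 (fun u => pos u ^+ k.+2) (k.+2%:R * pos t ^+ k.+1).
Proof.
case: (ltgtP t 0) => t0.
- rewrite pos_le0 ?ltW // expr0n mulr0.
  apply: (@isder_near _ _ (fun=> 0) _ _ _ _ _ (isder_cst _ _ 0)).
  near=> u; rewrite pos_le0 ?expr0n //; apply: ltW; near: u; exact: lt_nbhsl.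
- rewrite pos_id ?ltW //.
  have h := @is_deriveX _ _ id k.+1.+1 t 1 1 (is_derive_id _ _).
  rewrite [_ *: 1]mulr1 exprfctE in h.
  apply: (@isder_near _ _ (fun u => u ^+ k.+2) _ _ _ _ _ h).
  near=> u; rewrite pos_id //; apply: ltW; near: u; exact: lt_nbhsr.
- rewrite t0 (_ : (fun u => _) = (fun u : R => u * pos u ^+ k.+1)); last first.
    apply/funext => u; case: (lerP u 0) => u0; last by rewrite pos_id ?ltW // -exprS.
    by rewrite pos_le0 // !expr0n mulr0.
  have := @is_derive_mulid (fun u => pos u ^+ k.+1).
  rewrite pos_id // expr0n mulr0; apply.
  by apply: cforX; exact: cfor_pos.
Unshelve. all: end_near. Qed.

Lemma C1_posX n (U : set 'rV[R]_n) f df k : C1 U f df ->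
  C1 U (fun x => pos (f x) ^+ k.+2)
    (fun i x => k.+2%:R * pos (f x) ^+ k.+1 * df i x).
Proof.
move=> hf; apply: (@C1_comp _ _ U setT f df (fun u => pos u ^+ k.+2)
  (fun t => k.+2%:R * pos t ^+ k.+1)) => // t _; split.
- exact: is_derive_posX.
- by apply: cforX; exact: cfor_pos.
- by apply: cforM; [exact: cfor_cst|apply: cforX; exact: cfor_pos].
Qed.

End PositivePart.

(** * The weak formulation and bounds on the eigenvalue *)

Section WeakForm.
Context {R : realType} {n : nat}.
Local Notation V := 'rV[R]_n.
Context (Omega : set V) (oOmega : open Omega).
Context (alpha : R) (m v : V -> R).
Hypothesis m_C1 : C1 Omega m (fun i => pd i m).
Hypothesis v_cont : forall x, Omega x -> {for x, continuous v}.
Context (D mu : R) (D_gt0 : 0 < D) (phi : V -> R).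
Hypothesis phi_eig : eigenfunction Omega alpha m v D mu phi.
Hypothesis phi_gt0 : forall x, Omega x -> 0 < phi x.

Lemma eigenfunction_C1 : C1 Omega phi (fun i => pd i phi).
Proof. by have [[_ h] _ _ _] := phi_eig; exact: Ck_ext_C1. Qed.

(** The weak equation as a single integrand of integral 0, for [psi] given in [Omega] only.
    Pointwise comparison with other integrands is then enough. *)
Lemma eigenfunction_weak (psi : V -> R) dpsi :
  C1 Omega psi dpsi -> supported_in Omega psi ->
  let E x := \sum_i (D * (pd i phi x * dpsi i x)
               - 2 * alpha * (pd i m x * pd i phi x * psi x))
             + (v x - mu) * (phi x * psi x) in
  Cc (zext Omega E) /\ intRN (zext Omega E) = 0.
Proof.
move=> hpsi [K [cK KO psi0]] E.
have sp : supported_in Omega psi by exists K.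
have [hz sd] := C1_zext oOmega hpsi sp.
have dpsi0 i x : Omega x -> ~ K x -> dpsi i x = 0.
  move=> Ox Kx; have [_ <-] := C1_der i hpsi Ox.
  apply: (@derive_val _ _ _ _ _ psi 0).
  apply: (@isder_near _ _ (fun=> 0) _ _ _ _ _ (isder_cst _ _ 0)).
  have := near_zext_out cK KO psi0 Kx; have := near_zext_in psi oOmega Ox.
  by apply: filterS2 => y -> <-.
have hphi := eigenfunction_C1.
have cD x i : Omega x -> {for x, continuous (fun x => D * (pd i phi x * dpsi i x)
               - 2 * alpha * (pd i m x * pd i phi x * psi x))}.
  move=> Ox; apply: cforB; (apply: cforM; first exact: cfor_cst).
    by apply: cforM; [exact: C1_dcont hphi Ox|exact: C1_dcont hpsi Ox].
  apply: cforM; last exact: C1_cont hpsi Ox.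
  by apply: cforM; [exact: C1_dcont m_C1 Ox|exact: C1_dcont hphi Ox].
have cS x : Omega x -> {for x, continuous (fun x => \sum_i (D * (pd i phi x * dpsi i x)
               - 2 * alpha * (pd i m x * pd i phi x * psi x)))}.
  by move=> Ox; apply: cfor_sum => i; exact: cD.
have cp x : Omega x -> {for x, continuous (fun x => phi x * psi x)}.
  by move=> Ox; apply: cforM; [exact: C1_cont hphi Ox|exact: C1_cont hpsi Ox].
have S0 x : Omega x -> ~ K x -> \sum_i (D * (pd i phi x * dpsi i x)
               - 2 * alpha * (pd i m x * pd i phi x * psi x)) = 0.
  move=> Ox Kx; rewrite big1 // => i _.
  by rewrite dpsi0 // psi0 // !mulr0 subrr.
have p0 x : Omega x -> ~ K x -> phi x * psi x = 0.
  by move=> Ox Kx; rewrite psi0 // mulr0.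
have cE : Cc (zext Omega E).
  apply: Cc_zext => //.
    move=> x Ox; apply: cforD; first exact: cS.
    apply: cforM; last exact: cp.
    by apply: cforB; [exact: v_cont|exact: cfor_cst].
  by exists K; split => // x Ox Kx; rewrite /E S0 // p0 // mulr0 addr0.
split => //.
have tpsi : test_function Omega (zext Omega psi).
  split; first exact: C1_Ck openT hz.
  exists K; split => // x Kx; have [Ox|Ox] := pselect (Omega x).
    by rewrite zext_in // psi0.
  by rewrite zext_out.
have [_ _ _ /(_ _ tpsi)] := phi_eig; rewrite /int_on => W.
pose A x := \sum_i (D * (pd i phi x * dpsi i x)
               - 2 * alpha * (pd i m x * pd i phi x * psi x))
             + v x * (phi x * psi x).
pose B x := mu * (phi x * psi x).
have cA : Cc (zext Omega A).
  apply: Cc_zext => //.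
    move=> x Ox; apply: cforD; first exact: cS.
    by apply: cforM; [exact: v_cont|exact: cp].
  by exists K; split => // x Ox Kx; rewrite /A S0 // p0 // mulr0 addr0.
have cB : Cc (zext Omega B).
  apply: Cc_zext => //.
    by move=> x Ox; apply: cforM; [exact: cfor_cst|exact: cp].
  by exists K; split => // x Ox Kx; rewrite /B p0 // mulr0.
have -> : zext Omega E = (fun x => zext Omega A x - zext Omega B x).
  apply/funext => x; have [Ox|Ox] := pselect (Omega x).
    by rewrite !zext_in // /E /A /B; ring.
  by rewrite !zext_out // subrr.
rewrite intRNB //; apply/eqP; rewrite subr_eq0; apply/eqP.
transitivity (intRN ((fun x => D * dot (grad phi x) (grad (zext Omega psi) x) -
    2 * alpha * dot (grad m x) (grad phi x) * zext Omega psi x +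
    v x * phi x * zext Omega psi x) \_ Omega)); last first.
  rewrite W; congr intRN; apply/funext => x.
  have [Ox|Ox] := pselect (Omega x); last by rewrite -/(zext _ _ x) !zext_out.
  by rewrite -/(zext _ _ x) !zext_in // /B mulrA.
congr intRN; apply/funext => x.
have [Ox|Ox] := pselect (Omega x); last by rewrite -/(zext _ _ x) !zext_out.
rewrite -/(zext _ _ x) !zext_in // /A mulrA; congr (_ + _).
rewrite sumrB /dot -!mulr_sumr -mulr_suml !mulrA; congr (_ - _).
  congr (_ * _); apply: eq_bigr => i _.
  by rewrite (C1_grad i hz (I : setT x)) zext_in // mxE.
by congr (_ * _ * _); apply: eq_bigr => i _; rewrite !mxE.
Qed.

(** With p = phi, and a, b, q the partial derivatives of g, m, phi, the right side is D (a - alpha g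
    b / D)^2, the energy density of g exp (- alpha m / D) under the weight exp (2 alpha m / D). The
    left side is the i-th term of the equation tested with g^2 / phi, and the gap is a square
    divided by D. *)
Lemma picone_term (a b g p q : R) : p != 0 ->
  D * (q * ((a * g + g * a) * p^-1 + g * g * (- p ^- 2 * q)))
    - 2 * alpha * (b * q * (g * g * p^-1))
  <= D * a ^+ 2 - 2 * alpha * g * (a * b) + alpha ^+ 2 / D * b ^+ 2 * g ^+ 2.
Proof.
move=> p0; rewrite -subr_ge0.
rewrite (_ : _ - _ = (D * a - alpha * g * b - D * g * (q / p)) ^+ 2 / D).
  by rewrite divr_ge0 ?sqr_ge0 // ltW.
by field; rewrite p0 gt_eqF.
Qed.

(* Picone's inequality: test the equation with g^2 / phi. *)
Lemma eigenvalue_le M (g : V -> R) dg (Z : 'I_n -> V -> R)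
    (dZ : 'I_n -> 'I_n -> V -> R) :
  C1 Omega g dg -> supported_in Omega g ->
  (exists2 x, Omega x & g x != 0) ->
  (forall i, C1 Omega (Z i) (dZ i)) -> (forall i, supported_in Omega (Z i)) ->
  (forall x, Omega x ->
     \sum_i (D * dg i x ^+ 2 - 2 * alpha * g x * (dg i x * pd i m x)
             + alpha ^+ 2 / D * pd i m x ^+ 2 * g x ^+ 2)
     + v x * g x ^+ 2 + \sum_i dZ i i x <= M * g x ^+ 2) ->
  mu <= M.
Proof.
move=> hg sg [x0 Ox0 gx0] hZ sZ H.
have hphi := eigenfunction_C1.
have hpsi := C1M (C1M hg hg) (C1V hphi (fun x Ox => lt0r_neq0 (phi_gt0 Ox))).
have [K [cK KO g0]] := sg.
have spsi : supported_in Omega (fun x => g x * g x * (phi x)^-1).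
  by exists K; split => // x Ox Kx; rewrite g0 // !mul0r.
have [cE iE] := eigenfunction_weak hpsi spsi.
have [cZ iZ] := intRN_div oOmega hZ sZ.
have cg2 : Cc (zext Omega (fun x => g x * g x)).
  apply: Cc_zext => //; first by move=> x Ox; exact: C1_cont (C1M hg hg) Ox.
  by exists K; split => // x Ox Kx; rewrite g0 // mul0r.
have g2pos : 0 < intRN (zext Omega (fun x => g x * g x)).
  apply: (@intRN_gt0 _ _ _ x0) => //.
    move=> x; have [Ox|Ox] := pselect (Omega x); last by rewrite zext_out.
    by rewrite zext_in // -expr2 sqr_ge0.
  by rewrite zext_in // -expr2 lt0r sqr_ge0 sqrf_eq0 gx0.
have iS := intRND cE cZ; rewrite iE iZ addr0 in iS.
rewrite -subr_ge0 -(pmulr_lge0 _ g2pos) -intRNZ // -iS.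
apply: le_intRN; [exact: CcD cE cZ|exact: CcZ|] => x.
have [Ox|Ox] := pselect (Omega x); last by rewrite !zext_out // mulr0 addr0.
rewrite !zext_in //.
have p0 : phi x != 0 by rewrite gt_eqF // phi_gt0.
have -> : (v x - mu) * (phi x * (g x * g x * (phi x)^-1)) =
  v x * g x ^+ 2 - mu * g x ^+ 2 by field.
have S : \sum_i (D * (pd i phi x * ((dg i x * g x + g x * dg i x) * (phi x)^-1
      + g x * g x * (- phi x ^- 2 * pd i phi x)))
    - 2 * alpha * (pd i m x * pd i phi x * (g x * g x * (phi x)^-1)))
  <= \sum_i (D * dg i x ^+ 2 - 2 * alpha * g x * (dg i x * pd i m x)
             + alpha ^+ 2 / D * pd i m x ^+ 2 * g x ^+ 2).
  by apply: ler_sum => i _; exact: picone_term.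
by have := H x Ox; rewrite mulrBl -expr2; lra.
Qed.

(** The boundary condition keeps superlevel sets of [phi] away from the boundary; truncations of
    [phi] at a positive level thus have compact support. *)
Lemma superlevel_compact d : 0 < d -> compact (closure Omega) ->
  let K := [set x | closure Omega x /\ d <= phi x] in compact K /\ K `<=` Omega.
Proof.
move=> d0 cO K; have [[phic _] phib _ _] := phi_eig; split.
  apply: (@subclosed_compact _ _ (closure Omega)) => //; last by move=> x [].
  rewrite (_ : K = closure Omega `&` (phi @^-1` [set r | d <= r])) //.
  rewrite closed_setSI; last exact: closed_closure.
  by apply: closed_comp; [move=> x _; exact: phic|exact: closed_ge].
move=> x [cx dx]; apply: contrapT => Ox.
have p0 : phi x = 0 by apply: phib; split => //; move/interior_subset.
by move: dx; rewrite p0 leNgt d0.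
Qed.

(** Here e = eta(phi), Q = eta'(phi), q and b are derivatives of phi and m, and w k b is that of the
    weight, so D k = 2 alpha cancels the drift. The last bracket is the derivative of w e^2 y. Since
    Q lies in [0, 1], D Q q^2 dominates D (Q q)^2, and what is left is the square (D Q q + e y)^2 /
    D. *)
Lemma weighted_term (w k b q Q e y dy : R) :
  0 <= w -> 0 <= Q <= 1 -> D * k = 2 * alpha ->
  w * (e * e) * ((2 * alpha * (b * y) - y ^+ 2) / D + dy) <=
  D * (q * (w * (k * b) * e + w * (Q * q))) - 2 * alpha * (b * q * (w * e)) +
  ((w * (k * b) * (e * e) + w * (Q * q * e + e * (Q * q))) * y + w * (e * e) * dy).
Proof.
move=> w0 /andP[Q0 Q1] Dk; rewrite -subr_ge0.
rewrite (_ : _ - _ = w * (D * (Q - Q ^+ 2) * q ^+ 2 + (D * (Q * q) + e * y) ^+ 2 / D)).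
  apply: mulr_ge0 => //; apply: addr_ge0; last by rewrite divr_ge0 ?sqr_ge0 // ltW.
  apply: mulr_ge0; last exact: sqr_ge0.
  by apply: mulr_ge0; [exact: ltW|rewrite subr_ge0 expr2 ler_piMl].
have -> : k = 2 * alpha / D by rewrite -Dk mulrAC mulfV ?mul1r // gt_eqF.
by field; rewrite gt_eqF.
Qed.

(** The truncation is eta(s) = (s - d)_+^2 / s. It is C^1 and vanishes up to d, and its slope 1 - (1
    - p / s)^2 lies in [0, 1] because 0 <= p <= s. *)
Lemma truncation_bounds (s d : R) : 0 < s -> 0 < d ->
  let p := pos (s - d) in let e := p ^+ 2 / s in
  [/\ 0 <= e, e <= s, s - e <= 2 * d & 0 <= 2 * p / s - p ^+ 2 * s ^- 2 <= 1].
Proof.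
move=> s0 d0 p e.
have p0 : 0 <= p := pos_ge0 _.
have ps : p <= s.
  rewrite /p; case: (lerP (s - d) 0) => sd; first by rewrite pos_le0 // ltW.
  by rewrite (pos_id (ltW sd)); lra.
have r1 : p / s <= 1 by rewrite ler_pdivrMr // mul1r.
have r0 : 0 <= p / s by rewrite divr_ge0 // ltW.
have eE : e = p / s * p by rewrite /e expr2 mulrAC.
have e0 : 0 <= e by rewrite eE mulr_ge0.
split => //.
- by rewrite eE (le_trans _ ps) // ler_piMl.
- rewrite /e /p; case: (lerP (s - d) 0) => sd.
    by rewrite pos_le0 // expr0n mul0r; lra.
  rewrite (pos_id (ltW sd)).
  have -> : s - (s - d) ^+ 2 / s = 2 * d - d ^+ 2 / s by field; rewrite gt_eqF.
  by rewrite lerBlDr lerDl divr_ge0 ?sqr_ge0 // ltW.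
- have -> : 2 * p / s - p ^+ 2 * s ^- 2 = 2 * (p / s) - (p / s) ^+ 2.
    by field; rewrite gt_eqF.
  by apply/andP; split; nra.
Qed.

Lemma truncation_mono (s d d' : R) : 0 < s -> 0 < d -> d <= d' ->
  pos (s - d') ^+ 2 / s <= pos (s - d) ^+ 2 / s.
Proof.
move=> s0 d0 dd; rewrite ler_pM2r ?invr_gt0 // lerXn2r ?nnegrE ?pos_ge0 //.
case: (lerP (s - d') 0) => sd; first by rewrite pos_le0 // pos_ge0.
by rewrite !pos_id; lra.
Qed.

(** [Y] is free near the boundary, because the truncation at level d makes w e^2 Y compactly
    supported. Truncating costs O(d) in the zero-order term, while the mass int w e^2 stays bounded
    below as d decreases; a small d therefore excludes mu < M. *)
Lemma eigenvalue_ge M (Y : 'I_n -> V -> R) (dY : 'I_n -> 'I_n -> V -> R) Cm Cv :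
  compact (closure Omega) ->
  (forall x, Omega x -> `|m x| <= Cm) -> (forall x, Omega x -> `|v x| <= Cv) ->
  (forall i, C1 Omega (Y i) (dY i)) ->
  (forall x, Omega x ->
     M <= (\sum_i ((2 * alpha * (pd i m x * Y i x) - Y i x ^+ 2) / D + dY i i x))
          + v x) ->
  M <= mu.
Proof.
move=> cO mb vb hY HM.
have hphi := eigenfunction_C1.
have [[phic _] _ [x0 Ox0 _] _] := phi_eig.
pose k := 2 * alpha / D.
have Dk : D * k = 2 * alpha by rewrite /k mulrC divfK // gt_eqF.
pose w x := expR (k * m x).
have w0 x : 0 < w x := expR_gt0 _.
have hw : C1 Omega w (fun i x => w x * (k * pd i m x)).
  apply: (@C1_comp _ _ Omega setT _ _ expR expR (C1Z k m_C1)) => // t _.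
  by split; [exact: is_derive_expR|exact: continuous_expR|exact: continuous_expR].
pose e d x := pos (phi x - d) ^+ 2 * (phi x)^-1.
pose Q d x := 2 * pos (phi x - d) / phi x - pos (phi x - d) ^+ 2 * phi x ^- 2.
have eb d x : Omega x -> 0 < d -> [/\ 0 <= e d x, e d x <= phi x,
    phi x - e d x <= 2 * d & 0 <= Q d x <= 1].
  by move=> Ox d0; exact: truncation_bounds (phi_gt0 Ox) d0.
have he d : C1 Omega (e d) (fun i x => Q d x * pd i phi x).
  have := C1M (C1_posX 0 (C1B hphi (@C1_cst _ _ Omega d)))
    (C1V hphi (fun x Ox => lt0r_neq0 (phi_gt0 Ox))).
  by move/C1_eq; apply => i x; rewrite /Q subr0 expr1; ring.
have se d : 0 < d -> exists K, [/\ compact K, K `<=` Omega &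
    forall x, Omega x -> ~ K x -> e d x = 0].
  move=> d0; have [cK KO] := superlevel_compact d0 cO.
  exists [set x | closure Omega x /\ d <= phi x]; split => // x Ox Kx.
  rewrite /e pos_le0 ?expr0n ?mul0r // subr_le0.
  by case: (lerP (phi x) d) => // dp; case: Kx; split; [exact: subset_closure|exact: ltW].
have [Cp Cp0 phib] := within_bounded cO phic.
have [Mb Mb0 Ob] := rV_compact_bounded cO.
have wb x : Omega x -> w x <= expR (`|k| * Cm).
  move=> Ox; rewrite ler_expR; apply: le_trans (ler_norm _) _.
  by rewrite normrM ler_wpM2l // mb.
have c1 d : 0 < d -> Cc (zext Omega (fun x => w x * e d x)) /\
    Cc (zext Omega (fun x => w x * (e d x * e d x))).
  move=> d0; have [K [cK KO e0]] := se d d0.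
  have hwe := C1M hw (he d); have hwee := C1M hw (C1M (he d) (he d)).
  split; apply: Cc_zext => //.
  - by move=> x Ox; exact: C1_cont hwe Ox.
  - by exists K; split => // x Ox Kx; rewrite e0 // mulr0.
  - by move=> x Ox; exact: C1_cont hwee Ox.
  - by exists K; split => // x Ox Kx; rewrite e0 // !mulr0.
pose C0 := Cv + `|mu|.
have C00 : 0 <= C0 by rewrite /C0 addr_ge0 //; exact: le_trans (vb _ Ox0).
(* The right side is the price of replacing (v - mu) phi e by (v - mu) e^2, using phi - e <= 2 d and
   |v - mu| <= [C0]. *)
have key d : 0 < d -> (M - mu) * intRN (zext Omega (fun x => w x * (e d x * e d x)))
    <= 2 * d * C0 * intRN (zext Omega (fun x => w x * e d x)).
  move=> d0; have [K [cK KO e0]] := se d d0; have [cwe cwee] := c1 d d0.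
  have sp : supported_in Omega (fun x => w x * e d x).
    by exists K; split => // x Ox Kx; rewrite e0 // mulr0.
  have [cE iE] := eigenfunction_weak (C1M hw (he d)) sp.
  have hZ i := C1M (C1M hw (C1M (he d) (he d))) (hY i).
  have sZ i : supported_in Omega (fun x => w x * (e d x * e d x) * Y i x).
    by exists K; split => // x Ox Kx; rewrite e0 // !mulr0 mul0r.
  have [cZ iZ] := intRN_div oOmega hZ sZ.
  have iS := intRND cE cZ; rewrite iE iZ addr0 in iS.
  rewrite -subr_le0 -!intRNZ // -intRNB; [|exact: CcZ..].
  rewrite -iS; apply: le_intRN; [by apply: CcB; exact: CcZ|exact: CcD cE cZ|] => x.
  have [Ox|Ox] := pselect (Omega x); last by rewrite !zext_out // !mulr0 subrr addr0.
  rewrite !zext_in //.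
  have [ep es se2 Q01] := eb d x Ox d0.
  have T i := @weighted_term (w x) k (pd i m x) (pd i phi x) (Q d x) (e d x)
    (Y i x) (dY i i x) (ltW (w0 x)) Q01 Dk.
  have S : w x * (e d x * e d x) *
      (\sum_i ((2 * alpha * (pd i m x * Y i x) - Y i x ^+ 2) / D + dY i i x)) <=
      \sum_i (D * (pd i phi x * (w x * (k * pd i m x) * e d x + w x * (Q d x * pd i phi x)))
        - 2 * alpha * (pd i m x * pd i phi x * (w x * e d x))) +
      \sum_i ((w x * (k * pd i m x) * (e d x * e d x) +
        w x * (Q d x * pd i phi x * e d x + e d x * (Q d x * pd i phi x))) * Y i x +
        w x * (e d x * e d x) * dY i i x).
    by rewrite mulr_sumr -big_split; apply: ler_sum => i _; exact: T.
  have wee : 0 <= w x * (e d x * e d x).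
    by apply: mulr_ge0; [exact: ltW|exact: mulr_ge0].
  have H1 := ler_wpM2l wee (HM x Ox).
  have vmu : - C0 <= v x - mu.
    have := vb x Ox; rewrite ler_norml => /andP[v1 v2].
    by have := ler_norm mu; rewrite /C0; lra.
  have we : 0 <= w x * e d x by apply: mulr_ge0; first exact: ltW.
  have H2 : - (2 * d * C0) * (w x * e d x) <= (v x - mu) * (phi x - e d x) * (w x * e d x).
    apply: ler_wpM2r => //.
    apply: le_trans (_ : - C0 * (phi x - e d x) <= _).
      by rewrite !mulNr lerN2 [leRHS]mulrC; apply: ler_wpM2l.
    by apply: ler_wpM2r => //; rewrite subr_ge0.
  rewrite [leRHS]addrAC; move: S H1 H2; rewrite /e; lra.
case: (lerP M mu) => // muM; exfalso.
pose d0 := phi x0 / 2.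
have p0 := phi_gt0 Ox0.
have d00 : 0 < d0 by rewrite divr_gt0.
pose c := intRN (zext Omega (fun x => w x * (e d0 x * e d0 x))).
have cgt0 : 0 < c.
  have [_ cw] := c1 d0 d00.
  apply: (@intRN_gt0 _ _ _ x0) => //.
    move=> x; have [Ox|Ox] := pselect (Omega x); last by rewrite zext_out.
    by rewrite zext_in //; apply: mulr_ge0; [exact: ltW|rewrite -expr2 sqr_ge0].
  rewrite zext_in // mulr_gt0 // -expr2 exprn_gt0 //.
  rewrite /e pos_id ?mulr_gt0 ?invr_gt0 ?exprn_gt0 //; rewrite /d0; lra.
pose B := expR (`|k| * Cm) * Cp * (2 * Mb) ^+ n + 1.
have B0 : 0 < B.
  by rewrite ltr_wpDl // !mulr_ge0 ?exprn_ge0 ?mulr_ge0 ?expR_ge0 // ltW.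
(* Both integrals are replaced by constants: the mass grows as d decreases, and int w e is at most
   [B] uniformly in d. *)
have key2 d : 0 < d -> d <= d0 -> (M - mu) * c <= 2 * d * C0 * B.
  move=> dp dd0; have [cwe cwee] := c1 d dp; have [_ cwee0] := c1 d0 d00.
  apply: le_trans (le_trans (_ : _ <= _) (key d dp)) _.
    apply: ler_wpM2l; first by rewrite subr_ge0 ltW.
    apply: le_intRN => // x.
    have [Ox|Ox] := pselect (Omega x); last by rewrite !zext_out.
    rewrite !zext_in // ler_pM2l //.
    have [ep _ _ _] := eb d0 x Ox d00.
    by apply: ler_pM => //; apply: truncation_mono => //; exact: phi_gt0.
  apply: ler_wpM2l; first by rewrite !mulr_ge0 // ltW.
  apply: le_trans (ler_norm _) _; apply: le_trans (_ : expR (`|k| * Cm) * Cp * (2 * Mb) ^+ n <= _).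
    apply: intRN_bound => //.
      move=> x xM; rewrite zext_out // => /subset_closure /Ob.
      by rewrite leNgt xM.
    move=> x; have [Ox|Ox] := pselect (Omega x); last first.
      by rewrite zext_out // normr0 mulr_ge0 ?expR_ge0 // ltW.
    have [ep es _ _] := eb d x Ox dp.
    rewrite zext_in // ger0_norm; last by apply: mulr_ge0; first exact: ltW.
    apply: ler_pM => //; [exact: ltW|exact: wb|].
    apply: le_trans es _; apply: le_trans (ler_norm _) _.
    exact/phib/subset_closure.
  by rewrite /B lerDl.
have Mc : 0 < (M - mu) * c by rewrite mulr_gt0 // subr_gt0.
(* Makes 2 * d1 * C0 * B smaller than (M - mu) * c, against [key2]; the + 1 keeps the denominator
   positive when C0 = 0. *)
pose d1 := Num.min d0 ((M - mu) * c / (2 * (2 * C0 * B + 1))).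
have CB : 0 < 2 * (2 * C0 * B + 1).
  by rewrite mulr_gt0 // ltr_wpDl // !mulr_ge0 // ltW.
have d1p : 0 < d1 by rewrite lt_min d00 divr_gt0.
have d1d : d1 <= d0 by rewrite ge_min lexx.
have d1c : d1 <= (M - mu) * c / (2 * (2 * C0 * B + 1)) by rewrite ge_min lexx orbT.
have := key2 d1 d1p d1d; move: d1c; rewrite ler_pdivlMr //.
have : 0 <= d1 * (C0 * B) by rewrite !mulr_ge0 // ltW.
lra.
Qed.

End WeakForm.

(** * Directional derivatives and symmetry of the Hessian *)

Lemma seq_min_pos (R : realType) (I : eqType) (s : seq I) (P : I -> R -> Prop) :
  (forall i r r', r' <= r -> P i r -> P i r') ->
  (forall i, i \in s -> exists2 r, 0 < r & P i r) ->
  exists2 r, 0 < r & forall i, i \in s -> P i r.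
Proof.
move=> Pm; elim: s => [|i s ih] H; first by exists 1.
have [|r r0 rP] := ih; first by move=> j js; apply: H; rewrite inE js orbT.
have [r' r'0 r'P] := H i (mem_head _ _).
exists (Num.min r r') => [|j]; first by rewrite lt_min r0.
rewrite inE => /predU1P[->|js].
  by apply: Pm r'P; rewrite ge_min lexx orbT.
by apply: Pm (rP j js); rewrite ge_min lexx.
Qed.

Section Differentiability.
Context {R : realType} {n : nat}.
Local Notation V := 'rV[R]_n.
Implicit Types (U : set V) (f : V -> R) (x h : V).

Lemma MVT_delta_abs f (fi : V -> R) i x (h : R) :
  (forall t, `|t| <= `|h| -> is_derive (x + t *: delta_mx 0 i) (delta_mx 0 i) f
    (fi (x + t *: delta_mx 0 i))) ->
  exists2 t, `|t| <= `|h| &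
    f (x + h *: delta_mx 0 i) - f x = fi (x + t *: delta_mx 0 i) * h.
Proof.
move=> fd; case: (lerP 0 h) => h0.
  have [|t /andP[t0 th] E] := @MVT_delta _ _ f fi i x h h0.
    by move=> t /andP[t0 th]; apply: fd; rewrite !ger0_norm.
  by exists t; rewrite // !ger0_norm.
have D t : x + h *: delta_mx 0 i + t *: delta_mx 0 i = x + (h + t) *: delta_mx 0 i.
  by rewrite -addrA -scalerDl.
have hN : 0 <= - h by lra.
have [|t /andP[t0 th]] := @MVT_delta _ _ f fi i (x + h *: delta_mx 0 i) (- h) hN.
  move=> t /andP[t0 th]; rewrite D; apply: fd.
  by rewrite (ler0_norm (ltW h0)) ler0_norm; lra.
rewrite !D subrr scale0r addr0 => E; exists (h + t).
  by rewrite (ler0_norm (ltW h0)) ler0_norm; lra.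
by rewrite -opprB E mulrN opprK.
Qed.

(** The corners of the coordinate path from 0 to h. Its edges stay in the sup-norm ball of radius
    |h|, and increments along it telescope. *)
Definition trunc_row (k : nat) h : V := \row_j if (j < k)%N then h 0 j else 0.

Lemma trunc_rowS (k : 'I_n) h :
  trunc_row k.+1 h = trunc_row k h + h 0 k *: delta_mx 0 k.
Proof.
apply/rowP => j; rewrite shift_coordE !mxE ltnS leq_eqVlt.
case: (eqVneq j k) => [->|jk]; first by rewrite eqxx ltnn mulr1 add0r.
by rewrite (_ : (j == k :> nat) = false) ?mulr0 ?addr0 //; exact: negbTE.
Qed.

Lemma trunc_row_norm (k : 'I_n) h (t : R) : `|t| <= `|h 0 k| ->
  `|trunc_row k h + t *: delta_mx 0 k| <= `|h|.
Proof.
move=> th; apply: rV_norm_le => // j; rewrite shift_coordE !mxE.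
case: (eqVneq j k) => [->|jk].
  by rewrite ltnn add0r mulr1 (le_trans th) // rV_coord_le_norm.
rewrite mulr0 addr0; case: ifP => _; last by rewrite normr0.
exact: rV_coord_le_norm.
Qed.

Lemma C1_increment U f df x (p : 'I_n -> R) e r : C1 U f df ->
  (forall y, `|x - y| < r -> U y) ->
  (forall y i, `|x - y| < r -> `|df i y - p i| <= e) ->
  forall h, `|h| < r -> `|f (x + h) - f x - \sum_i p i * h 0 i| <= e * n%:R * `|h|.
Proof.
move=> hf rU dfe h hr.
have tel : f (x + h) - f x =
    \sum_(k < n) (f (x + trunc_row k.+1 h) - f (x + trunc_row k h)).
  rewrite -(big_mkord xpredT (fun k => f (x + trunc_row k.+1 h) - f (x + trunc_row k h))).
  rewrite telescope_sumr //; congr (f _ - f _).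
    by congr (_ + _); apply/rowP => j; rewrite mxE ltn_ord.
  by rewrite (_ : trunc_row 0 h = 0) ?addr0 //; apply/rowP => j; rewrite !mxE.
rewrite tel -sumrB; apply: le_trans (ler_norm_sum _ _ _) _.
apply: le_trans (_ : \sum_(k < n) e * `|h| <= _); last first.
  by rewrite sumr_const card_ord mulrAC mulr_natr lexx.
apply: ler_sum => k _; rewrite trunc_rowS addrA.
have B t : `|t| <= `|h 0 k| -> `|x - (x + trunc_row k h + t *: delta_mx 0 k)| < r.
  move=> th; rewrite -addrA opprD addrA subrr sub0r normrN.
  exact: le_lt_trans (trunc_row_norm th) hr.
have [t th ->] := @MVT_delta_abs f (df k) k (x + trunc_row k h) (h 0 k)
  (fun t ht => C1_der k hf (rU _ (B t ht))).
rewrite -mulrBl normrM ler_pM //; first exact/dfe/B.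
exact: rV_coord_le_norm.
Qed.

Lemma C1_frechet U f df x : open U -> C1 U f df -> U x -> forall e, 0 < e ->
  exists2 r, 0 < r & forall h, `|h| < r ->
    `|f (x + h) - f x - \sum_i df i x * h 0 i| <= e * `|h|.
Proof.
move=> oU hf Ux e e0.
have N : 0 < n%:R + 1 :> R by rewrite ltr_wpDl.
have e1 : 0 < e / (n%:R + 1) by rewrite divr_gt0.
have /nbhs_ballP[r0 r00 rU] : nbhs x U by move/open_nbhs_nbhs: (conj oU Ux).
pose P i r := forall y, `|x - y| < r -> `|df i x - df i y| < e / (n%:R + 1).
have [|i _|r1 r10 r1P] := @seq_min_pos R _ (enum 'I_n) P.
- by move=> i r r' rr' Pr y xy; apply: Pr; exact: lt_le_trans xy rr'.
- by have [d d0 dP] := iffLR (cfor_distP _ _) (@C1_dcont _ _ _ _ _ _ i hf Ux) _ e1; exists d.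
have hU y : `|x - y| < Num.min r0 r1 -> U y.
  by rewrite lt_min => /andP[xy _]; apply: rU; rewrite -ball_normE.
have hd y i : `|x - y| < Num.min r0 r1 -> `|df i y - df i x| <= e / (n%:R + 1).
  by rewrite lt_min => /andP[_ xy]; rewrite distrC; apply/ltW/r1P; rewrite ?mem_enum.
exists (Num.min r0 r1) => [|h hr]; first by rewrite lt_min r10 andbT.
apply: le_trans (C1_increment hf hU hd hr) _.
apply: ler_wpM2r => //; rewrite mulrAC ler_pdivrMr // ler_pM2l //; lra.
Qed.

Lemma C1_directional U f df x v : open U -> C1 U f df -> U x ->
  is_derive x v f (\sum_i df i x * v 0 i).
Proof.
move=> oU hf Ux.
have L : (fun t : R => t^-1 *: ((f \o shift x) (t *: v) - f x)) @ (0 : R)^' -->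
    \sum_i df i x * v 0 i.
  apply/cvgrPdist_lt => e e0.
  have v0 : 0 < `|v| + 1 by rewrite ltr_wpDl.
  have e1 : 0 < e / (`|v| + 1) / 2 by rewrite !divr_gt0.
  have [r r0 H] := C1_frechet oU hf Ux e1.
  near=> t.
  have t0 : t != 0 by near: t; exact: nbhs_dnbhs_neq.
  have tr : `|t| < r / (`|v| + 1).
    near: t; apply: dnbhs0_lt; exact: divr_gt0.
  have tv : `|t *: v| < r.
    rewrite normrZ; move: tr; rewrite ltr_pdivlMr // mulrDr mulr1; apply: le_lt_trans.
    by rewrite lerDl.
  rewrite /= (_ : _ *: _ = t^-1 * (f (x + t *: v) - f x)); last by rewrite [t *: v + x]addrC.
  have := H _ tv.
  rewrite (_ : \sum_i df i x * (t *: v) 0 i = t * \sum_i df i x * v 0 i); last first.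
    by rewrite mulr_sumr; apply: eq_bigr => i _; rewrite mxE mulrCA.
  set a := f _ - f _; set b := \sum_i _ => H1.
  have -> : b - t^-1 * a = - (t^-1 * (a - t * b)) by field.
  rewrite normrN normrM normrV ?unitfE // ltr_pdivrMl ?normr_gt0 //.
  apply: le_lt_trans H1 _; rewrite normrZ mulrCA ltr_pM2l ?normr_gt0 //.
  rewrite mulrAC ltr_pdivrMr // mulrAC ltr_pdivrMr // -mulrA ltr_pM2l //; lra.
by apply: DeriveDef; [apply/cvg_ex; exists (\sum_i df i x * v 0 i)|exact: cvg_lim].
Unshelve. all: end_near. Qed.

Lemma isder_shift f x v c a : is_derive (x + c) v f a ->
  is_derive x v (fun y => f (y + c)) a.
Proof.
move=> /is_derive_lineP h; apply: (iffRL (is_derive_lineP _ _ _ _)).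
by rewrite (_ : (fun t => _) = (fun t => f (t *: v + (x + c)))) //; apply/funext => t; rewrite addrA.
Qed.

Lemma second_difference U f i j x (h r : R) : C1 U f (fun i => pd i f) ->
  C1 U (pd i f) (fun j => pd j (pd i f)) ->
  (forall y, `|x - y| < r -> U y) -> 0 <= h -> 2 * h < r ->
  exists2 y, `|x - y| < r &
    f (x + h *: delta_mx 0 i + h *: delta_mx 0 j) - f (x + h *: delta_mx 0 i) -
    (f (x + h *: delta_mx 0 j) - f x) = pd j (pd i f) y * h * h.
Proof.
move=> hf hfi rU h0 hr.
have B t s : 0 <= t <= h -> 0 <= s <= h ->
    `|x - (x + t *: delta_mx 0 i + s *: delta_mx 0 j)| < r.
  move=> /andP[t0 th] /andP[s0 sh]; rewrite -addrA opprD addrA subrr sub0r normrN.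
  apply: le_lt_trans hr; apply: le_trans (ler_normD _ _) _; rewrite !normrZ.
  rewrite (ger0_norm t0) (ger0_norm s0).
  have di := @norm_delta_le R n i; have dj := @norm_delta_le R n j.
  have : t * `|delta_mx 0 i : V| <= t by rewrite ler_piMr.
  have : s * `|delta_mx 0 j : V| <= s by rewrite ler_piMr.
  lra.
have hh : 0 <= h <= h by rewrite h0 lexx.
have zh : 0 <= (0 : R) <= h by rewrite h0 lexx.
have B0 t : 0 <= t <= h -> `|x - (x + t *: delta_mx 0 i)| < r.
  by move=> th; have := B t 0 th zh; rewrite scale0r addr0.
have [|t th E] := @MVT_delta _ _ (fun y => f (y + h *: delta_mx 0 j) - f y)
  (fun y => pd i f (y + h *: delta_mx 0 j) - pd i f y) i x h h0.
  move=> t th; apply: isderD; last by apply: isderN; exact: C1_der hf (rU _ (B0 t th)).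
  by apply: isder_shift; exact: C1_der hf (rU _ (B t h th hh)).
have [|s sh E2] := @MVT_delta _ _ (pd i f) (pd j (pd i f)) j
  (x + t *: delta_mx 0 i) h h0.
  by move=> s sh; exact: C1_der hfi (rU _ (B t s th sh)).
by rewrite E E2; exists (x + t *: delta_mx 0 i + s *: delta_mx 0 j) => //; exact: B.
Qed.

(** The second difference is symmetric in i and j, and by [second_difference] it is h^2 times either
    mixed derivative at some point near x. *)
Lemma schwarz U f i j x : open U -> C1 U f (fun i => pd i f) ->
  (forall i, C1 U (pd i f) (fun j => pd j (pd i f))) -> U x ->
  pd j (pd i f) x = pd i (pd j f) x.
Proof.
move=> oU hf hff Ux.
apply/eqP; rewrite -subr_eq0 -normr_eq0; apply/eqP/le_anti/andP; split => //.
apply/ler_addgt0Pr => e e0; rewrite add0r.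
have /nbhs_ballP[r0 r00 rU] : nbhs x U by move/open_nbhs_nbhs: (conj oU Ux).
have e2 : 0 < e / 2 by rewrite divr_gt0.
have aux (a b c c' : R) : `|b - c'| < e / 2 -> `|a - c| < e / 2 -> c' = c ->
    `|b - a| <= e.
  move=> H1 H2 H3; rewrite (_ : b - a = (b - c') - (a - c)); last by rewrite H3; ring.
  by apply: le_trans (ler_normB _ _) _; lra.
have [d d0 dP] := iffLR (cfor_distP _ _) (@C1_dcont _ _ _ _ _ _ j (hff i) Ux) _ e2.
have [d' d'0 d'P] := iffLR (cfor_distP _ _) (@C1_dcont _ _ _ _ _ _ i (hff j) Ux) _ e2.
pose r := Num.min r0 (Num.min d d').
have rp : 0 < r by rewrite !lt_min r00 d0.
have rr0 : r <= r0 by rewrite ge_min lexx.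
have rd : r <= d by rewrite !ge_min lexx orbT.
have rd' : r <= d' by rewrite !ge_min lexx !orbT.
have rUr y : `|x - y| < r -> U y.
  by move=> xy; apply: rU; rewrite -ball_normE /=; exact: lt_le_trans xy rr0.
pose h := r / 4.
have h0 : 0 < h by rewrite divr_gt0.
have hr : 2 * h < r by rewrite /h; lra.
have [y xy E] := second_difference j hf (hff i) rUr (ltW h0) hr.
have [z xz E'] := second_difference i hf (hff j) rUr (ltW h0) hr.
have : pd j (pd i f) y = pd i (pd j f) z.
  apply: (mulIf (lt0r_neq0 h0)); apply: (mulIf (lt0r_neq0 h0)).
  refine (etrans (esym E) (etrans _ E')).
  rewrite (addrAC x (h *: delta_mx 0 i)) opprB opprB addrACA [RHS]addrACA.
  by congr (_ + _); rewrite addrC.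
move=> yz; exact: aux (dP y (lt_le_trans xy rd)) (d'P z (lt_le_trans xz rd')) yz.
Qed.

End Differentiability.

(** * Symmetric real matrices *)

Section Spectral.
Context {R : realType}.

Lemma char_poly_conj n (P A : 'M[R]_n) : P *m P = 1%:M ->
  char_poly (P *m A *m P) = char_poly A.
Proof.
move=> PP; rewrite /char_poly.
have PPp : map_mx polyC P *m map_mx polyC P = 1%:M by rewrite -map_mxM PP map_mx1.
have -> : char_poly_mx (P *m A *m P) =
    map_mx polyC P *m char_poly_mx A *m map_mx polyC P.
  rewrite /char_poly_mx mulmxBr mulmxBl !map_mxM; congr (_ - _).
  by rewrite mul_mx_scalar -scalemxAl PPp scale_scalar_mx mulr1.
by rewrite !det_mulmx mulrAC -det_mulmx PPp det1 mul1r.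
Qed.

Lemma char_poly_block_diag n m (A : 'M[R]_n) (B : 'M[R]_m) :
  char_poly (block_mx A 0 0 B) = char_poly A * char_poly B.
Proof.
rewrite /char_poly -(det_ublock _ 0); congr (\det _).
rewrite /char_poly_mx map_block_mx scalar_mx_block opp_block_mx add_block_mx.
by rewrite !map_mx0 !oppr0 !addr0.
Qed.

Lemma dot_mulmx n (u v : 'rV[R]_n) : u *m v^T = (dot u v)%:M.
Proof.
rewrite [LHS]mx11_scalar mxE; congr (_%:M); apply: eq_bigr => i _.
by rewrite mxE.
Qed.

Lemma dot_ge0 n (u : 'rV[R]_n) : 0 <= dot u u.
Proof. by apply: sumr_ge0 => i _; rewrite -expr2 sqr_ge0. Qed.

Lemma dot_eq0 n (u : 'rV[R]_n) : (dot u u == 0) = (u == 0).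
Proof.
apply/idP/eqP => [|->]; last by rewrite /dot big1 // => i _; rewrite mxE mul0r.
rewrite psumr_eq0 => [/allP h|i _]; last by rewrite -expr2 sqr_ge0.
apply/rowP => i; rewrite mxE; have := h i (mem_index_enum i).
by rewrite /= mulf_eq0 orbb => /eqP.
Qed.

Lemma enorm_eq0 n (u : 'rV[R]_n) : (enorm u == 0) = (u == 0).
Proof. by rewrite sqrtr_eq0 -dot_eq0 eq_le dot_ge0 andbT. Qed.

(** The Householder reflection in the hyperplane orthogonal to u - e. Equal lengths give |d|^2 = - 2
    (e . d), so that e is sent to e + d = u. *)
Lemma reflection_exists n (u e : 'rV[R]_n) : dot u u = 1 -> dot e e = 1 ->
  exists P : 'M[R]_n, [/\ P^T = P, P *m P = 1%:M & e *m P = u].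
Proof.
move=> uu ee; have [->|ue] := eqVneq u e.
  by exists 1%:M; rewrite trmx1 !mulmx1.
pose d := u - e; pose c := 2 / dot d d.
have dd0 : dot d d != 0 by rewrite dot_eq0 subr_eq0.
have ddE : dot d d = - 2 * dot e d.
  have -> : dot d d = dot u u - dot e e - 2 * dot e d.
    rewrite /dot mulr_sumr -!sumrB; apply: eq_bigr => i _.
    by rewrite !mxE; ring.
  by rewrite uu ee subrr sub0r mulNr.
exists (1%:M - c *: (d^T *m d)); split.
- by rewrite linearB linearZ /= trmx1 trmx_mul trmxK.
- have FF : d^T *m d *m (d^T *m d) = dot d d *: (d^T *m d).
    by rewrite mulmxA -[d^T *m d *m d^T]mulmxA dot_mulmx mul_mx_scalar -scalemxAl.
  move: (d^T *m d) FF => F FF.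
  rewrite mulmxBl mul1mx mulmxBr mulmx1 -scalemxAl -scalemxAr FF !scalerA.
  rewrite (_ : c * c * dot d d = c + c); last by rewrite /c; field.
  by rewrite scalerDl opprB addrK subrK.
- rewrite [LHS]mulmxBr mulmx1 -scalemxAr mulmxA dot_mulmx mul_scalar_mx scalerA.
  have -> : c * dot e d = -1.
    have e0 : dot e d != 0 by apply: contraNneq dd0; rewrite ddE => ->; rewrite mulr0.
    by rewrite /c ddE; field.
  by rewrite scaleN1r opprK addrC subrK.
Qed.

(** Deflation: a reflection takes the first basis vector to a unit eigenvector for [k ord0], and
    symmetry makes the conjugated matrix block diagonal. Cancelling one linear factor of the
    characteristic polynomial hands the splitting hypothesis, and with it the order of the
    eigenvalues, to the smaller block. *)
Lemma real_spectral n (A : 'M[R]_n) (k : 'I_n -> R) : A^T = A ->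
  eigenvalues A k ->
  exists Q : 'M[R]_n, Q *m Q^T = 1%:M /\ A = Q^T *m diag_mx (\row_i k i) *m Q.
Proof.
elim: n A k => [|n ih] A k sA eA.
  by exists 1%:M; split; apply/matrixP => -[].
have /eigenvalueP[v vA v0] : eigenvalue A (k ord0).
  by rewrite eigenvalue_root_char eA big_ord_recl rootM root_XsubC eqxx.
have dv0 : 0 < dot v v by rewrite lt0r dot_eq0 v0 dot_ge0.
have sv0 : 0 < Num.sqrt (dot v v) by rewrite sqrtr_gt0.
pose u := (Num.sqrt (dot v v))^-1 *: v.
have uu : dot u u = 1.
  have -> : dot u u = (Num.sqrt (dot v v)) ^- 2 * dot v v.
    by rewrite /dot mulr_sumr; apply: eq_bigr => i _; rewrite !mxE; field; rewrite gt_eqF.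
  by rewrite sqr_sqrtr ?ltW // mulVf // gt_eqF.
have uA : u *m A = k ord0 *: u by rewrite -scalemxAl vA !scalerA mulrC.
pose e : 'rV[R]_n.+1 := delta_mx 0 0.
have ee : dot e e = 1.
  rewrite /dot (bigD1 ord0) //= big1 ?addr0 => [|i i0].
    by rewrite !mxE !eqxx mulr1.
  by rewrite !mxE (negbTE i0) mulr0.
have [P [sP PP eP]] := reflection_exists uu ee.
have uP : u *m P = e by rewrite -eP -mulmxA PP mulmx1.
(* Typed with 1 + n for the block operations, and abstracted so that its body stays folded. *)
have [B [BA sB B0]] : exists B : 'M[R]_(1 + n), [/\ B = P *m A *m P, B^T = B &
    forall j, B 0 j = k ord0 * (j == 0)%:R].
  exists (P *m A *m P); split=> [//||j]; first by rewrite !trmx_mul sP sA mulmxA.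
  have : e *m (P *m A *m P) = k ord0 *: e by rewrite !mulmxA eP uA -scalemxAl uP.
  by rewrite /e -rowE => /rowP/(_ j); rewrite mxE => ->; rewrite !mxE eqxx.
have l0 : lshift n (ord0 : 'I_1) = (0 : 'I_n.+1) by apply: val_inj.
have Bul : ulsubmx B = (k ord0)%:M.
  apply/matrixP => i j; rewrite !ord1 !mxE.
  by rewrite l0 B0 !eqxx mulr1 mulr1n.
have Bur : ursubmx B = 0.
  apply/matrixP => i j; rewrite ord1 !mxE.
  by rewrite l0 B0 mulr0.
have Bdl : dlsubmx B = 0 by rewrite -sB -trmx_ursub Bur trmx0.
have sB' : (drsubmx B)^T = drsubmx B by rewrite trmx_drsub sB.
have BE : B = block_mx (k ord0)%:M 0 0 (drsubmx B).
  by rewrite -{1}[B]submxK Bul Bur Bdl.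
have e' : eigenvalues (drsubmx B) (fun i => k (lift ord0 i)).
  have cB : char_poly B = char_poly A by rewrite BA; exact: char_poly_conj.
  rewrite BE char_poly_block_diag eA big_ord_recl in cB.
  have cE : char_poly ((k ord0)%:M : 'M[R]_1) = 'X - (k ord0)%:P.
    by rewrite /char_poly det_mx11 !mxE eqxx mulr1n.
  have X0 : 'X - (k ord0)%:P != 0 by rewrite polyXsubC_eq0.
  by apply: (mulfI X0); rewrite -cE cB cE.
have [Q [QQ QE]] := ih _ _ sB' e'.
pose Q1 : 'M[R]_(1 + n) := block_mx 1%:M 0 0 Q.
have Q1Q1 : Q1 *m Q1^T = 1%:M.
  rewrite tr_block_mx mulmx_block !trmx0 trmx1 !mulmx0 !mul0mx !addr0 add0r mulmx1 QQ.
  by rewrite -scalar_mx_block.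
exists (Q1 *m P); split.
  by rewrite trmx_mul sP mulmxA -[Q1 *m P *m P]mulmxA PP mulmx1.
have -> : A = P *m B *m P by rewrite BA !mulmxA PP mul1mx -mulmxA PP mulmx1.
rewrite trmx_mul sP !mulmxA; congr (_ *m P); rewrite -!mulmxA; congr (P *m _).
rewrite {1}BE QE.
have -> : diag_mx (\row_i k i) = block_mx (k ord0)%:M 0 0
    (diag_mx (\row_i k (lift ord0 i))) :> 'M[R]_(1 + n).
  have -> : (k ord0)%:M = diag_mx (\row_(i < 1) k ord0) :> 'M[R]_1.
    by apply/matrixP => i j; rewrite !ord1 !mxE.
  rewrite -diag_mx_row; congr diag_mx.
  apply/rowP => i; rewrite mxE -[RHS]/(row_mx _ _ 0 i) mxE; case: splitP => j ij.
    by rewrite mxE; congr k; apply/val_inj; rewrite /= ij ord1.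
  by rewrite mxE; congr k; apply/val_inj.
have -> : Q1^T = block_mx 1%:M 0 0 Q^T :> 'M[R]_(1 + n).
  by rewrite tr_block_mx !trmx0 trmx1.
rewrite /Q1 !(@mulmx_block _ 1 n 1 n 1 n).
by rewrite !(mulmx0, mul0mx, addr0, add0r, mul1mx, mulmx1) mulmxA.
Qed.

End Spectral.

(** * Asymptotic lower bound *)

Section BoundedC1.
Context {R : realType} {n : nat}.
Local Notation V := 'rV[R]_n.
Context (Omega : set V).

Definition bdd_on (f : V -> R) := exists C, forall x, Omega x -> `|f x| <= C.

Lemma bdd_onD f g : bdd_on f -> bdd_on g -> bdd_on (fun x => f x + g x).
Proof.
move=> [C fC] [C' gC]; exists (C + C') => x Ox.
by apply: le_trans (ler_normD _ _) _; apply: lerD; [exact: fC|exact: gC].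
Qed.

Lemma bdd_onM f g : bdd_on f -> bdd_on g -> bdd_on (fun x => f x * g x).
Proof.
move=> [C fC] [C' gC]; exists (C * C') => x Ox.
by rewrite normrM ler_pM //; [exact: fC|exact: gC].
Qed.

Lemma bdd_onN f : bdd_on f -> bdd_on (fun x => - f x).
Proof. by move=> [C fC]; exists C => x Ox; rewrite normrN; exact: fC. Qed.

Lemma bdd_on_cst c : bdd_on (fun=> c).
Proof. by exists `|c|. Qed.

Lemma bdd_on_sum (I : Type) (s : seq I) (F : I -> V -> R) :
  (forall i, bdd_on (F i)) -> bdd_on (fun x => \sum_(i <- s) F i x).
Proof.
move=> bF; elim: s => [|i s [C sC]].
  by exists 0 => x _; rewrite big_nil normr0.
have [C' iC] := bF i; exists (C' + C) => x Ox; rewrite big_cons.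
by apply: le_trans (ler_normD _ _) _; apply: lerD; [exact: iC|exact: sC].
Qed.

Lemma bdd_onV f c : 0 < c -> (forall x, Omega x -> c <= f x) ->
  bdd_on (fun x => (f x)^-1).
Proof.
move=> c0 fc; exists c^-1 => x Ox; have fx := fc x Ox.
have f0 := lt_le_trans c0 fx.
by rewrite ger0_norm ?invr_ge0 ?(ltW f0) // lef_pV2.
Qed.

Lemma bdd_on_eq f g : (forall x, f x = g x) -> bdd_on f -> bdd_on g.
Proof. by move=> fg [C fC]; exists C => x Ox; rewrite -fg; exact: fC. Qed.

Lemma bdd_on_continuous f : compact (closure Omega) -> continuous f -> bdd_on f.
Proof.
move=> cO fc; have [C _ fC] := within_bounded cO (continuous_subspaceT fc).
by exists C => x /subset_closure /fC.
Qed.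

(** The error terms of the lower bound have to be uniform up to the boundary, hence bounds on all of
    [Omega] for the derivatives too. *)
Definition C1b (f : V -> R) := exists df,
  [/\ C1 Omega f df, bdd_on f & forall i, bdd_on (df i)].

Lemma C1bD f g : C1b f -> C1b g -> C1b (fun x => f x + g x).
Proof.
move=> [df [hf bf bdf]] [dg [hg bg bdg]].
exists (fun i x => df i x + dg i x); split; first exact: C1D.
  exact: bdd_onD.
by move=> i; exact: bdd_onD.
Qed.

Lemma C1bM f g : C1b f -> C1b g -> C1b (fun x => f x * g x).
Proof.
move=> [df [hf bf bdf]] [dg [hg bg bdg]].
exists (fun i x => df i x * g x + f x * dg i x); split; first exact: C1M.
  exact: bdd_onM.
by move=> i; apply: bdd_onD; exact: bdd_onM.
Qed.

Lemma C1b_cst c : C1b (fun=> c).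
Proof.
exists (fun _ _ => 0); split; first exact: C1_cst; last move=> i;
  exact: bdd_on_cst.
Qed.

Lemma C1b_sum (I : Type) (s : seq I) (F : I -> V -> R) :
  (forall i, C1b (F i)) -> C1b (fun x => \sum_(i <- s) F i x).
Proof.
move=> bF; elim: s => [|i s ih].
  rewrite (_ : (fun x => _) = (fun=> 0)); first exact: C1b_cst.
  by apply/funext => x; rewrite big_nil.
rewrite (_ : (fun x => _) = (fun x => F i x + \sum_(j <- s) F j x)); first exact: C1bD.
by apply/funext => x; rewrite big_cons.
Qed.

Lemma C1bV f c : 0 < c -> (forall x, Omega x -> c <= f x) -> C1b f ->
  C1b (fun x => (f x)^-1).
Proof.
move=> c0 fc [df [hf bf bdf]].
exists (fun i x => - (f x) ^- 2 * df i x); split.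
- by apply: C1V => // x Ox; rewrite gt_eqF // (lt_le_trans c0 (fc x Ox)).
- exact: bdd_onV fc.
- move=> i; apply: bdd_onM => //; apply: bdd_onN.
  apply: (@bdd_on_eq (fun x => (f x)^-1 * (f x)^-1)).
    by move=> x; rewrite expr2 invfM.
  by apply: bdd_onM; exact: bdd_onV fc.
Qed.

(* A bump with Euclidean support: the sup norm is not differentiable. *)
Definition bump (x : V) (r : R) (y : V) : R :=
  pos (r ^+ 2 - dot (y - x) (y - x)) ^+ 2.

Lemma bump_C1b x r : compact (closure Omega) -> C1b (bump x r).
Proof.
move=> cO.
have hc j := C1B (@C1_coord _ _ setT j) (@C1_cst _ _ setT (x 0 j)).
have hs := C1_sum (index_enum 'I_n) (fun j => C1M (hc j) (hc j)).
have hb := C1_posX 0 (C1B (@C1_cst _ _ setT (r ^+ 2)) hs).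
have E : bump x r = (fun y => pos (r ^+ 2 - \sum_j (y 0 j - x 0 j) * (y 0 j - x 0 j)) ^+ 2).
  apply/funext => y; rewrite /bump /dot; congr (pos (_ - _) ^+ 2).
  by apply: eq_bigr => j _; rewrite !mxE.
rewrite E; eexists; split; first exact: C1S hb.
- by apply: bdd_on_continuous => // y; exact: (C1_cont hb (I : setT y)).
- by move=> i; apply: bdd_on_continuous => // y; exact: (C1_dcont hb (I : setT y)).
Qed.

Lemma bump_ge0 x r y : 0 <= bump x r y.
Proof. by rewrite sqr_ge0. Qed.

Lemma dot_norm_le (u : V) : dot u u <= n%:R * `|u| ^+ 2.
Proof.
apply: le_trans (_ : \sum_(i < n) `|u| ^+ 2 <= _).
  apply: ler_sum => i _; rewrite -expr2 -real_normK ?num_real //.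
  by rewrite lerXn2r ?nnegrE // rV_coord_le_norm.
by rewrite sumr_const card_ord mulr_natl lexx.
Qed.

Lemma norm_dot_le (u : V) : `|u| ^+ 2 <= dot u u.
Proof.
have d0 := dot_ge0 u.
suff : `|u| <= Num.sqrt (dot u u).
  by move=> h; rewrite -(sqr_sqrtr d0) lerXn2r ?nnegrE // sqrtr_ge0.
apply: rV_norm_le => [|i]; first exact: sqrtr_ge0.
rewrite -[`|u 0 i|]ger0_norm // -sqrtr_sqr ler_sqrt // real_normK ?num_real //.
by rewrite /dot (bigD1 i) //= -expr2 lerDl sumr_ge0 // => j _; rewrite -expr2 sqr_ge0.
Qed.

Lemma bump_support x r y : 0 < r -> bump x r y != 0 -> `|x - y| < r.
Proof.
move=> r0; apply: contraNT; rewrite -leNgt distrC => xy; apply/eqP.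
rewrite /bump pos_le0 ?expr0n // subr_le0; apply: le_trans (norm_dot_le _).
by rewrite lerXn2r ?nnegrE //; exact: ltW.
Qed.

(** The divisor n + 1 pays for passing from the sup norm to the Euclidean norm: n / (n + 1)^2 <= 1 /
    2. *)
Lemma bump_center x r y : 0 < r -> `|x - y| < r / (n%:R + 1) ->
  (r ^+ 2 / 2) ^+ 2 <= bump x r y.
Proof.
move=> r0 xy; rewrite /bump.
have n0 : 0 <= n%:R :> R by [].
have n1 : 0 < n%:R + 1 :> R by lra.
have d1 := dot_norm_le (y - x).
have d2 : `|y - x| ^+ 2 <= (r / (n%:R + 1)) ^+ 2.
  have rr : 0 <= r / (n%:R + 1) by apply: divr_ge0; exact: ltW.
  by rewrite distrC lerXn2r ?nnegrE //; exact: ltW.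
have d3 : n%:R * (r / (n%:R + 1)) ^+ 2 <= r ^+ 2 / 2.
  rewrite expr_div_n mulrCA; apply: ler_wpM2l; first exact: sqr_ge0.
  by rewrite ler_pdivrMr ?exprn_gt0 // ler_pdivlMl //; nra.
have d4 : n%:R * `|y - x| ^+ 2 <= n%:R * (r / (n%:R + 1)) ^+ 2 by apply: ler_wpM2l.
have r2 : 0 < r ^+ 2 by rewrite exprn_gt0.
have d5 : r ^+ 2 / 2 <= r ^+ 2 - dot (y - x) (y - x) by lra.
by rewrite pos_id; [rewrite lerXn2r ?nnegrE //; lra|lra].
Qed.

End BoundedC1.

(** For the combination W, |W|^2 = sum th_i (w_i . W) and w_i . W <= (K + |W|^2) / 2, so |W|^2 <= (K
    + |W|^2) / 2. *)
Lemma convex_dot_le (R : realType) n (I : eqType) (s : seq I) (th : I -> R)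
    (w : I -> 'rV[R]_n) (K : R) :
  0 <= K -> (forall i, 0 <= th i) -> \sum_(i <- s) th i <= 1 ->
  (forall i, i \in s -> dot (w i) (w i) <= K) ->
  dot (\sum_(i <- s) th i *: w i) (\sum_(i <- s) th i *: w i) <= K.
Proof.
move=> K0 th0 th1 wK; set W := \sum_(i <- s) _.
have E : dot W W = \sum_(i <- s) th i * dot (w i) W.
  rewrite /dot (eq_bigr (fun k => \sum_(i <- s) th i * (w i 0 k * W 0 k))).
    by rewrite exchange_big; apply: eq_bigr => i _; rewrite mulr_sumr.
  move=> k _; rewrite {1}/W summxE mulr_suml; apply: eq_bigr => i _.
  by rewrite mxE mulrA.
have WW0 := dot_ge0 W.
have H : dot W W <= \sum_(i <- s) th i * ((K + dot W W) / 2).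
  rewrite {1}E big_seq [leRHS]big_seq; apply: ler_sum => i si.
  apply: ler_wpM2l => //; have := wK i si; have := dot_ge0 (w i - W).
  have -> : dot (w i - W) (w i - W) = dot (w i) (w i) + dot W W - 2 * dot (w i) W.
    rewrite /dot mulr_sumr -big_split -sumrB /=; apply: eq_bigr => k _ /=.
    by rewrite !mxE; ring.
  lra.
rewrite -mulr_suml in H.
have : (\sum_(i <- s) th i) * ((K + dot W W) / 2) <= (K + dot W W) / 2.
  by apply: ler_piMl => //; rewrite divr_ge0 // addr_ge0.
lra.
Qed.

Section FilterLimits.
Context {R : realType} {T : Type} {F : set_system T} {FF : ProperFilter F}.
Implicit Types (f g : T -> R) (a b : R).

Lemma flimD f g a b : f @ F --> a -> g @ F --> b -> (f y + g y) @[y --> F] --> a + b.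
Proof. by move=> fa gb; exact: (@cvgD _ _ _ F _ f g a b fa gb). Qed.

Lemma flimM f g a b : f @ F --> a -> g @ F --> b -> (f y * g y) @[y --> F] --> a * b.
Proof. by move=> fa gb; exact: (@cvgM _ _ F _ f g a b fa gb). Qed.

Lemma flim_cst a : (a : R) @[y --> F] --> a.
Proof. exact: cvg_cst. Qed.

Lemma flim_sum (I : Type) (s : seq I) (f : I -> T -> R) (a : I -> R) :
  (forall i, f i @ F --> a i) ->
  (\sum_(i <- s) f i y) @[y --> F] --> \sum_(i <- s) a i.
Proof.
move=> fa; elim: s => [|i s ih].
  rewrite big_nil (_ : (fun y => _) = (fun=> 0)); first exact: flim_cst.
  by apply/funext => y; rewrite big_nil.
rewrite big_cons (_ : (fun y => _) = (fun y => f i y + \sum_(j <- s) f j y)).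
  exact: flimD.
by apply/funext => y; rewrite big_cons.
Qed.

End FilterLimits.

Section LowerBound.
Context {R : realType} {n : nat}.
Local Notation V := 'rV[R]_n.
Context (Omega : set V) (oOmega : open Omega) (cOmega : compact (closure Omega)).
Context (alpha : R) (alpha_gt0 : 0 < alpha) (m v : V -> R).
Hypothesis m_C2 : Ck_ext 2 Omega m.
Hypothesis v_cont : {within closure Omega, continuous v}.
Context (lambda : R -> R).
Hypothesis lambda_principal :
  forall D, 0 < D -> principal_eigenvalue Omega alpha m v D (lambda D).

Definition critical_point (x : V) :=
  closure Omega x /\ forall i, ext Omega (pd i m) x = 0.

Lemma pot_C1 : C1 Omega m (fun i => pd i m).
Proof. by apply: Ck_ext_C1 => //; exact: Ck_extS. Qed.

Lemma pd_pot_C1 k : C1 Omega (pd k m) (fun i => pd i (pd k m)).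
Proof. by apply: Ck_ext_C1 => //; exact: Ck_ext_pd. Qed.

Lemma v_cfor x : Omega x -> {for x, continuous v}.
Proof. by move=> Ox; exact: within_closure_continuous v_cont. Qed.

Lemma ext_cvg_pd2 x i k : closure Omega x ->
  pd i (pd k m) y @[y --> within Omega (nbhs x)] --> ext Omega (pd i (pd k m)) x.
Proof. by move=> cx; apply: (Ck_ext_cvg (Ck_ext_pd i (Ck_ext_pd k m_C2)) cx). Qed.

Lemma v_cvg x : closure Omega x -> v y @[y --> within Omega (nbhs x)] --> v x.
Proof.
move=> cx; have PF : ProperFilter (within Omega (nbhs x)) by exact: within_nbhs_proper.
apply: (iffRL (@cvgrPdist_lt _ _ _ _ _ _ _)) => e e0.
have [d d0 dP] := within_closure_dist cx v_cont e0.
apply/nbhs_ballP; exists d => // y; rewrite -ball_normE => xy Oy.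
exact: dP (subset_closure Oy) xy.
Qed.

(** This is v + div Y for Y = alpha (grad m + S grad m) with [S] constant: what the lower bound
    retains at a critical point, where the 1 / D term vanishes. *)
Definition local_energy (S : 'M[R]_n) (y : V) : R :=
  v y + alpha * (\sum_i pd i (pd i m) y)
      + alpha * (\sum_k \sum_i S k i * pd i (pd k m) y).

Definition local_energy_ext (S : 'M[R]_n) (x : V) : R :=
  v x + alpha * (\sum_i ext Omega (pd i (pd i m)) x)
      + alpha * (\sum_k \sum_i S k i * ext Omega (pd i (pd k m)) x).

Lemma local_energy_near x S f0 : closure Omega x -> f0 < local_energy_ext S x ->
  exists2 r, 0 < r & forall y, Omega y -> `|x - y| < r -> f0 <= local_energy S y.
Proof.
move=> cx fx; have PF : ProperFilter (within Omega (nbhs x)) by exact: within_nbhs_proper.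
have L : local_energy S y @[y --> within Omega (nbhs x)] --> local_energy_ext S x.
  apply: flimD; first apply: flimD; first exact: v_cvg.
    apply: flimM; first exact: flim_cst.
    by apply: flim_sum => i; exact: ext_cvg_pd2.
  apply: flimM; first exact: flim_cst.
  apply: flim_sum => k; apply: flim_sum => i.
  by apply: flimM; [exact: flim_cst|exact: ext_cvg_pd2].
have e0 : 0 < local_energy_ext S x - f0 by rewrite subr_gt0.
have /nbhs_ballP[r r0 rP] : nbhs x [set y | Omega y ->
    `|local_energy_ext S x - local_energy S y| < local_energy_ext S x - f0].
  exact: (iffLR (@cvgrPdist_lt _ _ _ _ _ _ _) L _ e0).
exists r => // y Oy xy; have := rP y; rewrite -ball_normE => /(_ xy Oy).
by move=> /(le_lt_trans (ler_norm _)); lra.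
Qed.

Definition grad_sq (y : V) : R := \sum_i pd i m y ^+ 2.

Lemma grad_sq_near x : closure Omega x -> ~ critical_point x ->
  exists r, 0 < r /\ exists2 c, 0 < c &
    forall y, Omega y -> `|x - y| < r -> c <= grad_sq y.
Proof.
move=> cx ncx.
have [i li] : exists i, ext Omega (pd i m) x != 0.
  apply: contrapT => H; apply: ncx; split => // i.
  by apply/eqP/negPn/negP => li; apply: H; exists i.
set l := ext _ _ _ in li.
have l0 : 0 < `|l| / 2 by rewrite divr_gt0 // normr_gt0.
have [r r0 rP] := ext_dist cx (Ck_ext_cvg (Ck_ext_pd i m_C2) cx) l0.
exists r; split => //; exists ((`|l| / 2) ^+ 2); first by rewrite exprn_gt0.
move=> y Oy xy; have H := rP y Oy xy; rewrite -/l in H.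
have H2 : `|l| / 2 <= `|pd i m y|.
  by have := ler_normD (l - pd i m y) (pd i m y); rewrite subrK; lra.
apply: le_trans (_ : pd i m y ^+ 2 <= _).
  by rewrite -[leRHS]real_normK ?num_real // lerXn2r ?nnegrE //; exact: ltW.
by rewrite /grad_sq (bigD1 i) //= lerDl sumr_ge0 // => j _; rewrite sqr_ge0.
Qed.

Lemma sq_completion (b K a : R) : 0 < b -> - (K ^+ 2 / (4 * b)) <= b * a ^+ 2 - K * `|a|.
Proof.
move=> b0; rewrite -[a ^+ 2]real_normK ?num_real // -subr_ge0.
have -> : b * `|a| ^+ 2 - K * `|a| - - (K ^+ 2 / (4 * b)) = b * (`|a| - K / (2 * b)) ^+ 2.
  by field; rewrite gt_eqF.
by rewrite mulr_ge0 ?sqr_ge0 // ltW.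
Qed.

(** One coordinate of the lower bound for Y = alpha (a + w): the cross terms a w cancel. *)
Lemma completed_square_split (D a w h s t : R) : D != 0 ->
  (2 * alpha * (a * (alpha * (a + w))) - (alpha * (a + w)) ^+ 2) / D +
    alpha * (h + (s + t)) =
  alpha ^+ 2 / D * (a ^+ 2 - w * w) + alpha * h + alpha * s + alpha * t.
Proof. by move=> D0; field. Qed.

Lemma trace_shuffle (I : Type) (s : seq I) (th : I -> R) (S : I -> 'M[R]_n)
    (h : 'I_n -> 'I_n -> R) :
  alpha * (\sum_i \sum_k (\sum_(x <- s) S x k i * th x) * h i k) =
  \sum_(x <- s) th x * (alpha * (\sum_k \sum_i S x k i * h i k)).
Proof.
under [RHS]eq_bigr => x _ do rewrite mulrCA.
rewrite -mulr_sumr exchange_big /=; congr (_ * _).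
under [RHS]eq_bigr => x _ do rewrite mulr_sumr.
rewrite [RHS]exchange_big /=; apply: eq_bigr => k _.
under [RHS]eq_bigr => x _ do rewrite mulr_sumr.
rewrite [RHS]exchange_big /=; apply: eq_bigr => i _.
by rewrite mulr_suml; apply: eq_bigr => x _; ring.
Qed.

(** A finite list in place of an infimum over all critical points: the existence of a minimizer can
    then be deduced from this bound. When the list is empty, [f0] is arbitrary, which is the case of
    divergence to +oo. *)
Lemma lambda_lower (f : V -> R) :
  (forall x, critical_point x -> exists2 S : 'M[R]_n,
     exists2 rho, rho < 1 & forall u : V, dot (u *m S) (u *m S) <= rho * dot u u &
     f x < local_energy_ext S x) ->
  exists2 s : seq V, forall x, x \in s -> critical_point x &
    forall f0, (forall x, x \in s -> f0 <= f x) -> forall e, 0 < e ->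
    exists2 D0, 0 < D0 & forall D, 0 < D -> D < D0 -> f0 - e <= lambda D.
Proof.
move=> fS.
(* At a critical point: a contraction, and a radius on which its energy is at least f x. At other
   points of the closure: a radius and a positive bound for |grad m|^2. Elsewhere a dummy value. *)
have data x : exists p : 'M[R]_n * R * R * R, closure Omega x ->
  let: (Sx, rho, r, c) := p in
  [/\ rho < 1, 0 < r, 0 < c &
     (critical_point x -> (forall u : V, dot (u *m Sx) (u *m Sx) <= rho * dot u u) /\
      (forall y, Omega y -> `|x - y| < r -> f x <= local_energy Sx y) /\
      c = (r ^+ 2 / 2) ^+ 2) /\
     (~ critical_point x -> forall y, Omega y -> `|x - y| < r -> c <= grad_sq y)].
  have [cx|ncx] := pselect (closure Omega x); last by exists (0, 0, 0, 0).
  have [crit|ncrit] := pselect (critical_point x).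
    have [S [rho rho1 rhoP] fx] := fS x crit.
    have [r r0 rP] := local_energy_near cx fx.
    exists (S, rho, r, (r ^+ 2 / 2) ^+ 2) => _; split => //.
    by rewrite !(exprn_gt0, divr_gt0).
  have [r [r0 [c c0 rP]]] := grad_sq_near cx ncrit.
  by exists (0, 0, r, c) => _; split.
have [p pP] := choice data.
pose S x := (p x).1.1.1; pose rho x := (p x).1.1.2.
pose r x := (p x).1.2; pose c x := (p x).2.
have {}pP x : closure Omega x -> [/\ rho x < 1, 0 < r x, 0 < c x &
     (critical_point x -> (forall u : V, dot (u *m S x) (u *m S x) <= rho x * dot u u) /\
      (forall y, Omega y -> `|x - y| < r x -> f x <= local_energy (S x) y) /\
      c x = (r x ^+ 2 / 2) ^+ 2) /\
     (~ critical_point x -> forall y, Omega y -> `|x - y| < r x -> c x <= grad_sq y)].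
  by move=> cx; have := pP x cx; rewrite /S /rho /r /c; case: (p x) => [[[? ?] ?] ?].
have n1 : 1 <= n%:R + 1 :> R by rewrite lerDr.
have n0 : 0 < n%:R + 1 :> R by apply: lt_le_trans n1.
(* The reduced radii put each point where [bump_center] bounds the bump of its critical center from
   below. *)
have [|s sO sP] := @compact_ball_cover _ _ (closure Omega) (fun x => r x / (n%:R + 1)) cOmega.
  by move=> x cx; have [_ ? _ _] := pP x cx; rewrite divr_gt0.
pose s1 := [seq x <- s | `[< critical_point x >]].
have s1P x : x \in s1 -> x \in s /\ critical_point x.
  by rewrite mem_filter => /andP[/asboolP].
exists s1; first by move=> x /s1P[].
have [rh [rh0 rh1 rhP]] : exists rh, [/\ 0 < rh, rh <= 1 & forall x, x \in s1 ->
    forall u : V, dot (u *m S x) (u *m S x) <= (1 - rh) * dot u u].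
  have mono (x : V) t t' : t' <= t ->
      (forall u : V, dot (u *m S x) (u *m S x) <= (1 - t) * dot u u) ->
      (forall u : V, dot (u *m S x) (u *m S x) <= (1 - t') * dot u u).
    move=> tt' H u.
    by apply: le_trans (H u) _; apply: ler_wpM2r; [exact: dot_ge0|lra].
  have [x /s1P[xs crit]|t t0 tP] := seq_min_pos (s := s1) mono.
    have [rh1 _ _ [/(_ crit)[H _] _]] := pP x (sO x xs).
    by exists (1 - rho x); [rewrite subr_gt0|rewrite opprB addrCA subrr addr0].
  exists (Num.min t 1); split; first by rewrite lt_min t0 ltr01.
    by rewrite ge_min lexx orbT.
  by move=> x xs; apply: mono (tP x xs); rewrite ge_min lexx.
have [c0 c00 c0P] : exists2 c0, 0 < c0 & forall x, x \in s -> c0 <= c x.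
  apply: seq_min_pos => [x t t' tt' H|x xs]; first exact: le_trans H.
  by have [_ _ cx _] := pP x (sO x xs); exists (c x).
(* Bounded below on [Omega]: a covering ball around a critical point contributes its bump, any other
   covering ball contributes |grad m|^2. *)
pose den y := grad_sq y + \sum_(x <- s1) bump x (r x) y.
have denP y : Omega y -> c0 <= den y.
  move=> Oy; have [x xs xy] := sP y (subset_closure Oy).
  have [_ r0 cx0 [H1 H2]] := pP x (sO x xs).
  apply: le_trans (c0P x xs) _; rewrite /den.
  have g0 : 0 <= grad_sq y by apply: sumr_ge0 => i _; rewrite sqr_ge0.
  have [crit|ncrit] := pselect (critical_point x).
    have [_ [_ ->]] := H1 crit.
    have xs1 : x \in s1 by rewrite mem_filter xs andbT; apply/asboolP.
    apply: le_trans (bump_center r0 xy) _; rewrite (big_rem x xs1) /= addrCA lerDl.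
    by apply: addr_ge0 => //; apply: sumr_ge0 => z _; exact: bump_ge0.
  have xyr : `|x - y| < r x.
    by apply: lt_le_trans xy _; rewrite ler_pdivrMr // ler_peMr // ltW.
  apply: le_trans (H2 ncrit y Oy xyr) _; rewrite lerDl.
  by apply: sumr_ge0 => z _; exact: bump_ge0.
have bpd k : bdd_on Omega (pd k m).
  have [C _ CP] := ext_bounded cOmega (fun x => @Ck_ext_cvg _ _ 1 _ _ x (Ck_ext_pd k m_C2)).
  by exists C.
have bpd2 i k : bdd_on Omega (pd i (pd k m)).
  have [C _ CP] := ext_bounded cOmega
    (fun x => @Ck_ext_cvg _ _ 0 _ _ x (Ck_ext_pd i (Ck_ext_pd k m_C2))).
  by exists C.
have bv : bdd_on Omega v.
  by have [C _ CP] := within_bounded cOmega v_cont; exists C => x /subset_closure /CP.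
have bm : bdd_on Omega m.
  by have [C _ CP] := ext_bounded cOmega (fun x => @Ck_ext_cvg _ _ 2 _ _ x m_C2); exists C.
have Cpd k : C1b Omega (pd k m).
  by exists (fun i => pd i (pd k m)); split => //; exact: pd_pot_C1.
have Cden : C1b Omega den.
  apply: C1bD; last by apply: C1b_sum => x; exact: bump_C1b.
  by apply: C1b_sum => i; exact: (C1bM (Cpd i) (Cpd i)).
have CdenV := C1bV c00 denP Cden.
(* The weights sum to 1 - |grad m|^2 / den. They are C^1 up to bounded derivatives, and the missing
   mass is of order |grad m|^2. *)
pose th x y := bump x (r x) y * (den y)^-1.
have Cth x : C1b Omega (th x) by apply: C1bM => //; exact: bump_C1b.
pose T k i y := \sum_(x <- s1) S x k i * th x y.
have CT (q : 'I_n * 'I_n) : C1b Omega (T q.1 q.2).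
  by apply: C1b_sum => x; apply: C1bM => //; exact: C1b_cst.
have [dT0 dTP] := choice CT.
pose dT k i := dT0 (k, i).
have hT k i : C1 Omega (T k i) (dT k i) by have [] := dTP (k, i).
have bdT k i j : bdd_on Omega (dT k i j) by have [_ _] := dTP (k, i); apply.
pose Y i y := alpha * (pd i m y + \sum_k T k i y * pd k m y).
have hY i := C1Z alpha (C1D (pd_pot_C1 i)
  (C1_sum (index_enum 'I_n) (fun k => C1M (hT k i) (pd_pot_C1 k)))).
have [Cp CpP] : bdd_on Omega (fun y => v y + alpha * (\sum_i pd i (pd i m) y)).
  apply: bdd_onD => //; apply: bdd_onM; first exact: bdd_on_cst.
  exact: bdd_on_sum.
have [CT1 CT1P] : exists C, forall k y, Omega y -> `|\sum_i dT k i i y| <= C.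
  have B k : bdd_on Omega (fun y => \sum_i dT k i i y) by apply: bdd_on_sum => i.
  have [C CP] := choice B; exists (\sum_k `|C k|) => k y Oy.
  apply: le_trans (CP k y Oy) _; rewrite (bigD1 k) //=.
  apply: le_trans (ler_norm _) _; rewrite lerDl; exact: sumr_ge0.
move=> f0 f0s e e0.
(* K1 |grad m|^2 covers the missing mass of the weights, and K2 sum |d_k m| the derivatives of T.
   With [b0], completing squares in the latter costs at most n K2^2 / (4 b0) <= e. For D below the
   threshold, alpha^2 rh / D exceeds K1 + b0. *)
pose K1 := (`|Cp| + `|f0|) / c0; pose K2 := alpha * `|CT1|.
have K10 : 0 <= K1 by rewrite divr_ge0 ?addr_ge0 // ltW.
have K20 : 0 <= K2 by rewrite mulr_ge0 // ltW.
pose b0 := n%:R * K2 ^+ 2 / (4 * e) + 1.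
have b00 : 0 < b0 by rewrite ltr_wpDl // divr_ge0 ?mulr_ge0 ?sqr_ge0 // ltW.
have D00 : 0 < alpha ^+ 2 * rh / (K1 + b0).
  by rewrite divr_gt0 ?mulr_gt0 ?exprn_gt0 // ltr_wpDl.
exists (alpha ^+ 2 * rh / (K1 + b0)) => // D D0 DD.
have [[phi phi_eig phi0] _] := lambda_principal D0.
have [Cm CmP] := bm; have [Cv CvP] := bv.
apply: (eigenvalue_ge oOmega pot_C1 v_cfor D0 phi_eig phi0 cOmega CmP CvP hY) => y Oy.
pose a : V := \row_k pd k m y.
have aG : dot a a = grad_sq y by apply: eq_bigr => k _; rewrite !mxE expr2.
pose W : V := \sum_(x <- s1) th x y *: (a *m S x).
have den0 : 0 < den y := lt_le_trans c00 (denP y Oy).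
have th0 x : 0 <= th x y by rewrite mulr_ge0 ?bump_ge0 // invr_ge0 ltW.
have g0 : 0 <= grad_sq y by rewrite -aG dot_ge0.
have sth : \sum_(x <- s1) th x y = 1 - grad_sq y / den y.
  rewrite -mulr_suml -[1](mulfV (lt0r_neq0 den0)) -mulrBl; congr (_ / _).
  by rewrite /den addrC addKr.
have sth1 : \sum_(x <- s1) th x y <= 1.
  by rewrite sth lerBlDr lerDl divr_ge0 // ltW.
have WE i : W 0 i = \sum_k T k i y * pd k m y.
  rewrite /W summxE /T (eq_bigr (fun x => \sum_k S x k i * th x y * pd k m y)).
    by rewrite exchange_big; apply: eq_bigr => k _; rewrite mulr_suml.
  move=> x _; rewrite !mxE mulr_sumr; apply: eq_bigr => k _; rewrite mxE; ring.
have WW : dot W W <= (1 - rh) * grad_sq y.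
  apply: convex_dot_le => //; first by rewrite mulr_ge0 // subr_ge0.
  by move=> x xs; rewrite -aG; exact: rhP.
pose pt y := v y + alpha * (\sum_i pd i (pd i m) y).
pose Ex x := alpha * (\sum_k \sum_i S x k i * pd i (pd k m) y).
have step1 : \sum_i ((2 * alpha * (pd i m y * (alpha * (pd i m y + \sum_k T k i y * pd k m y)))
      - (alpha * (pd i m y + \sum_k T k i y * pd k m y)) ^+ 2) / D
      + alpha * (pd i (pd i m) y + \sum_k (dT k i i y * pd k m y + T k i y * pd i (pd k m) y)))
   = alpha ^+ 2 / D * (grad_sq y - dot W W) + alpha * (\sum_i pd i (pd i m) y)
     + alpha * (\sum_i \sum_k dT k i i y * pd k m y)
     + alpha * (\sum_i \sum_k T k i y * pd i (pd k m) y).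
  rewrite /grad_sq /dot -sumrB !mulr_sumr -!big_split /=; apply: eq_bigr => i _.
  by rewrite WE big_split /=; apply: completed_square_split; rewrite gt_eqF.
have step2 : alpha * (\sum_i \sum_k T k i y * pd i (pd k m) y) =
    \sum_(x <- s1) th x y * Ex x.
  exact: (trace_shuffle s1 (fun x => th x y) S (fun i k => pd i (pd k m) y)).
have step3 : f0 - K1 * grad_sq y <= pt y + \sum_(x <- s1) th x y * Ex x.
  have H : f0 * (\sum_(x <- s1) th x y) <= \sum_(x <- s1) th x y * (pt y + Ex x).
    rewrite mulr_sumr big_seq [leRHS]big_seq; apply: ler_sum => x xs1.
    have [xs crit] := s1P x xs1.
    have [->|t0] := eqVneq (th x y) 0; first by rewrite mulr0 mul0r.
    rewrite mulrC; apply: ler_wpM2l => //; apply: le_trans (f0s x xs1) _.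
    have [_ r0 _ [/(_ crit)[_ [H _]] _]] := pP x (sO x xs).
    apply: H => //; apply: bump_support => //.
    by apply: contraNneq t0; rewrite /th => ->; rewrite mul0r.
  have {}H : f0 * (\sum_(x <- s1) th x y) <=
      pt y * (\sum_(x <- s1) th x y) + \sum_(x <- s1) th x y * Ex x.
    apply: le_trans H _; rewrite mulr_sumr -big_split /= le_eqVlt; apply/orP; left.
    by apply/eqP/eq_bigr => x _; rewrite mulrDr [th x y * pt y]mulrC.
  rewrite sth in H; set q := grad_sq y / den y in H.
  have q0 : 0 <= q by rewrite divr_ge0 // ltW.
  have qK : (`|Cp| + `|f0|) * q <= K1 * grad_sq y.
    rewrite /K1 /q mulrA [leRHS]mulrAC; apply: ler_wpM2l.
      by rewrite mulr_ge0 // addr_ge0.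
    by rewrite lef_pV2 //; exact: denP.
  have pb : - `|Cp| <= pt y.
    by have := CpP y Oy; rewrite ler_norml => /andP[p1 _]; apply: le_trans p1; rewrite lerN2 ler_norm.
  have : (- `|Cp| - `|f0|) * q <= (pt y - f0) * q.
    by apply: ler_wpM2r => //; have := ler_norm f0; lra.
  lra.
have step4 : - (\sum_k K2 * `|pd k m y|) <= alpha * (\sum_i \sum_k dT k i i y * pd k m y).
  rewrite exchange_big /= mulr_sumr -sumrN; apply: ler_sum => k _.
  rewrite -mulr_suml mulrA -[leRHS]opprK lerN2 -mulNr; apply: le_trans (ler_norm _) _.
  rewrite normrM; apply: ler_wpM2r => //.
  rewrite normrN normrM gtr0_norm // ler_pM2l //.
  exact: le_trans (CT1P k y Oy) (ler_norm _).
have step5 : (K1 + b0) * grad_sq y <= alpha ^+ 2 / D * (grad_sq y - dot W W).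
  apply: le_trans (_ : alpha ^+ 2 / D * (rh * grad_sq y) <= _).
    rewrite mulrA; apply: ler_wpM2r => //.
    rewrite mulrAC ler_pdivlMr // mulrC -ler_pdivlMr; last by rewrite ltr_wpDl.
    exact: ltW.
  apply: ler_wpM2l; first by rewrite divr_ge0 ?sqr_ge0 // ltW.
  lra.
have step6 : - e <= b0 * grad_sq y - \sum_k K2 * `|pd k m y|.
  apply: le_trans (_ : \sum_(k < n) - (K2 ^+ 2 / (4 * b0)) <= _).
    rewrite sumr_const card_ord mulNrn lerN2 -[_ *+ n]mulr_natl mulrA ler_pdivrMr ?mulr_gt0 //.
    rewrite /b0 mulrDr mulr1 mulrDr.
    have -> : e * (4 * (n%:R * K2 ^+ 2 / (4 * e))) = n%:R * K2 ^+ 2.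
      by field; rewrite gt_eqF.
    by rewrite lerDl mulr_ge0 // ltW.
  by rewrite /grad_sq mulr_sumr -sumrB; apply: ler_sum => k _; exact: sq_completion.
rewrite step1 step2; move: step3 step4 step5 step6; rewrite /pt mulrDl.
lra.
Qed.

End LowerBound.

(** * Asymptotic upper bound *)

(** Here g = u^k and p = u^(k-1), with derivative - alpha z / (D k) of u. The constant [a1] cancels
    the term alpha^2 z^2 p^2 / D coming from D |grad g|^2, and [a2] creates - alpha^2 z^2 p^2 u^2 /
    D. Their sum tends to alpha, the coefficient for a Gaussian, where the powers k - 1 and k do not
    differ. *)
Lemma profile_identity (R : realType) (alpha D k a1 a2 a3 p u z b h y Pa : R) :
  D != 0 -> k != 0 ->
  a1 = alpha * k / (2 * k - 1) -> a2 = alpha * k / (2 * k + 1) ->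
  2 * k - 1 != 0 -> 2 * k + 1 != 0 ->
  D * (k * p * - (alpha / (D * k) * z)) ^+ 2
    - 2 * alpha * (p * u) * (k * p * - (alpha / (D * k) * z) * b)
    + alpha ^+ 2 / D * b ^+ 2 * (p * u) ^+ 2
  + (alpha * (2 * k * (p ^+ 2 * u) * - (alpha / (D * k) * z) * b
              + p ^+ 2 * u ^+ 2 * h)
     + (a1 * ((2 * k - 1) * p ^+ 2 * - (alpha / (D * k) * z) * z
              + p ^+ 2 * u * Pa)
     + (a2 * ((2 * k + 1) * (p ^+ 2 * u ^+ 2) * - (alpha / (D * k) * z) * z
              + p ^+ 2 * u ^+ 3 * Pa)
     + a3 * (2 * k * (p ^+ 2 * u) * - (alpha / (D * k) * z) * y
              + p ^+ 2 * u ^+ 2 * 1))))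
  = p ^+ 2 * u ^+ 2 * (alpha ^+ 2 / D * (b ^+ 2 - z * z) + alpha * h)
    + p ^+ 2 * u * (a1 + a2 * u ^+ 2) * Pa
    + a3 * (p ^+ 2 * u ^+ 2 - 2 * (p ^+ 2 * u) * (alpha / D * (z * y))).
Proof.
move=> D0 k0 -> -> k1 k2; field.
by rewrite k1 k2 D0 k0.
Qed.

Lemma profile_sum (R : realType) n (alpha E F X Y W a3 : R)
    (b z h y Pa : 'I_n -> R) :
  \sum_i (X * (E * (b i ^+ 2 - z i * z i) + alpha * h i) + Y * Pa i
           + a3 * (X - W * (F * (z i * y i)))) =
  X * (E * (\sum_i b i ^+ 2 - \sum_i z i * z i) + alpha * \sum_i h i)
  + Y * \sum_i Pa i + a3 * (n%:R * X - W * (F * \sum_i z i * y i)).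
Proof.
rewrite !big_split /= -!mulr_sumr big_split /= -!mulr_sumr !sumrB.
by rewrite sumr_const card_ord -!mulr_sumr mulr_natl.
Qed.

(** The term a1 t p^2 u is not dominated by g^2 = p^2 u^2 near the edge u = 0. Since q = 2 k (1 -
    u), the radial field with coefficient a1 t / (4 k) trades it for a1 t p^2 u^2, at a relative
    cost N / (4 k). *)
Lemma profile_trace (R : realType) (k a1 a2 t p u q N : R) : k != 0 ->
  q = 2 * k * (1 - u) ->
  p ^+ 2 * u * (a1 + a2 * u ^+ 2) * t
    + a1 * t / (4 * k) * (N * (p ^+ 2 * u ^+ 2) - 2 * (p ^+ 2 * u) * q) =
  a2 * t * (p ^+ 2 * u ^+ 2) * u + t * (a1 * (1 + N / (4 * k))) * (p ^+ 2 * u ^+ 2).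
Proof. by move=> k0 ->; field. Qed.

Lemma profile_final (R : realType) (X E dG al A w M T a1 a2 N u : R) :
  a2 * T * X * u <= a2 * T * X -> (w + al * A + E * dG) * X <= M * X ->
  X * (E * dG + al * A) + (a2 * T * X * u + T * (a1 * (1 + N)) * X) + w * X
  <= (M + T * (a2 + a1 * (1 + N))) * X.
Proof. by move=> *; lra. Qed.

Section PolynomialTestFunction.
Context {R : realType} {n : nat}.
Local Notation V := 'rV[R]_n.
Context (Omega : set V) (oOmega : open Omega).
Context (alpha : R) (alpha_gt0 : 0 < alpha) (m v : V -> R).
Hypothesis m_C1 : C1 Omega m (fun i => pd i m).
Hypothesis pd_m_C1 : forall k, C1 Omega (pd k m) (fun i => pd i (pd k m)).
Hypothesis v_cont : forall x, Omega x -> {for x, continuous v}.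
Context (D mu : R) (D_gt0 : 0 < D) (phi : V -> R).
Hypothesis phi_eig : eigenfunction Omega alpha m v D mu phi.
Hypothesis phi_gt0 : forall x, Omega x -> 0 < phi x.
Context (P : 'M[R]_n) (P_sym : P^T = P) (c : V) (l : nat).

(* The profile (1 - q / (2 k))_+ ^ k, with k = l + 2, is a compactly supported
   substitute for the Gaussian exp (- q / 2), where q = quad. *)
Let k : R := l.+2%:R.

Definition zvec (x : V) : V := (x - c) *m P.

Definition quad (x : V) : R := alpha / D * dot (zvec x) (x - c).

Definition cutoff (x : V) : R := pos (1 - quad x / (2 * k)).

Let k_gt0 : 0 < k.
Proof. by rewrite /k ltr0n. Qed.

Lemma C1_shift_coord U a : C1 U (fun x => (x - c) 0 a) (fun i _ => (a == i)%:R).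
Proof.
have h := C1B (@C1_coord _ _ U a) (@C1_cst _ _ U (c 0 a)).
rewrite (_ : (fun x : V => _) = (fun x : V => x 0 a - c 0 a)).
  by move/C1_eq: h; apply => i x; rewrite subr0.
by apply/funext => x; rewrite !mxE.
Qed.

Lemma C1_zvec U a : C1 U (fun x => zvec x 0 a) (fun i _ => P a i).
Proof.
have h := C1_sum (index_enum 'I_n) (fun j => C1Z (P j a) (@C1_shift_coord U j)).
rewrite (_ : (fun x => _) = (fun x => \sum_j P j a * (x - c) 0 j)).
  move/C1_eq: h; apply => i x; rewrite (bigD1 i) //= eqxx mulr1 big1 ?addr0.
    by rewrite -{1}P_sym mxE.
  by move=> j ji; rewrite (negbTE ji) mulr0.
by apply/funext => x; rewrite mxE; apply: eq_bigr => j _; rewrite mulrC.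
Qed.

Lemma C1_quad U : C1 U quad (fun i x => alpha / D * (2 * zvec x 0 i)).
Proof.
apply: C1Z.
have h := C1_sum (index_enum 'I_n) (fun a => C1M (@C1_zvec U a) (@C1_shift_coord U a)).
move/C1_eq: h; apply => i x; rewrite big_split /= mulr2n mulrDl mul1r; congr (_ + _).
  by rewrite mxE; apply: eq_bigr => j _; rewrite mulrC.
rewrite (bigD1 i) //= eqxx mulr1 big1 ?addr0 // => j ji.
by rewrite (negbTE ji) mulr0.
Qed.

Lemma C1_cutoff U s : C1 U (fun x => cutoff x ^+ s.+2)
  (fun i x => s.+2%:R * cutoff x ^+ s.+1 * - (alpha / (D * k) * zvec x 0 i)).
Proof.
have h := C1_posX s (C1B (@C1_cst _ _ U 1) (C1Z (2 * k)^-1 (@C1_quad U))).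
rewrite (_ : (fun x => _) = (fun x => pos (1 - (2 * k)^-1 * quad x) ^+ s.+2)).
  move/C1_eq: h; apply => i x; rewrite /cutoff [quad x / _]mulrC sub0r.
  by congr (_ * - _); move: (zvec x 0 i) => z; field; rewrite !gt_eqF.
by apply/funext => x; rewrite /cutoff mulrC.
Qed.

(** The factor of the trace tends to alpha as k grows; M + alpha tr P is the bound that the Gaussian
    would give. *)
Lemma eigenvalue_le_profile M :
  0 <= \tr P -> (forall x, 0 <= quad x) ->
  compact [set x | quad x <= 2 * k] -> [set x | quad x <= 2 * k] `<=` Omega ->
  (forall x, quad x < 2 * k -> v x + alpha * (\sum_i pd i (pd i m) x) +
     alpha ^+ 2 / D * (\sum_i pd i m x ^+ 2 - dot (zvec x) (zvec x)) <= M) ->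
  mu <= M + \tr P * (alpha * k / (2 * k + 1)
                     + alpha * k / (2 * k - 1) * (1 + n%:R / (4 * k))).
Proof.
move=> tP q0 cK KO HM.
have k2 : 2 <= k by rewrite /k ler_nat.
pose a1 := alpha * k / (2 * k - 1); pose a2 := alpha * k / (2 * k + 1).
pose a3 := a1 * \tr P / (4 * k).
have C1p s : C1 Omega (fun x => cutoff x ^+ s.+2) _ := @C1_cutoff Omega s.
have u0 x : ~ [set x | quad x <= 2 * k] x -> cutoff x = 0.
  move=> /= /negP; rewrite -ltNge => qx; rewrite /cutoff pos_le0 // subr_le0.
  by rewrite ler_pdivlMr ?mulr_gt0 // mul1r ltW.
have cc : quad c = 0.
  by rewrite /quad subrr /dot big1 ?mulr0 // => i _; rewrite [X in _ * X]mxE mulr0.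
(* The fields u^(2k) grad m, u^(2k-1) z, u^(2k+1) z and u^(2k) (x - c). The first cancels the cross
   term of the energy and leaves alpha Laplace m; the others serve [profile_identity] and
   [profile_trace]. *)
have hZ a := C1D (C1Z alpha (C1M (C1p (2 * l).+2) (pd_m_C1 a)))
  (C1D (C1Z a1 (C1M (C1p (2 * l).+1) (@C1_zvec Omega a)))
  (C1D (C1Z a2 (C1M (C1p (2 * l).+3) (@C1_zvec Omega a)))
       (C1Z a3 (C1M (C1p (2 * l).+2) (@C1_shift_coord Omega a))))).
apply: (eigenvalue_le oOmega m_C1 v_cont D_gt0 phi_eig phi_gt0 (C1p l) _ _ hZ).
- by exists [set x | quad x <= 2 * k]; split => // x _ /u0 ->; rewrite expr0n.
- exists c; first by apply: KO; rewrite /= cc mulr_ge0 // ltW.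
  by rewrite /cutoff cc mul0r subr0 pos_id // expr1n oner_neq0.
- move=> a; exists [set x | quad x <= 2 * k]; split => // x _ /u0 ->.
  by rewrite !expr0n /= !mul0r !mulr0 !addr0.
move=> x Ox.
set u := cutoff x; pose p := u ^+ l.+1.
have uge0 : 0 <= u := pos_ge0 _.
have ule1 : u <= 1.
  rewrite /u /cutoff; case: (lerP (1 - quad x / (2 * k)) 0) => h; first by rewrite pos_le0.
  by rewrite (pos_id (ltW h)) lerBlDr lerDl divr_ge0 // mulr_ge0 // ltW.
have e1 : u ^+ l.+2 = p * u by rewrite exprSr.
have e2 : u ^+ (2 * l).+2 = p ^+ 2 by rewrite /p -exprM [(l.+1 * 2)%N]mulnC mulnS.
have e3 : u ^+ (2 * l).+3 = p ^+ 2 * u by rewrite exprSr e2.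
have e4 : u ^+ (2 * l).+4 = p ^+ 2 * u ^+ 2 by rewrite exprSr e3 -mulrA.
have e5 : u ^+ (2 * l).+3.+2 = p ^+ 2 * u ^+ 3 by rewrite exprSr e4 -mulrA -exprSr.
have n4 : (2 * l).+4%:R = 2 * k by rewrite /k -natrM !mulnS.
have n3 : (2 * l).+3%:R = 2 * k - 1 by rewrite -n4 -[X in _ = X - 1]natr1 addrK.
have n5 : (2 * l).+3.+2%:R = 2 * k + 1 by rewrite -n4 natr1.
rewrite e1 e2 e3 e4 e5 n3 n4 n5.
have kp : 2 * k - 1 != 0 by rewrite gt_eqF //; lra.
have kq : 2 * k + 1 != 0 by rewrite gt_eqF //; lra.
have I i := @profile_identity R alpha D k a1 a2 a3 p u (zvec x 0 i) (pd i m x)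
  (pd i (pd i m) x) ((x - c) 0 i) (P i i) (lt0r_neq0 D_gt0) (lt0r_neq0 k_gt0)
  erefl erefl kp kq.
rewrite addrAC -big_split /=; under eq_bigr => i _ do rewrite eqxx I.
rewrite profile_sum.
rewrite -[alpha / D * \sum_i _]/(quad x) -[\sum_i P i i]/(\tr P).
have [u_eq0|u_neq0] := eqVneq u 0.
  by rewrite u_eq0 !(expr0n, mulr0, mul0r, addr0, subr0).
have qx : 0 < 1 - quad x / (2 * k).
  by rewrite ltNge; apply: contra u_neq0 => h; rewrite /u /cutoff pos_le0.
have uE : u = 1 - quad x / (2 * k) by rewrite /u /cutoff pos_id // ltW.
have qE : quad x = 2 * k * (1 - u).
  by rewrite uE opprB addrC subrK mulrC divfK // gt_eqF // mulr_gt0.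
have qk : quad x < 2 * k by move: qx; rewrite subr_gt0 ltr_pdivrMr ?mulr_gt0 // mul1r.
rewrite -[X in X + _ <= _]addrA /a3 (profile_trace _ _ _ _ _ (lt0r_neq0 k_gt0) qE).
have X0 : 0 <= p ^+ 2 * u ^+ 2 by rewrite mulr_ge0 ?sqr_ge0.
have a20 : 0 <= a2 by rewrite divr_ge0 ?mulr_ge0 ?ltW //; lra.
have B : a2 * \tr P * (p ^+ 2 * u ^+ 2) * u <= a2 * \tr P * (p ^+ 2 * u ^+ 2).
  by apply: ler_piMr => //; apply: mulr_ge0 => //; exact: mulr_ge0.
rewrite exprMn; exact: profile_final B (ler_wpM2r X0 (HM x qk)).
Qed.

End PolynomialTestFunction.

Section UpperBound.
Context {R : realType} {n : nat}.
Local Notation V := 'rV[R]_n.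
Context (Omega : set V) (oOmega : open Omega).

Lemma ext_eq_in f g (x : V) : closure Omega x ->
  (forall y, Omega y -> f y = g y) -> cvg (f y @[y --> within Omega (nbhs x)]) ->
  ext Omega f x = ext Omega g x.
Proof.
move=> cx fg fc; have PF : ProperFilter (within Omega (nbhs x)) by exact: within_nbhs_proper.
apply/esym/cvg_lim => //; apply: cvg_trans fc; apply: near_eq_cvg.
by apply: (filterS _ (withinT _ _)) => y /fg.
Qed.

(** A first-order expansion at a point that may lie on the boundary, uniform over directions
    pointing into [Omega]. The mean value theorem is applied on [t, s] with t > 0, and t then
    shrinks to 0, so that f enters at x0 through its limit alone. *)
Lemma cone_expansion f (x0 : V) (W : set V) Rd t0 :
  closure Omega x0 -> Ck_ext 1 Omega f -> ext Omega f x0 = 0 ->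
  0 <= Rd -> (forall d, W d -> `|d| <= Rd) ->
  (forall s d, 0 < s -> s < t0 -> W d -> Omega (x0 + s *: d)) -> 0 < t0 ->
  forall e, 0 < e -> exists2 t1, 0 < t1 & forall s d, 0 < s -> s < t1 -> W d ->
    `|f (x0 + s *: d) - s * \sum_b ext Omega (pd b f) x0 * d 0 b| <= e * s.
Proof.
move=> cx fC f0 Rd0 WR WO t00 e e0.
have hf := Ck_ext_C1 oOmega fC.
have nR : 0 < n%:R * Rd + 1 :> R by rewrite ltr_wpDl // mulr_ge0.
have e1 : 0 < e / (n%:R * Rd + 1) by rewrite divr_gt0.
have [r r0 rP] : exists2 r, 0 < r & forall b, b \in enum 'I_n ->
    forall y, Omega y -> `|x0 - y| < r ->
    `|ext Omega (pd b f) x0 - pd b f y| < e / (n%:R * Rd + 1).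
  apply: seq_min_pos => [b r r' rr' H y Oy xy|b _].
    by apply: H => //; exact: lt_le_trans xy rr'.
  have [d d0 dP] := ext_dist cx (Ck_ext_cvg (Ck_ext_pd b fC) cx) e1.
  by exists d.
have Rd1 : 0 < Rd + 1 by rewrite ltr_wpDl.
exists (Num.min t0 (r / (Rd + 1))) => [|s d s0]; first by rewrite lt_min t00 divr_gt0.
rewrite lt_min => /andP[st0 sr] Wd.
pose L := \sum_b ext Omega (pd b f) x0 * d 0 b.
have inO t : 0 < t -> t <= s -> Omega (x0 + t *: d).
  by move=> tp ts; apply: WO => //; exact: le_lt_trans ts st0.
have der t : 0 < t -> t <= s ->
    is_derive t 1 (fun s => f (x0 + s *: d) - s * L)
      (\sum_b pd b f (x0 + t *: d) * d 0 b - L).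
  move=> tp ts; apply: isderD.
    by apply: is_derive_line; exact: C1_directional oOmega hf (inO t tp ts).
  apply: isderN; have := isderM (is_derive_id t (1 : R)) (isder_cst t (1 : R) L).
  by rewrite mul1r mulr0 addr0.
have derb t : 0 < t -> t <= s -> `|\sum_b pd b f (x0 + t *: d) * d 0 b - L| <= e.
  move=> tp ts; rewrite /L -sumrB; apply: le_trans (ler_norm_sum _ _ _) _.
  apply: le_trans (_ : \sum_(b < n) e / (n%:R * Rd + 1) * Rd <= _).
    apply: ler_sum => b _; rewrite -mulrBl normrM ler_pM //.
      rewrite distrC; apply/ltW/rP; [by rewrite mem_enum|exact: inO|].
      rewrite opprD addrA subrr sub0r normrN normrZ gtr0_norm //.
      apply: le_lt_trans (_ : s * Rd < r).
        by apply: ler_pM => //; [exact: ltW|exact: WR].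
      by move: sr; rewrite ltr_pdivlMr // mulrDr mulr1; apply: le_lt_trans; rewrite lerDl ltW.
    exact: le_trans (rV_coord_le_norm _ _) (WR d Wd).
  rewrite sumr_const card_ord -[leLHS]mulr_natl mulrA mulrCA -mulrA -[leRHS]mulr1.
  apply: ler_wpM2l; first exact: ltW.
  by rewrite mulrAC ler_pdivrMr // mul1r lerDl.
have L1 : 0 < `|L| + 1 by rewrite ltr_wpDl.
apply/ler_addgt0Pr => z z0.
have z2 : 0 < z / 2 by rewrite divr_gt0.
have [q q0 qP] := ext_dist cx (Ck_ext_cvg fC cx) z2.
(* Close enough to 0 that f (x0 + t d) and t L are each at most z / 2. *)
pose t := Num.min s (Num.min (q / (Rd + 1) / 2) (z / 2 / (`|L| + 1))).
have tp : 0 < t by rewrite !lt_min s0 !divr_gt0.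
have ts : t <= s by rewrite ge_min lexx.
have tq : t <= q / (Rd + 1) / 2 by rewrite !ge_min lexx orbT.
have tz : t <= z / 2 / (`|L| + 1) by rewrite !ge_min lexx !orbT.
have H1 : `|f (x0 + t *: d)| < z / 2.
  have := qP _ (inO t tp ts); rewrite f0 sub0r normrN; apply.
  rewrite opprD addrA subrr sub0r normrN normrZ gtr0_norm //.
  have q1 : q / (Rd + 1) / 2 < q / (Rd + 1).
    by rewrite gtr_pMr ?divr_gt0 // invf_lt1 // ltr1n.
  have := le_lt_trans tq q1; rewrite ltr_pdivlMr // mulrDr mulr1; apply: le_lt_trans.
  rewrite -[leLHS]addr0; apply: lerD; last exact: ltW.
  by apply: ler_wpM2l; [exact: ltW|exact: WR].
have H2 : `|t * L| <= z / 2.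
  rewrite normrM gtr0_norm //; move: tz; rewrite ler_pdivlMr // mulrDr mulr1.
  by apply: le_trans; rewrite lerDl ltW.
have dI x : x \in `]t, s[ -> is_derive x 1 (fun s => f (x0 + s *: d) - s * L)
    (\sum_b pd b f (x0 + x *: d) * d 0 b - L).
  rewrite in_itv /= => /andP[x1 x2]; apply: der; last exact: ltW.
  exact: lt_trans tp x1.
have cI : {within `[t, s], continuous (fun s => f (x0 + s *: d) - s * L)}.
  apply: derivable_within_continuous => x; rewrite in_itv /= => /andP[x1 x2].
  by have [] := der x (lt_le_trans tp x1) x2.
have [x xts Ex] := MVT_segment ts dI cI.
move: xts; rewrite in_itv /= => /andP[x1 x2].
have H3 := derb x (lt_le_trans tp x1) x2.
rewrite -/L; have -> : f (x0 + s *: d) - s * L =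
    (\sum_b pd b f (x0 + x *: d) * d 0 b - L) * (s - t) + f (x0 + t *: d) - t * L.
  by rewrite -Ex -addrA subrK.
have H4 : `|(\sum_b pd b f (x0 + x *: d) * d 0 b - L) * (s - t)| <= e * s.
  rewrite normrM ler_pM // ger0_norm ?subr_ge0 //.
  by rewrite lerBlDr lerDl ltW.
apply: le_trans (ler_normB _ _) _.
apply: le_trans (lerD (ler_normD _ _) (lexx _)) _.
lra.
Qed.

End UpperBound.

Section OrthogonalDiagonal.
Context {R : realType} {n : nat}.
Context (Q : 'M[R]_n) (QQ : Q *m Q^T = 1%:M).

Lemma dot_orth (a b : 'rV[R]_n) : dot (a *m Q) (b *m Q) = dot a b.
Proof.
have := dot_mulmx (a *m Q) (b *m Q).
rewrite trmx_mul mulmxA -[a *m Q *m _]mulmxA QQ mulmx1 dot_mulmx.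
by move=> /matrixP/(_ 0 0); rewrite !mxE !eqxx !mulr1n => ->.
Qed.

Definition orth_diag (d : 'I_n -> R) : 'M[R]_n := Q^T *m diag_mx (\row_i d i) *m Q.

Lemma orth_diag_sym d : (orth_diag d)^T = orth_diag d.
Proof. by rewrite /orth_diag !trmx_mul trmxK tr_diag_mx mulmxA. Qed.

Lemma tr_orth_diag d : \tr (orth_diag d) = \sum_i d i.
Proof.
rewrite /orth_diag mxtrace_mulC mulmxA QQ mul1mx mxtrace_diag.
by apply: eq_bigr => i _; rewrite mxE.
Qed.

Lemma orth_coord (y : 'rV[R]_n) : y = y *m Q^T *m Q.
Proof. by rewrite -mulmxA (mulmx1C QQ) mulmx1. Qed.

Lemma mul_orth_diag d (y : 'rV[R]_n) :
  y *m orth_diag d = (\row_i (d i * (y *m Q^T) 0 i)) *m Q.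
Proof.
rewrite /orth_diag !mulmxA; congr (_ *m _); apply/rowP => i.
by rewrite mul_mx_diag !mxE mulrC.
Qed.

Lemma dot_orth_diag2 d (y : 'rV[R]_n) :
  dot (y *m orth_diag d) (y *m orth_diag d) = \sum_i d i ^+ 2 * (y *m Q^T) 0 i ^+ 2.
Proof.
rewrite mul_orth_diag dot_orth; apply: eq_bigr => i _.
by rewrite mxE -expr2 exprMn.
Qed.

Lemma dot_orth_diag1 d (y : 'rV[R]_n) :
  dot (y *m orth_diag d) y = \sum_i d i * (y *m Q^T) 0 i ^+ 2.
Proof.
rewrite {2}(orth_coord y) mul_orth_diag dot_orth; apply: eq_bigr => i _.
by rewrite mxE expr2 mulrA.
Qed.

Lemma dot_orth_id (y : 'rV[R]_n) : dot y y = \sum_i (y *m Q^T) 0 i ^+ 2.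
Proof. by rewrite {1 2}(orth_coord y) dot_orth; apply: eq_bigr => i _; rewrite expr2. Qed.

End OrthogonalDiagonal.

Section UpperAsymptotics.
Context {R : realType} {n : nat}.
Local Notation V := 'rV[R]_n.
Context (Omega : set V) (oOmega : open Omega).
Context (alpha : R) (alpha_gt0 : 0 < alpha) (m v : V -> R).
Hypothesis m_C2 : Ck_ext 2 Omega m.
Hypothesis v_cont : {within closure Omega, continuous v}.
Context (lambda : R -> R).
Hypothesis lambda_principal :
  forall D, 0 < D -> principal_eigenvalue Omega alpha m v D (lambda D).

Lemma chess_sym x : closure Omega x -> (chess Omega m x)^T = chess Omega m x.
Proof.
move=> cx; apply/matrixP => i j; rewrite !mxE; apply: (ext_eq_in cx).
  move=> y Oy.
  exact: (schwarz i j oOmega (pot_C1 oOmega m_C2) (pd_pot_C1 oOmega m_C2) Oy).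
exact: (@Ck_ext_cvg _ _ 0 _ _ x (Ck_ext_pd j (Ck_ext_pd i m_C2)) cx).
Qed.

Lemma char_poly_trace_sum (A : 'M[R]_n) (k : 'I_n -> R) : A^T = A ->
  eigenvalues A k -> \tr A = \sum_i k i.
Proof.
by move=> sA eA; have [Q [QQ ->]] := real_spectral sA eA; exact: tr_orth_diag.
Qed.

Lemma potential_near x e : closure Omega x -> 0 < e ->
  exists2 r, 0 < r & forall y, Omega y -> `|x - y| < r ->
    v y + alpha * (\sum_i pd i (pd i m) y)
    <= v x + alpha * \tr (chess Omega m x) + e.
Proof.
move=> cx e0; have PF : ProperFilter (within Omega (nbhs x)) by exact: within_nbhs_proper.
have trE : \tr (chess Omega m x) = \sum_i ext Omega (pd i (pd i m)) x.
  by apply: eq_bigr => i _; rewrite mxE.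
have L : (v y + alpha * (\sum_i pd i (pd i m) y)) @[y --> within Omega (nbhs x)] -->
    v x + alpha * \tr (chess Omega m x).
  rewrite trE; apply: flimD; first exact: v_cvg.
  apply: flimM; first exact: flim_cst.
  by apply: flim_sum => i; exact: ext_cvg_pd2.
have /nbhs_ballP[r r0 rP] : nbhs x [set y | Omega y ->
    `|v x + alpha * \tr (chess Omega m x) - (v y + alpha * (\sum_i pd i (pd i m) y))| < e].
  exact: (iffLR (@cvgrPdist_lt _ _ _ _ _ _ _) L _ e0).
exists r => // y Oy xy; have := rP y; rewrite -ball_normE => /(_ xy Oy).
by rewrite distrC => /(le_lt_trans (ler_norm _)); lra.
Qed.

Lemma profile_exponent (k N : R) : 2 <= k -> 0 <= N ->
  k / (2 * k + 1) + k / (2 * k - 1) * (1 + N / (4 * k)) <= 1 + (N + 1) / k.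
Proof.
move=> k2 N0; rewrite -subr_ge0.
have k0 : 0 < k by lra.
have k1 : 0 < 2 * k - 1 by lra.
have k3 : 0 < 2 * k + 1 by lra.
have -> : 1 + (N + 1) / k - (k / (2 * k + 1) + k / (2 * k - 1) * (1 + N / (4 * k))) =
   (N * (2 * k + 1) * (7 * k - 4) / 4 + (4 * k ^+ 2 - k - 1)) / (k * (2 * k + 1) * (2 * k - 1)).
  by field; rewrite !gt_eqF.
apply: divr_ge0; last by rewrite !mulr_ge0 // ltW.
apply: addr_ge0; last by nra.
by rewrite !mulr_ge0 //; lra.
Qed.

Lemma square_perturbation (t D' e1 C h b : R) : 0 < t -> t ^+ 2 = D' ->
  0 < e1 -> e1 <= 1 -> `|h| <= C -> `|b - t * h| <= e1 * t ->
  b ^+ 2 <= (t * h) ^+ 2 + (2 * C + 1) * e1 * D'.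
Proof.
move=> t0 <- e0 e1' hC H.
pose z := (b - t * h) / t.
have zE : b = t * h + t * z by rewrite /z; field; rewrite gt_eqF.
have ze : `|z| <= e1 by rewrite /z normrM normfV (gtr0_norm t0) ler_pdivrMr.
have hz : h * z <= C * e1.
  by apply: le_trans (ler_norm _) _; rewrite normrM; exact: ler_pM.
have zz : z ^+ 2 <= e1.
  rewrite -real_normK ?num_real // expr2 -[leRHS]mulr1.
  by apply: ler_pM => //; exact: le_trans ze e1'.
have -> : b ^+ 2 = t ^+ 2 * (h ^+ 2 + 2 * (h * z) + z ^+ 2) by rewrite zE; ring.
have -> : (t * h) ^+ 2 + (2 * C + 1) * e1 * t ^+ 2 = t ^+ 2 * (h ^+ 2 + (2 * C + 1) * e1).
  by ring.
by apply: ler_wpM2l; [exact: sqr_ge0|lra].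
Qed.

(** Interior points (nu = 0) and boundary points (nu normal) in one statement. The cone hypothesis,
    taken at s = sqrt D, makes room in [Omega] for a test function of width r sqrt D around x0 +
    sqrt D c nu; as nu H = 0, the shift leaves the linear part of grad m unchanged. *)
Lemma lambda_upper x0 nu (kap : 'I_n -> R) :
  critical_point Omega m x0 -> eigenvalues (chess Omega m x0) kap ->
  nu *m chess Omega m x0 = 0 ->
  (forall r, 0 < r -> exists c t0, 0 < t0 /\ forall s w, 0 < s -> s < t0 ->
     `|w| <= r -> Omega (x0 + s *: (c *: nu + w))) ->
  forall e, 0 < e -> exists2 D0, 0 < D0 & forall D, 0 < D -> D < D0 ->
    lambda D <= v x0 + alpha * \sum_i (`|kap i| + kap i) + e.
Proof.
move=> [cx crit] eigk Hnu cone e e0.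
set H := chess Omega m x0 in eigk Hnu.
have sH : H^T = H := chess_sym cx.
have [Q [QQ HE]] := real_spectral sH eigk.
have n0 : 0 <= n%:R :> R by [].
have trH : \tr H = \sum_i kap i := char_poly_trace_sum sH eigk.
(* P = |H| + eta is positive definite even if H is singular, so the sublevel sets of the quadratic
   form are bounded; the extra trace costs at most e / 8. *)
pose eta := e / (8 * (alpha * n%:R + 1)).
have an : 0 <= alpha * n%:R by rewrite mulr_ge0 // ltW.
have eta0 : 0 < eta by rewrite divr_gt0 // mulr_gt0 // ltr_wpDl.
have etae : alpha * (n%:R * eta) <= e / 8.
  rewrite /eta mulrA mulrA ler_pdivrMr ?mulr_gt0 ?ltr_wpDl // mulrC; nra.
pose d i := `|kap i| + eta.
have d0 i : 0 < d i by rewrite ltr_wpDl.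
pose P := orth_diag Q d.
have sP : P^T = P := orth_diag_sym Q d.
have trP : \tr P = \sum_i `|kap i| + n%:R * eta.
  by rewrite tr_orth_diag // big_split /= sumr_const card_ord mulr_natl.
have trP0 : 0 <= \tr P.
  by rewrite trP; apply: addr_ge0; [exact: sumr_ge0|apply: mulr_ge0 => //; exact: ltW].
have Ppos y : eta * dot y y <= dot (y *m P) y.
  rewrite dot_orth_diag1 // (dot_orth_id QQ) mulr_sumr; apply: ler_sum => i _.
  by apply: ler_wpM2r; [exact: sqr_ge0|rewrite /d lerDr].
have HP y : dot (y *m H) (y *m H) <= dot (y *m P) (y *m P).
  have -> : H = orth_diag Q kap by [].
  rewrite !dot_orth_diag2 //; apply: ler_sum => i _.
  apply: ler_wpM2r; first exact: sqr_ge0.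
  rewrite -[kap i ^+ 2]real_normK ?num_real // lerXn2r ?nnegrE ?(ltW (d0 i)) //.
  by rewrite /d lerDl ltW.
(* A degree for which the loss against the Gaussian, bounded in [profile_exponent], is at most e /
   8. *)
pose l := Num.bound (8 * (alpha * \tr P * (n%:R + 1)) / e).
pose k : R := l.+2%:R.
have k2 : 2 <= k by rewrite /k ler_nat.
have k0 : 0 < k by lra.
have kb : alpha * \tr P * ((n%:R + 1) / k) <= e / 8.
  have aP : 0 <= alpha * \tr P * (n%:R + 1).
    by apply: mulr_ge0; [apply: mulr_ge0 => //; exact: ltW|exact: addr_ge0].
  have B : 8 * (alpha * \tr P * (n%:R + 1)) / e < l%:R.
    by apply: archi_boundP; apply: divr_ge0; [exact: mulr_ge0|exact: ltW].
  rewrite ltr_pdivrMr // in B.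
  have kl : l%:R * e <= k * e.
    by apply: ler_wpM2r; [exact: ltW|rewrite /k ler_nat -addn2 leq_addr].
  by rewrite mulrA ler_pdivrMr //; lra.
(* On quad <= 2 k, the displacement divided by sqrt D has square at most K0, hence norm at most r0 =
   K0 + 1. This radius does not involve D, so [c] is fixed before D is chosen. *)
pose K0 := 2 * k / (alpha * eta).
have K00 : 0 < K0 by apply: divr_gt0; exact: mulr_gt0.
pose r0 := K0 + 1.
have r00 : 0 < r0 by apply: addr_gt0.
have [c [t0 [t00 coneO]]] := cone r0 r00.
pose W := [set z | exists2 w : V, `|w| <= r0 & z = c *: nu + w].
pose Rd := `|c| * `|nu| + r0.
have Rd0 : 0 <= Rd by apply: addr_ge0; [exact: mulr_ge0|exact: ltW].
have WR z : W z -> `|z| <= Rd.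
  move=> [w wr ->]; apply: le_trans (ler_normD _ _) _.
  by rewrite normrZ /Rd lerD2l.
have WO s z : 0 < s -> s < t0 -> W z -> Omega (x0 + s *: z).
  by move=> s0 st [w wr ->]; exact: coneO.
pose CL := \sum_a \sum_b `|H b a|.
have CL0 : 0 <= CL by apply: sumr_ge0 => a _; exact: sumr_ge0.
pose C1' := alpha ^+ 2 * (n%:R * (2 * (r0 * CL) + 1)).
have C10 : 0 <= C1'.
  apply: mulr_ge0; first exact: sqr_ge0.
  apply: mulr_ge0 => //; apply: addr_ge0 => //; apply: mulr_ge0 => //.
  by apply: mulr_ge0 => //; exact: ltW.
(* The relative error allowed in grad m = t w H on the support; [C1'] is the factor it picks up in
   alpha^2 |grad m|^2 / D, and e1 <= 1 bounds its square by itself. *)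
pose e1 := Num.min 1 (e / (8 * (C1' + 1))).
have e10 : 0 < e1 by rewrite lt_min ltr01 divr_gt0 // mulr_gt0 // ltr_wpDl.
have e11 : e1 <= 1 by rewrite ge_min lexx.
have e1e : C1' * e1 <= e / 8.
  have e12 : e1 <= e / (8 * (C1' + 1)) by rewrite ge_min lexx orbT.
  apply: le_trans (ler_wpM2l C10 e12) _.
  by rewrite mulrA ler_pdivrMr ?mulr_gt0 ?ltr_wpDl // mulrC; nra.
have [t1 t10 t1P] : exists2 t1, 0 < t1 & forall a, a \in enum 'I_n ->
    forall s z, 0 < s -> s < t1 -> W z ->
    `|pd a m (x0 + s *: z) - s * \sum_b ext Omega (pd b (pd a m)) x0 * z 0 b| <= e1 * s.
  apply: seq_min_pos => [a t t' tt' h s z s0 st|a _].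
    by apply: h => //; exact: lt_le_trans st tt'.
  exact: (cone_expansion oOmega cx (Ck_ext_pd a m_C2) (crit a) Rd0 WR WO t00 e10).
have [r rp rP] := potential_near cx (divr_gt0 e0 (ltr0n R 8)).
have Rd1 : 0 < Rd + 1 by rewrite ltr_wpDl.
pose tm := Num.min t0 (Num.min t1 (r / (Rd + 1))).
have tm0 : 0 < tm by rewrite !lt_min t00 t10 divr_gt0.
exists (tm ^+ 2); first by rewrite exprn_gt0.
move=> D D0 Dt.
pose t := Num.sqrt D.
have t_gt0 : 0 < t by rewrite sqrtr_gt0.
have tt : t ^+ 2 = D by rewrite sqr_sqrtr // ltW.
have ttm : t < tm.
  by rewrite -[tm]ger0_norm ?(ltW tm0) // -sqrtr_sqr ltr_sqrt // exprn_gt0.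
move: ttm; rewrite !lt_min => /and3P[tt0 tt1 ttr].
have [[phi phi_eig phi0] _] := lambda_principal D0.
pose xc := x0 + (t * c) *: nu.
have nearP x : quad alpha D P xc x <= 2 * k ->
    exists2 w : V, `|w| <= r0 & x = x0 + t *: (c *: nu + w) /\ x - xc = t *: w.
  rewrite /quad /zvec => qx; set y := x - xc in qx.
  have yD : dot y y <= K0 * D.
    have h := le_trans (ler_wpM2l (ltW (divr_gt0 alpha_gt0 D0)) (Ppos y)) qx.
    have c0 : 0 <= D / (alpha * eta).
      by apply: divr_ge0; apply: ltW => //; exact: mulr_gt0.
    have := ler_wpM2r c0 h; rewrite /K0; move: (dot y y) => q hq.
    have -> : q = alpha / D * (eta * q) * (D / (alpha * eta)).
      by field; rewrite !gt_eqF.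
    by apply: le_trans hq _; rewrite mulrA mulrAC.
  exists (t^-1 *: y); last first.
    rewrite scalerDr !scalerA mulfV ?gt_eqF // scale1r; split => //.
    by rewrite addrA -/xc /y addrC subrK.
  have : `|t^-1 *: y| ^+ 2 <= K0.
    apply: le_trans (norm_dot_le _) _.
    have -> : dot (t^-1 *: y) (t^-1 *: y) = dot y y / D.
      rewrite -tt /dot mulr_suml; apply: eq_bigr => i _; rewrite !mxE.
      by field; rewrite gt_eqF.
    by rewrite ler_pdivrMr.
  have : 0 <= `|t^-1 *: y| by [].
  rewrite /r0; move: (`|_|) => z z0 zK; nra.
have qcont : continuous (quad alpha D P xc).
  by move=> x; exact: (C1_cont (C1_quad alpha D sP xc (U := setT)) I).
have q0 x : 0 <= quad alpha D P xc x.
  apply: mulr_ge0; first by apply: divr_ge0; exact: ltW.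
  apply: le_trans (Ppos _).
  by apply: mulr_ge0; [exact: ltW|exact: dot_ge0].
apply: le_trans (eigenvalue_le_profile (l := l) oOmega alpha_gt0 (pot_C1 oOmega m_C2)
  (pd_pot_C1 oOmega m_C2) (v_cfor oOmega v_cont) D0 phi_eig phi0 sP
  (M := v x0 + alpha * \tr H + e / 8 + e / 8) (c := xc) trP0 q0 _ _ _) _.
- apply: bounded_closed_compact.
    exists (`|x0| + t * Rd); split; first exact: num_real.
    move=> N MN x /= /nearP[w wr [-> _]]; apply: le_trans (ltW MN).
    apply: le_trans (ler_normD _ _) _; rewrite lerD2l normrZ gtr0_norm // ler_pM2l //.
    by apply: WR; exists w.
  rewrite (_ : [set x | _] = quad alpha D P xc @^-1` [set s | s <= 2 * k]) //.
  by apply: closed_comp; [move=> x _; exact: qcont|exact: closed_le].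
- by move=> x /= /nearP[w wr [-> _]]; apply: WO => //; exists w.
- move=> x /ltW /nearP[w wr [xE yE]].
  have Ww : W (c *: nu + w) by exists w.
  have Ox : Omega x by rewrite xE; exact: WO.
  have xr : `|x0 - x| < r.
    rewrite xE opprD addrA subrr sub0r normrN normrZ gtr0_norm //.
    move: ttr; rewrite ltr_pdivlMr // mulrDr mulr1; apply: le_lt_trans.
    rewrite -[leLHS]addr0; apply: lerD; last exact: ltW.
    by apply: ler_wpM2l; [exact: ltW|exact: WR].
  apply: lerD; first exact: rP.
  have EH a : `|pd a m x - t * (w *m H) 0 a| <= e1 * t.
    have := t1P a (mem_enum _ a) t _ t_gt0 tt1 Ww; rewrite -xE.
    rewrite (_ : \sum_b _ = (w *m H) 0 a) //.
    have -> : (w *m H) 0 a = ((c *: nu + w) *m H) 0 a.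
      by rewrite mulmxDl -scalemxAl Hnu scaler0 add0r.
    by rewrite mxE; apply: eq_bigr => b _; rewrite [H b a]mxE mulrC.
  have wH a : `|(w *m H) 0 a| <= r0 * CL.
    rewrite mxE; apply: le_trans (ler_norm_sum _ _ _) _.
    apply: le_trans (_ : \sum_b r0 * `|H b a| <= _).
      apply: ler_sum => b _; rewrite normrM; apply: ler_wpM2r => //.
      exact: le_trans (rV_coord_le_norm _ _) wr.
    rewrite -mulr_sumr; apply: ler_wpM2l; first exact: ltW.
    by rewrite /CL [leRHS](bigD1 a) //= lerDl; apply: sumr_ge0 => b _; exact: sumr_ge0.
  have zH : \sum_a (t * (w *m H) 0 a) ^+ 2 <= dot (zvec P xc x) (zvec P xc x).
    rewrite /zvec yE; apply: le_trans (HP _).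
    by rewrite -scalemxAl /dot; apply: ler_sum => a _; rewrite !mxE expr2.
  have S : \sum_a pd a m x ^+ 2 <= \sum_a (t * (w *m H) 0 a) ^+ 2 +
      n%:R * ((2 * (r0 * CL) + 1) * e1 * D).
    have -> : n%:R * ((2 * (r0 * CL) + 1) * e1 * D) =
        \sum_(a < n) ((2 * (r0 * CL) + 1) * e1 * D).
      by rewrite sumr_const card_ord mulr_natl.
    rewrite -big_split /=; apply: ler_sum => a _.
    exact: square_perturbation t_gt0 tt e10 e11 (wH a) (EH a).
  apply: le_trans (_ : alpha ^+ 2 / D * (n%:R * ((2 * (r0 * CL) + 1) * e1 * D)) <= _).
    apply: ler_wpM2l; first by apply: divr_ge0; [exact: sqr_ge0|exact: ltW].
    by move: S zH; lra.
  apply: le_trans e1e; rewrite /C1'.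
  have -> : alpha ^+ 2 / D * (n%:R * ((2 * (r0 * CL) + 1) * e1 * D)) =
      alpha ^+ 2 * (n%:R * (2 * (r0 * CL) + 1)) * e1 by field; rewrite gt_eqF.
  exact: lexx.
rewrite -/k.
have -> : alpha * k / (2 * k + 1) + alpha * k / (2 * k - 1) * (1 + n%:R / (4 * k)) =
    alpha * (k / (2 * k + 1) + k / (2 * k - 1) * (1 + n%:R / (4 * k))).
  by rewrite [RHS]mulrDr !mulrA.
have aT : 0 <= alpha * \tr P by apply: mulr_ge0 => //; exact: ltW.
have := ler_wpM2l aT (profile_exponent k2 n0).
have -> : \sum_i (`|kap i| + kap i) = \sum_i `|kap i| + \tr H by rewrite big_split trH.
have aP : alpha * \tr P = alpha * (\sum_i `|kap i|) + alpha * (n%:R * eta).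
  by rewrite trP mulrDr.
rewrite [\tr P * _]mulrCA mulrA; move: (_ * (k / _ + _)) => X.
rewrite mulrDr mulr1.
move: kb; move: (alpha * \tr P * _) => Y; rewrite aP mulrDr.
move: (alpha * \tr H) (alpha * _) (alpha * _) etae => A B C.
lra.
Qed.

End UpperAsymptotics.

(** * Geometry of the critical points *)

Section ConeCondition.
Context {R : realType} {n : nat}.
Local Notation V := 'rV[R]_n.
Context (Omega : set V) (oOmega : open Omega).

Lemma interior_cone (x0 : V) : Omega x0 ->
  forall r, 0 < r -> exists c t0, 0 < t0 /\ forall s (w : V), 0 < s -> s < t0 ->
     `|w| <= r -> Omega (x0 + s *: (c *: 0 + w)).
Proof.
move=> Ox r r0.
have /nbhs_ballP[q q0 qP] : nbhs x0 Omega by move/open_nbhs_nbhs: (conj oOmega Ox).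
exists 0, (q / r); split; first exact: divr_gt0.
move=> s w s0 sq wr; apply: qP; rewrite -ball_normE /= scaler0 add0r.
rewrite opprD addrA subrr sub0r normrN normrZ gtr0_norm //.
by apply: le_lt_trans (ler_wpM2l (ltW s0) wr) _; rewrite -ltr_pdivlMr.
Qed.

(** Far enough along the inner normal, the linear part of [rho] drops by at least s against any w
    with |w| <= r, which beats a Frechet remainder of at most s / 2. *)
Lemma boundary_cone (x0 : V) nu : boundary Omega x0 ->
  unit_exterior_normal Omega x0 nu ->
  forall r, 0 < r -> exists c t0, 0 < t0 /\ forall s (w : V), 0 < s -> s < t0 ->
     `|w| <= r -> Omega (x0 + s *: (c *: nu + w)).
Proof.
move=> [cx _] [U [rho [[oU Ux Crho rhoP gr0] ->]]] r r0.
have hrho := Ck_C1 (Crho 1%N).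
set g := grad rho x0 in gr0 *.
have gE i : pd i rho x0 = g 0 i by rewrite mxE.
have rho0 : rho x0 <= 0.
  rewrite leNgt; apply/negP => rp.
  have [d d0 dP] := iffLR (cfor_distP _ _) (C1_cont hrho Ux) _ rp.
  have /nbhs_ballP[q q0 qP] : nbhs x0 U by move/open_nbhs_nbhs: (conj oU Ux).
  have dq : 0 < Num.min d q by rewrite lt_min d0.
  have [y Oy] := closure_dist cx dq.
  rewrite lt_min => /andP[xd xq].
  have Uy : U y by apply: qP; rewrite -ball_normE.
  have := dP y xd; have := (rhoP y Uy).1 Oy => ry.
  by rewrite gtr0_norm; lra.
have G0 : 0 < dot g g by rewrite lt0r dot_eq0 gr0 dot_ge0.
have E0 : 0 < enorm g by rewrite sqrtr_gt0.
have EE : enorm g ^+ 2 = dot g g by rewrite sqr_sqrtr // ltW.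
pose L := \sum_i `|g 0 i|.
have L0 : 0 <= L by apply: sumr_ge0.
(* Gives - c' |g| + g . w <= - 1 whenever |w| <= r, as g . w <= L r. *)
pose c' := (L * r + 1) / enorm g.
have Lr : 0 <= L * r by apply: mulr_ge0 => //; exact: ltW.
have c'0 : 0 < c' by rewrite divr_gt0 // ltr_wpDl.
set nu' := (enorm g)^-1 *: g.
pose K := c' * `|nu'| + r.
have K0 : 0 < K by rewrite ltr_wpDl // mulr_ge0 // ltW.
have e0 : 0 < (2 * K)^-1 by rewrite invr_gt0 mulr_gt0.
have [q q0 qP] := C1_frechet oU hrho Ux e0.
have /nbhs_ballP[q1 q10 q1P] : nbhs x0 U by move/open_nbhs_nbhs: (conj oU Ux).
exists (- c'), (Num.min (q / K) (q1 / K)); split.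
  by rewrite lt_min !divr_gt0.
move=> s w s0; rewrite lt_min !ltr_pdivlMr // => /andP[sq sq1] wr.
set h := s *: _.
have hK : `|h| <= s * K.
  rewrite normrZ gtr0_norm // ler_pM2l //; apply: le_trans (ler_normD _ _) _.
  by rewrite normrZ normrN (gtr0_norm c'0) /K lerD2l.
have Uh : U (x0 + h).
  apply: q1P; rewrite -ball_normE /= opprD addrA subrr sub0r normrN.
  exact: le_lt_trans sq1.
apply/(rhoP _ Uh).
have H := qP h (le_lt_trans hK sq).
have S1 : \sum_i pd i rho x0 * h 0 i = s * (- c' * (enorm g) + dot g w).
  rewrite mulrDr; rewrite {1}(_ : enorm g = (enorm g)^-1 * dot g g); last first.
    by rewrite -EE; field; rewrite gt_eqF.
  rewrite /dot !mulr_sumr -big_split /=; apply: eq_bigr => i _.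
  have -> : h 0 i = s * (- c' * ((enorm g)^-1 * g 0 i) + w 0 i).
    by rewrite /h mxE [(_ + w) 0 i]mxE mxE [nu' 0 i]mxE.
  by rewrite gE; ring.
have S2 : dot g w <= L * r.
  rewrite /L mulr_suml; apply: ler_sum => i _; apply: le_trans (ler_norm _) _.
  rewrite normrM; apply: ler_wpM2l => //.
  exact: le_trans (rV_coord_le_norm _ _) wr.
have S3 : - c' * enorm g = - (L * r + 1) by rewrite /c' mulNr divfK // gt_eqF.
have S4 : (2 * K)^-1 * `|h| <= s / 2.
  apply: le_trans (ler_wpM2l (ltW e0) hK) _.
  by have -> : (2 * K)^-1 * (s * K) = s / 2 by field; rewrite gt_eqF.
move: (le_trans (ler_norm _) H); rewrite S1 S3.
have S5 : s * (- (L * r + 1) + dot g w) <= - s.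
  by rewrite -[leRHS]mulr1 mulNr -mulrN; apply: ler_wpM2l; [exact: ltW|lra].
move: S5 S4; move: (s * _) (_ * `|h|) => a b; lra.
Qed.

End ConeCondition.

Section SignMatrix.
Context {R : realType} {n : nat}.

Lemma orth_diagM (Q : 'M[R]_n) a b : Q *m Q^T = 1%:M ->
  orth_diag Q a *m orth_diag Q b = orth_diag Q (fun i => a i * b i).
Proof.
move=> QQ; rewrite /orth_diag !mulmxA -[_ *m Q *m Q^T]mulmxA QQ mulmx1.
congr (_ *m _); rewrite -!mulmxA; congr (_ *m _).
by rewrite mulmx_diag; congr diag_mx; apply/rowP => i; rewrite !mxE.
Qed.

(** The sign of H attains tr (S H) = sum |k_i|; scaling it by 1 - t buys strict contraction at the
    price t sum |k_i| < e. *)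
Lemma sign_matrix (H : 'M[R]_n) (k : 'I_n -> R) e : H^T = H -> eigenvalues H k ->
  0 < e -> exists2 S : 'M[R]_n,
    exists2 rho, rho < 1 & forall u : 'rV[R]_n, dot (u *m S) (u *m S) <= rho * dot u u &
    \sum_i `|k i| - e < \tr (S *m H).
Proof.
move=> sH eH e0; have [Q [QQ HE]] := real_spectral sH eH.
have HO : H = orth_diag Q k by [].
set A := \sum_i `|k i|.
have A0 : 0 <= A by apply: sumr_ge0.
pose t := Num.min 2^-1 (e / (2 * (A + 1))).
have A1 : 0 < 2 * (A + 1) by rewrite mulr_gt0 // ltr_wpDl.
have t0 : 0 < t by rewrite lt_min invr_gt0 divr_gt0 // ltr0n.
have t1 : t <= 2^-1 by rewrite ge_min lexx.
have t2 : t * A < e.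
  have : t <= e / (2 * (A + 1)) by rewrite ge_min lexx orbT.
  by rewrite ler_pdivlMr //; nra.
exists (orth_diag Q (fun i => (1 - t) * Num.sg (k i))).
  exists ((1 - t) ^+ 2); first by rewrite expr_lt1 //; lra.
  move=> u; rewrite dot_orth_diag2 // (dot_orth_id QQ) mulr_sumr; apply: ler_sum => i _.
  apply: ler_wpM2r; first exact: sqr_ge0.
  rewrite exprMn ler_piMr ?sqr_ge0 // sqr_sg.
  by case: (_ == _).
rewrite HO orth_diagM // tr_orth_diag //.
rewrite (eq_bigr (fun i => (1 - t) * `|k i|)); last first.
  by move=> i _; rewrite -mulrA -normrEsg.
by rewrite -mulr_sumr -/A; lra.
Qed.

End SignMatrix.

(** * Conclusion: the limit and its minimizer *)

Lemma near_right0 (R : realType) (P : R -> Prop) :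
  (exists2 D0, 0 < D0 & forall D, 0 < D -> D < D0 -> P D) ->
  \forall D \near (0 : R)^'+, P D.
Proof.
move=> [D0 D00 H]; near=> D; apply: H; near: D.
  exact: nbhs_right_gt.
exact: nbhs_right_lt.
Unshelve. all: end_near. Qed.

Lemma critical_pointP (R : realType) n (Omega : set 'rV[R]_n) m x : open Omega ->
  (Sigma1 Omega m `|` Sigma2 Omega m) x <-> critical_point Omega m x.
Proof.
move=> oO; have iO : interior Omega = Omega.
  apply/seteqP; split=> y; first exact: interior_subset.
  by move=> Oy; exact: open_nbhs_nbhs (conj oO Oy).
have E : enorm (cgrad Omega m x) = 0 <-> forall i, ext Omega (pd i m) x = 0.
  split=> [/eqP|H].
    by rewrite enorm_eq0 => /eqP/rowP H i; have := H i; rewrite !mxE.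
  by apply/eqP; rewrite enorm_eq0; apply/eqP/rowP => i; rewrite !mxE.
split=> [[[Ox /E H]|[[cx _] /E H]]|[cx /E H]].
- by split => //; exact: subset_closure.
- by split.
- have [Ox|Ox] := pselect (Omega x); [by left|right].
  by split=> //; split=> //; rewrite iO.
Qed.

Lemma bounded_closure_compact (R : realType) n (A : set 'rV[R]_n) :
  bounded_set A -> compact (closure A).
Proof.
move=> [M [_ AM]]; apply: bounded_closed_compact; last exact: closed_closure.
exists (M + 1); split; first exact: num_real.
move=> N MN x cx; apply: le_trans (ltW MN).
have d0 : 0 < (1 / 2 : R) by rewrite divr_gt0.
have [y Ay xy] := closure_dist cx d0.
have yM : `|y| <= M + 1 / 2 by apply: AM => //; rewrite ltrDl.
by have := ler_normD (x - y) y; rewrite subrK; lra.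
Qed.

Theorem theorem1p3 (R : realType) (N : nat) (N_gt0 : (0 < N)%N)
    (Omega : set 'rV[R]_N) (Omega_dom : bounded_smooth_domain Omega)
    (n : 'rV[R]_N -> 'rV[R]_N)
    (n_normal : forall x, boundary Omega x ->
       unit_exterior_normal Omega x (n x))
    (alpha : R) (alpha_gt0 : 0 < alpha)
    (m : 'rV[R]_N -> R) (m_C2 : Ck_closure 2 Omega m)
    (V : 'rV[R]_N -> R) (V_C0 : {within closure Omega, continuous V})
    (lambda : R -> R)
    (lambda_principal : forall D : R, 0 < D ->
       principal_eigenvalue Omega alpha m V D (lambda D))
    (kappa : 'rV[R]_N -> 'I_N -> R)
    (kappa_eig : forall x, closure Omega x ->
       eigenvalues (chess Omega m x) (kappa x)) :
  (Sigma1 Omega m `|` Sigma2 Omega m = set0 ->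
     lambda D @[D --> 0^'+] --> +oo)
  /\
  (Sigma1 Omega m `|` Sigma2 Omega m !=set0 ->
   (forall x, Sigma2 Omega m x -> eigenvector (chess Omega m x) 0 (n x)) ->
   exists2 mu : R,
     is_min (Sigma1 Omega m `|` Sigma2 Omega m)
       (fun x => V x + alpha * \sum_(i < N) (`|kappa x i| + kappa x i)) mu
     & lambda D @[D --> 0^'+] --> mu).
Proof.
have [_ oO _ bO _] := Omega_dom.
have cO := bounded_closure_compact bO.
have [_ m_ext] := m_C2.
pose F x := V x + alpha * \sum_(i < N) (`|kappa x i| + kappa x i).
have lower (f : 'rV[R]_N -> R) :
    (forall x, critical_point Omega m x -> f x < F x) ->
    exists2 s : seq 'rV[R]_N, forall x, x \in s -> critical_point Omega m x &
    forall f0, (forall x, x \in s -> f0 <= f x) -> forall e, 0 < e ->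
    exists2 D0, 0 < D0 & forall D, 0 < D -> D < D0 -> f0 - e <= lambda D.
  move=> fF; apply: (lambda_lower oO cO alpha_gt0 m_ext V_C0 lambda_principal) => x crit.
  have [cx _] := crit; have sH := chess_sym oO m_ext cx.
  have e0 : 0 < (F x - f x) / alpha by rewrite divr_gt0 // subr_gt0 fF.
  have [S Srho SH] := sign_matrix sH (kappa_eig x cx) e0.
  exists S => //; rewrite /local_energy_ext.
  have -> : \sum_i ext Omega (pd i (pd i m)) x = \sum_i kappa x i.
    by rewrite -(char_poly_trace_sum sH (kappa_eig x cx)); apply: eq_bigr => i _; rewrite mxE.
  have -> : \sum_k \sum_i S k i * ext Omega (pd i (pd k m)) x = \tr (S *m chess Omega m x).
    by apply: eq_bigr => k _; rewrite mxE; apply: eq_bigr => i _; rewrite mxE.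
  move: SH; rewrite ltrBlDr -ltrBlDl; move: (\tr _) => T.
  rewrite -[X in X < _](@mulfK _ alpha) ?gt_eqF //.
  rewrite ltr_pM2r ?invr_gt0 // /F big_split /=; lra.
have upper x : critical_point Omega m x ->
    (forall y, Sigma2 Omega m y -> eigenvector (chess Omega m y) 0 (n y)) ->
    forall e, 0 < e -> exists2 D0, 0 < D0 & forall D, 0 < D -> D < D0 ->
    lambda D <= F x + e.
  move=> crit eig e e0; have [cx _] := crit.
  have [Ox|nOx] := pselect (Omega x).
    apply: (lambda_upper oO alpha_gt0 m_ext V_C0 lambda_principal crit (kappa_eig x cx)
      (mul0mx _ _) (interior_cone oO Ox)) => //.
  have [//|S2] := iffRL (critical_pointP m x oO) crit; first by move=> [].
  have [bx _] := S2; have [_ Hn] := eig x S2.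
  have nH : n x *m chess Omega m x = 0.
    rewrite -[chess _ _ _](chess_sym oO m_ext cx) -[n x]trmxK -trmx_mul Hn.
    by rewrite scale0r trmx0.
  exact: (lambda_upper oO alpha_gt0 m_ext V_C0 lambda_principal crit (kappa_eig x cx)
    nH (boundary_cone bx (n_normal x bx))).
split=> [noS|[x0 Sx0] eig].
  have nocrit x : ~ critical_point Omega m x.
    by move=> /(critical_pointP m x oO); rewrite noS.
  (* The list consists of critical points, so it is empty and every [f0] is admissible. *)
  have [s sP H] := lower (fun=> 0) (fun x crit => False_ind _ (nocrit x crit)).
  apply/cvgryPge => A; apply: near_right0.
  have [|D0 D00 HD] := H (A + 1) _ 1 ltr01; first by move=> x /sP /nocrit.
  by exists D0 => // D Dp DD; have := HD D Dp DD; rewrite addrK.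
have crit0 : critical_point Omega m x0 by exact/(critical_pointP m x0 oO).
have contra f0 e x : 0 < e -> critical_point Omega m x -> F x + 2 * e < f0 ->
    (exists2 D0, 0 < D0 & forall D, 0 < D -> D < D0 -> f0 - e <= lambda D) -> False.
  move=> e0 crit lt [D0 D00 H]; have [D1 D10 H1] := upper x crit eig e e0.
  pose D := Num.min D0 D1 / 2.
  have Dp : 0 < D by rewrite divr_gt0 // lt_min D00.
  have Dm : D < Num.min D0 D1 by rewrite gtr_pMr ?invf_lt1 ?ltr1n // lt_min D00.
  move: Dm; rewrite lt_min => /andP[DD0 DD1].
  by have := H D Dp DD0; have := H1 D Dp DD1; lra.
have [x1 [crit1 min1]] : exists x1, critical_point Omega m x1 /\
    forall x, critical_point Omega m x -> F x1 <= F x.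
  apply: contrapT => nomin.
  (* Without a minimizer every critical x has a strictly better b x. The midpoint of F x and F (b x)
     is admissible in [lower], since it is below F x, yet it is still beaten by F (b x). *)
  have better x : exists y, critical_point Omega m x ->
      critical_point Omega m y /\ F y < F x.
    have [crit|ncrit] := pselect (critical_point Omega m x); last by exists x.
    apply: contrapT => H; apply: nomin; exists x; split => // y cy.
    by rewrite leNgt; apply/negP => yx; apply: H; exists y.
  have [b bP] := choice better.
  have [|s sP H] := lower (fun x => (F x + F (b x)) / 2).
    by move=> x /bP[_ bx]; lra.
  (* The best of [x0] and of the b x over the finite list lies below all midpoints, so the upper
     bound at it contradicts the lower bound; [x0] covers the empty list. *)
  have [x2 [crit2 x2P]] : exists x2, critical_point Omega m x2 /\
      forall x, x \in s -> (F x2 < (F x + F (b x)) / 2).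
    clear H; elim: s sP => [|x s ih] sP; first by exists x0.
    have [|x2 [crit2 x2P]] := ih; first by move=> y ys; apply: sP; rewrite inE ys orbT.
    have [cb bx] := bP x (sP x (mem_head _ _)).
    case: (lerP (F x2) (F (b x))) => h.
      exists x2; split=> // y; rewrite inE => /predU1P[->|/x2P//]; lra.
    exists (b x); split=> // y; rewrite inE => /predU1P[->|/x2P]; lra.
  have [e0 e00 e0P] : exists2 e0, 0 < e0 & forall x, x \in s ->
      F x2 + 3 * e0 <= (F x + F (b x)) / 2.
    apply: seq_min_pos => [x r r' rr' h|x xs]; first by lra.
    by have h := x2P x xs; exists (((F x + F (b x)) / 2 - F x2) / 3); lra.
  apply: (contra (F x2 + 3 * e0) e0 x2) => //; first by lra.
  exact: H.
exists (F x1).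
  split; first by exists x1; first exact: (iffRL (critical_pointP m x1 oO) crit1).
  by move=> x Sx; exact: (min1 x (iffLR (critical_pointP m x oO) Sx)).
apply/cvgrPdist_lt => e e0.
have e3 : 0 < e / 3 by rewrite divr_gt0.
have [|s sP H] := lower (fun x => F x - e / 3); first by move=> x _; lra.
have [|D0 D00 HL] := H (F x1 - e / 3) _ _ e3.
  by move=> x /sP /min1 h; lra.
have [D1 D10 HU] := upper x1 crit1 eig _ e3.
apply: near_right0; exists (Num.min D0 D1); first by rewrite lt_min D00.
move=> D Dp; rewrite lt_min => /andP[DD0 DD1].
have h1 := HL D Dp DD0; have h2 := HU D Dp DD1.
by rewrite ltr_norml; apply/andP; split; lra.
Qed.
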